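(* Let $D\subset\mathbb{C}$ be a domain, let $\mathcal{F}$ be a family of meromorphic functions on $D$, and let $\psi\not\equiv 0,\infty$ be a meromorphic function on $D$. Suppose that: (1) for every $f\in\mathcal{F}$, every zero of $f$ has multiplicity at least $2$; (2) for every $f\in\mathcal{F}$, every pole of $f$ has multiplicity at least $3$; (3) for every $f\in\mathcal{F}$, at each common zero of $f$ and $\psi$ the multiplicity of the zero of $f$ is strictly larger than that of the zero of $\psi$, and at each common pole of $f$ and $\psi$ the multiplicity of the pole of $f$ is strictly larger than that of the pole of $\psi$; (4) every pair $f,g\in\mathcal{F}$ shares $\psi$ in $D$. Then $\mathcal{F}$ is normal in $D$.
   Context: A domain is a nonempty connected open subset of $\mathbb{C}$. Meromorphic functions are regarded as maps to the Riemann sphere $\mathbb{C}\cup\{\infty\}$, taking the value $\infty$ at poles. Two meromorphic functions $f,g$ on $D$ share a meromorphic function $\psi$ in $D$ if $\{z\in D: f(z)=\psi(z)\}=\{z\in D: g(z)=\psi(z)\}$, where equality is equality of values in $\mathbb{C}\cup\{\infty\}$ (so a common pole of $f$ and $\psi$ counts as a point where $f(z)=\psi(z)$). A family of meromorphic functions on $D$ is normal in $D$ if every sequence in the family has a subsequence which converges uniformly on compact subsets of $D$, with respect to the spherical metric, to a meromorphic function on $D$ or to the constant $\infty$. *)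

(* Defs.v *)
From HB Require Import structures.
From mathcomp Require Import all_boot all_order all_algebra.
From mathcomp Require Import all_classical all_reals all_analysis.
From mathcomp.real_closed Require Import complex.
Set Implicit Arguments.
Unset Strict Implicit.
Unset Printing Implicit Defensive.
Import Order.TTheory GRing.Theory Num.Theory.
Import numFieldNormedType.Exports.

Local Open Scope classical_set_scope.
Local Open Scope ring_scope.
Local Open Scope complex_scope.

(* The usual topology of the complex plane: R[i] as a normed space over
   itself, so that [derivable g z 1] is complex differentiability. *)
HB.instance Definition _ (R : realType) := NormedModule.copy R[i] R[i]^o.

Section Meromorphic.
Variable R : realType.
Implicit Types (D K : set R[i]) (f g : R[i] -> option R[i]) (z w : R[i]).

(* [option R[i]] is the Riemann sphere, [None] being the point at infinity.
   Functions on a domain D are represented by total functions; everything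
   below depends only on their values in D. *)

Definition domain D := [/\ D !=set0, connected D & open D].

Definition cmod z : R := ComplexField.Normc.normc z.

Definition holomorphic_at (h : R[i] -> R[i]) z :=
  \forall w \near z, derivable h w 1.

(* Holomorphic except for poles, i.e. isolated singularities at which the
   modulus tends to infinity, where the value is infinity. In particular the
   constant infinity is not meromorphic. *)
Definition meromorphic D f := forall z, D z ->
  (exists2 h : R[i] -> R[i], holomorphic_at h z &
     \forall w \near z, f w = Some (h w)) \/
  (f z = None /\
   exists2 h : R[i] -> R[i],
     (\forall w \near z^', f w = Some (h w) /\ derivable h w 1) &
     cmod (h w) @[w --> z^'] --> +oo).

(* The function that vanishes identically near z has a zero of infinite
   multiplicity at z: no m satisfies [zero_mult f z m]. *)
Definition zero_mult f z (m : nat) := (0 < m)%N /\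
  exists h : R[i] -> R[i], [/\ holomorphic_at h z, h z != 0 &
    \forall w \near z, f w = Some ((w - z) ^+ m * h w)].

Definition pole_mult f z (m : nat) := [/\ (0 < m)%N, f z = None &
  exists h : R[i] -> R[i], [/\ holomorphic_at h z, h z != 0 &
    \forall w \near z^', f w = Some (h w / (w - z) ^+ m)]].

Definition share D f g (psi : R[i] -> option R[i]) :=
  [set z | D z /\ f z = psi z] = [set z | D z /\ g z = psi z].

(* Half the Euclidean distance between the inverse stereographic projections
   of p and q on the unit sphere. *)
Definition chordal (p q : option R[i]) : R :=
  match p, q with
  | Some z, Some w => cmod (z - w) /
      (Num.sqrt (1 + cmod z ^+ 2) * Num.sqrt (1 + cmod w ^+ 2))
  | Some z, None | None, Some z => (Num.sqrt (1 + cmod z ^+ 2))^-1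
  | None, None => 0
  end.

(* Great-circle distance on the unit sphere. *)
Definition spherical (p q : option R[i]) : R := 2 * asin (chordal p q).

Definition spherically_cvg_compacts D (u : nat -> R[i] -> option R[i]) g :=
  forall K, compact K -> K `<=` D -> forall e : R, 0 < e ->
    \forall n \near \oo, forall z, K z -> spherical (u n z) (g z) < e.

Definition normal_family D (F : set (R[i] -> option R[i])) :=
  forall u : nat -> R[i] -> option R[i], (forall n, F (u n)) ->
  exists phi : nat -> nat, {homo phi : m n / (m < n)%N} /\
  exists g, (meromorphic D g \/ (forall z, D z -> g z = None)) /\
    spherically_cvg_compacts D (fun n => u (phi n)) g.

End Meromorphic.

(* Main.v *)
Require Import Defs.
From mathcomp Require Import all_boot all_order all_algebra.
From mathcomp Require Import all_classical all_reals all_analysis.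
From mathcomp.real_closed Require Import complex.
From mathcomp Require Import ring lra zify.
Import Order.TTheory GRing.Theory Num.Theory.
Import numFieldNormedType.Exports.
Set Implicit Arguments.
Unset Strict Implicit.
Unset Printing Implicit Defensive.
Local Open Scope classical_set_scope.
Local Open Scope ring_scope.
Local Open Scope complex_scope.
Local Arguments cmod : simpl never.

(* The idea is to compare metrics. Let [z0] be a point of [D]. As all members
   of the family agree with [psi] at the same points, either they all equal
   [psi] near [z0], or in a punctured disc around [z0] no member [f] takes the
   value of [psi], and [psi] has no zeros and no poles. There [G = f / (f -
   psi)] is holomorphic, with zeros of order at least 2 and 1-points of order
   at least 3. As 1/2 + 2/3 + 1 > 2, the sphere carries a metric of curvature
   at most a negative constant with cone points at 0, 1, oo whose pull-back by
   [G] vanishes at these points, and the maximum principle (Ahlfors' lemma)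
   bounds the pull-back by a fixed metric of the punctured disc, of density
   O(|z - z0|^(-47/48)). That density is integrable along radii, so |f|^2 /
   (|f|^2 + |psi|^2), which is a function of [G], stays within 1/4 of its limit
   at [z0], on a disc that does not depend on [f]. Hence |f| <= 2 |psi| or
   |psi| <= 2 |f| holds throughout that disc, off [z0]. The conditions on
   common zeros and poles deal with [z0] itself: [f] or [1 / f] is holomorphic
   in the disc and, by Cauchy's formula over a contour around [z0], bounded
   independently of [f]. Normality follows by compactness: the limit is taken
   along an ultrafilter, and Cauchy's estimates make the convergence locally
   uniform. *)

(** * The complex plane *)

(** The exponents come from a count in 24ths. Under a map with a zero of order k, a cone exponent a
    pulls back to a density of order k(1 - a) - 1; positivity for k = 2 at 0 and k = 3 at 1 requires
    a < 1/2 and a < 2/3, while negative curvature requires the three exponents to exceed 2 in sum.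
    The choice 11/24, 15/24, 23/24 does so by 1/24. The exponent 47/48 of the metric on the
    punctured disc is caught between two demands: it is below 1, for integrability along radii, and
    above 1 - 1/24, so that even a simple pole of [G] at the centre leaves the comparison function
    tending to 0 there. The obstacle is [z0]. Nothing limits the contact of [f] and [psi] at this
    point: [G] may have a zero, a 1-point or a pole of any order there, and its limit depends on
    [f]. Uniformity survives because only the side of 1/2 on which the limit of |f|^2 / (|f|^2 +
    |psi|^2) lies matters: it decides whether [f] or [1 / f] is bounded, and the oscillation bound
    holds on a disc fixed before [f]. *)

Section ComplexPlane.
Variable R : realType.
Notation C := R[i].
Implicit Types (x y : R) (z w l : C) (f g : C -> C).

Lemma cmod_ge0 z : 0 <= cmod z.
Proof. by case: z => a b; exact: sqrtr_ge0. Qed.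
Lemma cmod0 : cmod (0 : C) = 0.
Proof. exact: ComplexField.Normc.normc0. Qed.
Lemma cmod1 : cmod (1 : C) = 1.
Proof. exact: ComplexField.Normc.normc1. Qed.
Lemma cmodM z w : cmod (z * w) = cmod z * cmod w.
Proof. exact: ComplexField.Normc.normcM. Qed.
Lemma cmodN z : cmod (- z) = cmod z.
Proof. by case: z => a b /=; rewrite /cmod /= !sqrrN. Qed.
Lemma cmodB z w : cmod (z - w) = cmod (w - z).
Proof. by rewrite -cmodN opprB. Qed.
Lemma cmodV z : cmod z^-1 = (cmod z)^-1.
Proof. exact: ComplexField.Normc.normcV. Qed.
Lemma cmodX z n : cmod (z ^+ n) = cmod z ^+ n.
Proof. by elim: n => [|n IH]; rewrite ?expr0 ?cmod1// !exprS cmodM IH. Qed.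
Lemma cmodD z w : cmod (z + w) <= cmod z + cmod w.
Proof. by rewrite -lecR rmorphD; exact: (@ler_normD _ R[i]). Qed.
Lemma cmodBD z w : cmod (z - w) <= cmod z + cmod w.
Proof. by rewrite -(cmodN w); exact: cmodD. Qed.
Lemma cmod_sub_le z w : cmod z - cmod w <= cmod (z - w).
Proof. by rewrite lerBlDr -{1}(subrK w z); exact: cmodD. Qed.
Lemma cmod_tri z w v : cmod (z - v) <= cmod (z - w) + cmod (w - v).
Proof. by rewrite -{1}(subrK w z) -addrA; exact: cmodD. Qed.
Lemma cmod_eq0 z : (cmod z == 0) = (z == 0).
Proof.
apply/eqP/eqP => [|->]; last exact: cmod0.
exact: ComplexField.Normc.eq0_normc.
Qed.
Lemma cmod_gt0 z : (0 < cmod z) = (z != 0).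
Proof. by rewrite lt_def cmod_ge0 andbT cmod_eq0. Qed.
Lemma cmodR x : cmod (x%:C) = `|x|.
Proof. by rewrite /cmod /= expr0n /= addr0 sqrtr_sqr. Qed.
Lemma cmod_i : cmod ('i : C) = 1.
Proof. by rewrite /cmod /= expr0n /= add0r expr1n sqrtr1. Qed.
Lemma sqr_cmod z : cmod z ^+ 2 = complex.Re z ^+ 2 + complex.Im z ^+ 2.
Proof. by case: z => a b; rewrite /cmod /= sqr_sqrtr // addr_ge0 ?sqr_ge0. Qed.
Lemma Re_le_cmod z : `|complex.Re z| <= cmod z.
Proof.
rewrite -ler_sqr ?nnegrE ?cmod_ge0 // sqr_cmod real_normK ?num_real //.
by rewrite lerDl sqr_ge0.
Qed.
Lemma Im_le_cmod z : `|complex.Im z| <= cmod z.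
Proof.
rewrite -ler_sqr ?nnegrE ?cmod_ge0 // sqr_cmod real_normK ?num_real //.
by rewrite lerDr sqr_ge0.
Qed.
Lemma cmod_le_ReIm z : cmod z <= `|complex.Re z| + `|complex.Im z|.
Proof.
case: z => a b; have E : a +i* b = a%:C + 'i * b%:C.
  by apply/eqP; rewrite eq_complex /=; apply/andP; split; apply/eqP; ring.
rewrite {1}E; apply: (le_trans (cmodD _ _)).
by rewrite cmodM cmod_i mul1r !cmodR.
Qed.

Lemma cReD z w : complex.Re (z + w) = complex.Re z + complex.Re w.
Proof. by case: z; case: w. Qed.
Lemma cImD z w : complex.Im (z + w) = complex.Im z + complex.Im w.
Proof. by case: z; case: w. Qed.
Lemma cReN z : complex.Re (- z) = - complex.Re z.
Proof. by case: z. Qed.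
Lemma cImN z : complex.Im (- z) = - complex.Im z.
Proof. by case: z. Qed.
Lemma cReM z w : complex.Re (z * w) =
  complex.Re z * complex.Re w - complex.Im z * complex.Im w.
Proof. by case: z; case: w. Qed.
Lemma cImM z w : complex.Im (z * w) =
  complex.Re z * complex.Im w + complex.Im z * complex.Re w.
Proof. by case: z; case: w. Qed.
Lemma cReV z : complex.Re z^-1 = complex.Re z / cmod z ^+ 2.
Proof. by rewrite sqr_cmod; case: z. Qed.
Lemma cImV z : complex.Im z^-1 = - complex.Im z / cmod z ^+ 2.
Proof. by rewrite sqr_cmod mulNr; case: z. Qed.
Lemma eq_ReIm z w : complex.Re z = complex.Re w -> complex.Im z = complex.Im w ->
  z = w.
Proof. by case: z => a b; case: w => c d /= -> ->. Qed.

(** [R[i]] is normed over itself, so its balls have radii in [R[i]]. A positive radius is real; this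
    is the passage to the real radii used in all estimates. *)
Lemma nbhsCP z (P : set C) :
  nbhs z P <-> exists2 d : R, 0 < d & forall w, cmod (w - z) < d -> P w.
Proof.
split=> [/nbhs_ballP[e /= e0 eP]|[d d0 dP]].
  have eE : e = (complex.Re e)%:C by rewrite (RRe_real (gtr0_real e0)).
  exists (complex.Re e); first by rewrite -ltcR -eE.
  move=> w wd; apply: eP; rewrite -ball_normE /= distrC eE.
  by change ((cmod (w - z))%:C < (complex.Re e)%:C); rewrite ltcR.
apply/nbhs_ballP; exists (d%:C); first by rewrite /= ltcR.
move=> w; rewrite -ball_normE /= distrC => wd; apply: dP.
by move: wd; change ((cmod (w - z))%:C < d%:C -> cmod (w - z) < d); rewrite ltcR.
Qed.

Lemma dnbhsCP z (P : set C) : z^' P <->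
  exists2 d : R, 0 < d & forall w, w != z -> cmod (w - z) < d -> P w.
Proof.
split=> [/nbhsCP[d d0 dP]|[d d0 dP]].
  by exists d => // w wz wd; exact: dP.
by apply/nbhsCP; exists d => // w wd wz; exact: dP.
Qed.

Lemma openCP (D : set C) : open D ->
  forall z, D z -> exists2 r : R, 0 < r & forall w, cmod (w - z) < r -> D w.
Proof. by rewrite openE => oD z /oD/nbhsCP. Qed.

Section Continuity.
Variable T : topologicalType.
Implicit Types (F G : T -> C) (t : T).

(** Continuity by components makes the theorems on real functions (mean value, primitives) directly
    applicable; the source is arbitrary so that paths and functions on the plane obey the same
    rules. *)
Definition ccont F t :=
  {for t, continuous (fun s => complex.Re (F s))} /\
  {for t, continuous (fun s => complex.Im (F s))}.

Lemma ccontP F t : ccont F t <->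
  forall e, 0 < e -> \forall s \near t, cmod (F s - F t) < e.
Proof.
split=> [[/cvgrPdist_lt cR /cvgrPdist_lt cI] e e0|cF].
  have e2 : 0 < e / 2 by rewrite divr_gt0.
  near=> s.
  apply: (le_lt_trans (cmod_le_ReIm _)); rewrite (splitr e) cReD cImD cReN cImN.
  by apply: ltrD; rewrite distrC; near: s; [exact: cR|exact: cI].
split; apply/cvgrPdist_lt => e /cF; apply: filterS => s; rewrite cmodB;
  apply: le_lt_trans.
- by rewrite -cReN -cReD Re_le_cmod.
- by rewrite -cImN -cImD Im_le_cmod.
Unshelve. all: by end_near. Qed.

Lemma eq_cont (a b : T -> R) t : (forall s, a s = b s) ->
  {for t, continuous b} -> {for t, continuous a}.
Proof. by move=> ab; have -> : a = b by apply/funext. Qed.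

Lemma ccont_cst z t : ccont (fun _ => z) t.
Proof. by split; exact: cvg_cst. Qed.
Lemma ccontD F G t : ccont F t -> ccont G t -> ccont (fun s => F s + G s) t.
Proof.
move=> [a b] [c d]; split.
  by apply: (eq_cont (fun s => cReD (F s) (G s))); exact: continuousD.
by apply: (eq_cont (fun s => cImD (F s) (G s))); exact: continuousD.
Qed.
Lemma ccontN F t : ccont F t -> ccont (fun s => - F s) t.
Proof.
move=> [a b]; split.
  by apply: (eq_cont (fun s => cReN (F s))); exact: continuousN.
by apply: (eq_cont (fun s => cImN (F s))); exact: continuousN.
Qed.
Lemma ccontM F G t : ccont F t -> ccont G t -> ccont (fun s => F s * G s) t.
Proof.
move=> [a b] [c d]; split.
  apply: (eq_cont (fun s => cReM (F s) (G s))).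
  by apply: continuousB; exact: continuousM.
apply: (eq_cont (fun s => cImM (F s) (G s))).
by apply: continuousD; exact: continuousM.
Qed.
Lemma ccontB F G t : ccont F t -> ccont G t -> ccont (fun s => F s - G s) t.
Proof. by move=> a b; apply: ccontD => //; exact: ccontN. Qed.
Lemma ccont_sqr_cmod F t : ccont F t ->
  {for t, continuous (fun s => cmod (F s) ^+ 2)}.
Proof.
move=> [a b]; apply: (eq_cont (fun s => sqr_cmod (F s))).
by apply: continuousD; exact: continuousM.
Qed.
Lemma ccont_cmod F t : ccont F t -> {for t, continuous (fun s => cmod (F s))}.
Proof.
move=> /ccontP cF; apply/cvgrPdist_lt => e /cF; apply: filterS => s.
by apply: le_lt_trans; rewrite ler_norml lerNl opprB cmod_sub_le cmodB cmod_sub_le.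
Qed.
Lemma ccontV F t : F t != 0 -> ccont F t -> ccont (fun s => (F s)^-1) t.
Proof.
move=> F0 cF; have cm : {for t, continuous (fun s => (cmod (F s) ^+ 2)^-1)}.
  apply: continuousV; last exact: ccont_sqr_cmod.
  by rewrite sqrf_eq0 cmod_eq0.
case: cF => a b; split.
  by apply: (eq_cont (fun s => cReV (F s))); exact: continuousM.
apply: (eq_cont (fun s => cImV (F s))).
by apply: continuousM => //; exact: continuousN.
Qed.
Lemma ccont_div F G t : G t != 0 -> ccont F t -> ccont G t ->
  ccont (fun s => F s / G s) t.
Proof. by move=> a b c; apply: ccontM => //; exact: ccontV. Qed.
Lemma ccontX F n t : ccont F t -> ccont (fun s => F s ^+ n) t.
Proof.
move=> cF; elim: n => [|n IH]; first exact: ccont_cst.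
have -> : (fun s => F s ^+ n.+1) = (fun s => F s * F s ^+ n).
  by apply/funext => s; rewrite exprS.
exact: ccontM.
Qed.
End Continuity.

Lemma ccont_id z : ccont (fun w : C => w) z.
Proof. by apply/ccontP => e e0; apply/nbhsCP; exists e. Qed.
Lemma ccont_comp (T : topologicalType) (F : T -> C) (f : C -> C) (t : T) :
  ccont F t -> ccont f (F t) -> ccont (fun s => f (F s)) t.
Proof.
move=> /ccontP cF /ccontP cf; apply/ccontP => e /cf /nbhsCP[d d0 dP].
by near=> s; apply: dP; near: s; exact: cF.
Unshelve. all: by end_near. Qed.
Lemma ccontCP f z : ccont f z <-> forall e, 0 < e ->
  exists2 d, 0 < d & forall w, cmod (w - z) < d -> cmod (f w - f z) < e.
Proof.
split=> [/ccontP cf e /cf /nbhsCP//|cf].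
by apply/ccontP => e /cf ?; apply/nbhsCP.
Qed.

(** Caratheodory's form of differentiability: an exact factorisation with a continuous quotient. The
    product and chain rules become algebraic identities without error terms. *)
Definition cdiff f z l := exists2 q : C -> C, ccont q z &
  q z = l /\ forall w, f w = f z + (w - z) * q w.

Lemma cdiffP f z l : cdiff f z l <-> forall e, 0 < e -> exists2 d, 0 < d &
  forall w, cmod (w - z) < d ->
    cmod (f w - f z - l * (w - z)) <= e * cmod (w - z).
Proof.
split=> [[q /ccontCP cq [<- fE]] e /cq[d d0 dP]|fP].
  exists d => // w /dP qw; rewrite fE.
  have -> : f z + (w - z) * q w - f z - q z * (w - z) = (q w - q z) * (w - z).
    by ring.
  by rewrite cmodM ler_wpM2r ?cmod_ge0 // ltW.
exists (fun w => if w == z then l else (f w - f z) / (w - z)); last first.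
  split=> [|w]; first by rewrite eqxx.
  have [->|wz] := eqVneq w z; first by rewrite subrr mul0r addr0.
  by rewrite mulrC divfK ?subr_eq0 // addrC subrK.
apply/ccontCP => e e0; have e2 : 0 < e / 2 by rewrite divr_gt0.
have [d d0 dP] := fP _ e2; exists d => // w /dP fw; rewrite eqxx.
move: fw; have [->|wz] := eqVneq w z; first by move=> _; rewrite subrr cmod0.
have wz0 : w - z != 0 by rewrite subr_eq0.
move=> fw; apply: (@le_lt_trans _ _ (e / 2)); last first.
  by rewrite ltr_pdivrMr // mulrDr mulr1 ltrDr.
rewrite -(ler_pM2r (_ : 0 < cmod (w - z))) ?cmod_gt0 // -cmodM.
by rewrite mulrBl divfK.
Qed.

Lemma derivableCP f z : derivable f z 1 <-> exists l, cdiff f z l.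
Proof.
have key l h : h != 0 -> l - h^-1 *: (f (h *: 1 + z) - f z) =
    - h^-1 * (f (z + h) - f z - l * h).
  move=> h0; rewrite /GRing.scale /= mulr1 [h + z]addrC.
  have E (a : C) : l - h^-1 * a = - h^-1 * (a - l * h) by field.
  exact: E.
split=> [|[l /cdiffP lP]].
  move=> /cvg_ex[l]; set q := (X in X @ _ --> _) => ql; exists l; apply/cdiffP => e e0.
  have /dnbhsCP[d d0 dP] : \forall h \near 0^', `|l - q h| < e%:C.
    by move/cvgrPdist_lt : ql; apply; rewrite ltcR.
  exists d => // w wd; have [->|wz] := eqVneq w z.
    by rewrite !subrr mulr0 subr0 cmod0 mulr0.
  have wz0 : w - z != 0 by rewrite subr_eq0.
  have /dP-/(_ wz0) : cmod (w - z - 0) < d by rewrite subr0.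
  have zE : z + (w - z) = w by ring.
  rewrite /q key // zE.
  rewrite mulNr normrN.
  change ((cmod ((w - z)^-1 * (f w - f z - l * (w - z))))%:C < e%:C -> 
    cmod (f w - f z - l * (w - z)) <= e * cmod (w - z)).
  rewrite ltcR cmodM cmodV => /ltW.
  by rewrite ler_pdivrMl ?cmod_gt0 // [e * _]mulrC.
apply/cvg_ex; exists l; apply/cvgrPdist_lt => e e0.
have eE : e = (complex.Re e)%:C by rewrite (RRe_real (gtr0_real e0)).
have r0 : 0 < complex.Re e by rewrite -ltcR -eE.
have r2 : 0 < complex.Re e / 2 by rewrite divr_gt0.
have [d d0 dP] := lP _ r2.
apply/dnbhsCP; exists d => // h h0; rewrite subr0 => hd; rewrite key // eE.
rewrite mulNr normrN.
change ((cmod (h^-1 * (f (z + h) - f z - l * h)))%:C < (complex.Re e)%:C).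
rewrite ltcR cmodM cmodV ltr_pdivrMl ?cmod_gt0 //.
have zh : z + h - z = h by rewrite addrC addKr.
have := dP (z + h); rewrite zh => /(_ hd) /le_lt_trans; apply.
rewrite [_ / 2 * _]mulrC ltr_pM2l ?cmod_gt0 //.
by rewrite ltr_pdivrMr // mulrDr mulr1 ltrDr.
Qed.

End ComplexPlane.

(** * Complex differentiation and derivatives of paths *)

Section ComplexDerivative.
Variable R : realType.
Notation C := R[i].
Implicit Types (x y a b s t : R) (z w l : C) (f g : C -> C).

Lemma cdiff_near f z (q : C -> C) : ccont q z ->
  (\forall w \near z, f w = f z + (w - z) * q w) -> cdiff f z (q z).
Proof.
move=> /ccontCP cq /nbhsCP[d d0 dP]; apply/cdiffP => e /cq[d' d'0 d'P].
exists (Num.min d d'); first by rewrite lt_min d0.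
move=> w; rewrite lt_min => /andP[/dP -> /d'P qw].
have -> : f z + (w - z) * q w - f z - q z * (w - z) = (q w - q z) * (w - z).
  by ring.
by rewrite cmodM ler_wpM2r ?cmod_ge0 // ltW.
Qed.

Lemma cdiff_ccont f z l : cdiff f z l -> ccont f z.
Proof.
move=> [q cq [_ fE]].
have -> : f = (fun w => f z + (w - z) * q w) by apply/funext.
apply: ccontD; first exact: ccont_cst.
by apply: ccontM => //; apply: ccontB; [exact: ccont_id|exact: ccont_cst].
Qed.

Lemma cdiff_uniq f z l l' : cdiff f z l -> cdiff f z l' -> l = l'.
Proof.
move=> /cdiffP fl /cdiffP fl'; apply/eqP/negPn/negP => ll'.
have e0 : 0 < cmod (l - l') / 4 by rewrite divr_gt0 // cmod_gt0 subr_eq0.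
have [d d0 dP] := fl _ e0; have [d' d'0 d'P] := fl' _ e0.
pose h := Num.min d d' / 2.
have h0 : 0 < h by rewrite divr_gt0 // lt_min d0.
have hd : h < Num.min d d'.
  by rewrite /h ltr_pdivrMr // mulrDr mulr1 ltrDr lt_min d0.
have hE : cmod (z + h%:C - z) = h by rewrite addrC addKr cmodR gtr0_norm.
move: hd; rewrite lt_min -hE => /andP[/dP H1 /d'P H2].
have : cmod ((l - l') * (z + h%:C - z)) <= cmod (l - l') / 2 * h.
  have -> : (l - l') * (z + h%:C - z) =
   (f (z + h%:C) - f z - l' * (z + h%:C - z)) -
   (f (z + h%:C) - f z - l * (z + h%:C - z)) by ring.
  apply: (le_trans (cmodBD _ _)); rewrite hE in H1 H2; lra.
rewrite cmodM hE ler_pM2r // leNgt => /negP; apply.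
by rewrite ltr_pdivrMr // mulrDr mulr1 ltrDr cmod_gt0 subr_eq0.
Qed.

Lemma cdiff_cst c z : cdiff (fun _ => c) z 0.
Proof.
exists (fun _ => 0); first exact: ccont_cst.
by split=> // w; rewrite mulr0 addr0.
Qed.
Lemma cdiff_id z : cdiff (fun w => w) z 1.
Proof.
exists (fun _ => 1); first exact: ccont_cst.
by split=> // w; rewrite mulr1 addrC subrK.
Qed.
Lemma cdiffD f g z l l' : cdiff f z l -> cdiff g z l' ->
  cdiff (fun w => f w + g w) z (l + l').
Proof.
move=> [p cp [<- fE]] [q cq [<- gE]].
exists (fun w => p w + q w); first exact: ccontD.
by split=> // w; rewrite fE gE; ring.
Qed.
Lemma cdiffN f z l : cdiff f z l -> cdiff (fun w => - f w) z (- l).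
Proof.
move=> [p cp [<- fE]].
exists (fun w => - p w); first exact: ccontN.
by split=> // w; rewrite fE; ring.
Qed.
Lemma cdiffB f g z l l' : cdiff f z l -> cdiff g z l' ->
  cdiff (fun w => f w - g w) z (l - l').
Proof. by move=> a b; apply: cdiffD => //; exact: cdiffN. Qed.
Lemma cdiffM f g z l l' : cdiff f z l -> cdiff g z l' ->
  cdiff (fun w => f w * g w) z (l * g z + f z * l').
Proof.
move=> df dg; have cg := cdiff_ccont dg.
case: df dg => p cp [<- fE] [q cq [<- gE]].
exists (fun w => p w * g w + f z * q w).
  apply: ccontD; first exact: ccontM.
  by apply: ccontM => //; exact: ccont_cst.
by split=> // w; rewrite fE gE; ring.
Qed.
Lemma eq_near_cdiff f g z l : (\forall w \near z, f w = g w) ->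
  cdiff f z l -> cdiff g z l.
Proof.
move=> fg [q cq [<- fE]]; apply: cdiff_near => //.
have fgz := nbhs_singleton fg.
by move: fg; apply: filterS => w <-; rewrite fE fgz.
Qed.
Lemma cdiffV f z l : f z != 0 -> cdiff f z l ->
  cdiff (fun w => (f w)^-1) z (- l / f z ^+ 2).
Proof.
move=> fz0 df; have cf := cdiff_ccont df; case: df => q cq [<- fE].
have -> : - q z / f z ^+ 2 = - q z / (f z * f z) by rewrite expr2.
apply: (@cdiff_near _ _ (fun w => - q w / (f z * f w))).
  apply: ccont_div; [by rewrite mulf_neq0|exact: ccontN|].
  by apply: ccontM => //; exact: ccont_cst.
have /ccontP/(_ (cmod (f z))) := cf; rewrite cmod_gt0 => /(_ fz0).
apply: filterS => w; have [fw0|fw0 _] := eqVneq (f w) 0.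
  by rewrite fw0 sub0r cmodN ltxx.
have -> : (w - z) * (- q w / (f z * f w)) = (f z - f w) / (f z * f w).
  by rewrite [X in (f z - X)](fE w); field; rewrite fz0 fw0.
by field; rewrite fz0 fw0.
Qed.
Lemma cdiffX f n z l : cdiff f z l ->
  cdiff (fun w => f w ^+ n.+1) z (n.+1%:R * f z ^+ n * l).
Proof.
move=> df; elim: n => [|n IH]; first by rewrite expr0 !mul1r.
have -> : (fun w => f w ^+ n.+2) = (fun w => f w * f w ^+ n.+1).
  by apply/funext => w; rewrite exprS.
have -> : n.+2%:R * f z ^+ n.+1 * l =
    l * f z ^+ n.+1 + f z * (n.+1%:R * f z ^+ n * l).
  by rewrite [n.+2%:R]mulrS exprS; ring.
exact: cdiffM IH.
Qed.

Definition cder f z := exists l, cdiff f z l.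
Definition der f z : C := xget 0 [set l | cdiff f z l].

Lemma derP f z : cder f z -> cdiff f z (der f z).
Proof. by case=> l fl; rewrite /der; case: xgetP => [l' -> //|/(_ l)/(_ fl)]. Qed.
Lemma derE f z l : cdiff f z l -> der f z = l.
Proof. by move=> fl; apply: (@cdiff_uniq f z) => //; apply: derP; exists l. Qed.
Lemma cder_ccont f z : cder f z -> ccont f z.
Proof. by case=> l /cdiff_ccont. Qed.
Lemma cder_cst c z : cder (fun _ => c) z.
Proof. by exists 0; exact: cdiff_cst. Qed.
Lemma cder_id z : cder (fun w => w) z.
Proof. by exists 1; exact: cdiff_id. Qed.
Lemma cderB f g z : cder f z -> cder g z -> cder (fun w => f w - g w) z.
Proof. by move=> [l a] [l' b]; exists (l - l'); exact: cdiffB. Qed.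
Lemma cderM f g z : cder f z -> cder g z -> cder (fun w => f w * g w) z.
Proof. by move=> [l a] [l' b]; eexists; exact: (cdiffM a b). Qed.
Lemma cderV f z : f z != 0 -> cder f z -> cder (fun w => (f w)^-1) z.
Proof. by move=> f0 [l a]; eexists; exact: (cdiffV f0 a). Qed.
Lemma cder_div f g z : g z != 0 -> cder f z -> cder g z ->
  cder (fun w => f w / g w) z.
Proof. by move=> a b c; apply: cderM => //; exact: cderV. Qed.
Lemma cderX f n z : cder f z -> cder (fun w => f w ^+ n) z.
Proof.
case: n => [|n] [l fl]; last by eexists; exact: (cdiffX n fl).
exact: cder_cst.
Qed.
Lemma eq_near_cder f g z : (\forall w \near z, f w = g w) ->
  cder f z -> cder g z.
Proof. by move=> fg [l fl]; exists l; exact: eq_near_cdiff fl. Qed.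

Implicit Types (c : R -> C) (v : C).
Definition crd c t v :=
  is_derive t 1 (fun s => complex.Re (c s)) (complex.Re v) /\
  is_derive t 1 (fun s => complex.Im (c s)) (complex.Im v).

Lemma crdP c t v : crd c t v <-> exists2 k : R -> C, ccont k t &
  k t = v /\ forall s, c s = c t + (s - t)%:C * k s.
Proof.
split=> [[/is_derive1_caratheodory[p [pE cp pt]]
    /is_derive1_caratheodory[q [qE cq qt]]]|[k [ck1 ck2] [kt kE]]].
  exists (fun s => p s +i* q s); first by split.
  split=> [|s]; first by rewrite /= pt qt; case: (v).
  apply: eq_ReIm; rewrite ?cReD ?cImD ?cReM ?cImM /= mul0r ?subr0 ?addr0.
    by rewrite mulrC -pE addrC subrK.
  by rewrite mulrC -qE addrC subrK.
split; apply/is_derive1_caratheodory.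
  exists (fun s => complex.Re (k s)); split=> //; last by rewrite kt.
  by move=> s; rewrite kE cReD cReM /= mul0r subr0 addrC addKr mulrC.
exists (fun s => complex.Im (k s)); split=> //; last by rewrite kt.
by move=> s; rewrite kE cImD cImM /= mul0r addr0 addrC addKr mulrC.
Qed.

Lemma crd_ccont c t v : crd c t v -> ccont c t.
Proof.
by case=> /@ex_derive a /@ex_derive b; split;
  apply: differentiable_continuous; apply/derivable1_diffP.
Qed.

Lemma crd_comp f c t l v : crd c t v -> cdiff f (c t) l ->
  crd (fun s => f (c s)) t (l * v).
Proof.
move=> dc [q cq [<- fE]]; have cc := crd_ccont dc.
move: dc => /crdP[k ck [<- kE]]; apply/crdP.
exists (fun s => q (c s) * k s); first by apply: ccontM => //; exact: ccont_comp.
split=> // s; rewrite fE.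
have -> : c s - c t = (s - t)%:C * k s by rewrite kE; ring.
by ring.
Qed.

Lemma crd_line z w t : crd (fun s => z + s%:C * w) t w.
Proof.
apply/crdP; exists (fun _ => w); first exact: ccont_cst.
by split=> // s; rewrite rmorphB; ring.
Qed.

Lemma crdD c c' t v v' : crd c t v -> crd c' t v' ->
  crd (fun s => c s + c' s) t (v + v').
Proof.
move=> /crdP[k ck [<- kE]] /crdP[k' ck' [<- kE']]; apply/crdP.
exists (fun s => k s + k' s); first exact: ccontD.
by split=> // s; rewrite kE kE'; ring.
Qed.

Lemma crdZ w c t v : crd c t v -> crd (fun s => w * c s) t (w * v).
Proof.
move=> /crdP[k ck [<- kE]]; apply/crdP.
exists (fun s => w * k s); first by apply: ccontM => //; exact: ccont_cst.
by split=> // s; rewrite kE; ring.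
Qed.

Lemma real_MVT (h dh : R -> R) a b : a <= b ->
  (forall t, a <= t <= b -> is_derive t 1 h (dh t)) ->
  exists2 t, a <= t <= b & h b - h a = dh t * (b - a).
Proof.
move=> ab dP; have [||t tab E] := @MVT_segment R h dh a b ab.
- by move=> t; rewrite in_itv /= => /andP[? ?]; apply: dP; rewrite !ltW.
- apply: derivable_within_continuous => t; rewrite in_itv /= => tab.
  exact: (@ex_derive _ _ _ _ _ _ _ (dP _ tab)).
by exists t => //; move: tab; rewrite in_itv.
Qed.

(** The mean value theorem fails for complex paths. It is applied to the real part of [k * c], where
    [k] is the conjugate of the increment [D], so that [k * D] is the squared modulus of [D]. *)
Lemma crd_bound c (v : R -> C) a b (M : R) : a <= b ->
  (forall t, a <= t <= b -> crd c t (v t)) ->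
  (forall t, a <= t <= b -> cmod (v t) <= M) ->
  cmod (c b - c a) <= M * (b - a).
Proof.
move=> ab dc vM; pose D := c b - c a.
pose k := complex.Re D +i* - complex.Im D.
have kD : complex.Re (k * D) = cmod D ^+ 2.
  by rewrite sqr_cmod cReM /= mulNr opprK !expr2.
have kM : cmod k = cmod D.
  by apply/eqP; rewrite -(eqrXn2 (ltn0Sn 1)) ?cmod_ge0 // !sqr_cmod /= sqrrN.
have [t tab] := @real_MVT (fun s => complex.Re (k * c s))
  (fun s => complex.Re (k * v s)) a b ab (fun t tab => (crdZ k (dc t tab)).1).
rewrite -cReN -cReD -mulrN -mulrDr kD => E.
have [D0|D0] := eqVneq (cmod D) 0.
  rewrite -/D D0 mulr_ge0 ?subr_ge0 //.
  by apply: le_trans (vM a _); rewrite ?cmod_ge0 // lexx.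
have Dp : 0 < cmod D by rewrite lt_def D0 cmod_ge0.
rewrite -/D -(ler_pM2l Dp) -expr2 E mulrA ler_wpM2r ?subr_ge0 //.
apply: (le_trans (ler_norm _)); apply: (le_trans (Re_le_cmod _)).
by rewrite cmodM kM ler_wpM2l ?cmod_ge0 // vM.
Qed.

End ComplexDerivative.

(** * Integrals over rectangles and Cauchy's formula *)

Section LineIntegrals.
Variable R : realType.
Lemma real_primitive (h : R -> R) (a b : R) : a <= b ->
  (forall t, a <= t <= b -> {for t, continuous h}) ->
  exists H : R -> R, forall t, a <= t <= b -> is_derive t 1 H (h t).
Proof.
(* [k] clamps to the interval from [a] to [b], which makes the integrand continuous on the whole
   line; starting at [a - 1] makes every point considered interior to the interval of
   integration. *)
move=> ab ch; pose k t := Num.max a (Num.min t b).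
have kin t : a <= k t <= b.
  by rewrite /k le_max lexx /= ge_max ab ge_min lexx orbT.
have kid t : a <= t <= b -> k t = t.
  by move=> /andP[at_ tb]; rewrite /k (min_idPl tb) (max_idPr at_).
have ck : continuous k.
  move=> t; apply: (@continuous_max R R (cst a) (fun t => Num.min t b)).
    exact: cvg_cst.
  apply: (@continuous_min R R id (cst b)); [exact: cvg_id|exact: cvg_cst].
have chk : continuous (h \o k).
  by move=> t; apply: continuous_comp; [exact: ck|exact: ch].
pose mu := @lebesgue_measure R.
exists (fun x => (\int[mu]_(t in `[a - 1, x]) ((h \o k) t))%R) => t tab.
have [||||dF F'] := @continuous_FTC1_closed R (h \o k) (a - 1) t (b + 1).
- by case/andP: tab => _ tb; apply: (le_lt_trans tb); rewrite ltrDl.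
- apply: continuous_compact_integrable; first exact: segment_compact.
  exact: continuous_subspaceT.
- by case/andP: tab => at_ _; apply: lt_le_trans at_; rewrite ltrBlDr ltrDl.
- exact: chk.
apply: DeriveDef => //; rewrite -derive1E F' /= kid //.
Qed.
Notation C := R[i].
Implicit Types (x y a b c d s t : R) (z w l : C) (f g : C -> C) (p q : R -> C).

Definition isprim p a b (P : R -> C) := forall t, a <= t <= b -> crd P t (p t).
(** The integral is the increment of a primitive, well defined by the mean value inequality; no
    complex-valued Lebesgue integral is involved. The default [0] is taken when there is no
    primitive. *)
Definition cint a b p : C :=
  xget 0 [set v | exists2 P, isprim p a b P & v = P b - P a].

Lemma cintE p a b P : a <= b -> isprim p a b P -> cint a b p = P b - P a.
Proof.
move=> ab pP; rewrite /cint; case: xgetP => [v -> [Q pQ ->]|/(_ (P b - P a))].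
  apply/eqP; rewrite -subr_eq0 -cmod_eq0 eq_le cmod_ge0 andbT.
  have -> : Q b - Q a - (P b - P a) = Q b + -1 * P b - (Q a + -1 * P a) by ring.
  rewrite -(mul0r (b - a)).
  apply: (@crd_bound _ (fun t => Q t + -1 * P t) (fun _ => 0)) => // t tab.
    have -> : 0 = p t + -1 * p t by ring.
    by apply: crdD; [exact: pQ|apply: crdZ; exact: pP].
  by rewrite cmod0.
by case; exists P.
Qed.

Definition conton a b p := forall t, a <= t <= b -> ccont p t.

Lemma prim_exists p a b : a <= b -> conton a b p -> exists P, isprim p a b P.
Proof.
move=> ab cp; have [P1 dP1] := real_primitive ab (fun t tab => (cp t tab).1).
have [P2 dP2] := real_primitive ab (fun t tab => (cp t tab).2).
by exists (fun t => P1 t +i* P2 t) => t tab; split; [exact: dP1|exact: dP2].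
Qed.

Lemma cint_bound p a b (M : R) : a <= b -> conton a b p ->
  (forall t, a <= t <= b -> cmod (p t) <= M) -> cmod (cint a b p) <= M * (b - a).
Proof.
move=> ab cp pM; have [P pP] := prim_exists ab cp.
by rewrite (cintE ab pP); exact: crd_bound pM.
Qed.

Lemma cint_Im_ge p a b (m : R) : a <= b -> conton a b p ->
  (forall t, a <= t <= b -> m <= complex.Im (p t)) ->
  m * (b - a) <= complex.Im (cint a b p).
Proof.
move=> ab cp pM; have [P pP] := prim_exists ab cp.
rewrite (cintE ab pP) cImD cImN.
have [t tab ->] := @real_MVT _ (fun t => complex.Im (P t))
  (fun t => complex.Im (p t)) a b ab (fun t tab => (pP t tab).2).
by rewrite ler_wpM2r ?subr_ge0 // pM.
Qed.

Lemma cintD p q a b : a <= b -> conton a b p -> conton a b q ->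
  cint a b (fun t => p t + q t) = cint a b p + cint a b q.
Proof.
move=> ab cp cq; have [P pP] := prim_exists ab cp.
have [Q qQ] := prim_exists ab cq; rewrite (cintE ab pP) (cintE ab qQ).
rewrite (@cintE _ _ _ (fun t => P t + Q t)) //; first by ring.
by move=> t tab; apply: crdD; [exact: pP|exact: qQ].
Qed.

Lemma cintZ z p a b : a <= b -> conton a b p ->
  cint a b (fun t => z * p t) = z * cint a b p.
Proof.
move=> ab cp; have [P pP] := prim_exists ab cp; rewrite (cintE ab pP).
rewrite (@cintE _ _ _ (fun t => z * P t)) //; first by ring.
by move=> t tab; apply: crdZ; exact: pP.
Qed.

Lemma eq_cint p q a b : (forall t, a <= t <= b -> p t = q t) ->
  cint a b p = cint a b q.
Proof.
move=> pq; rewrite /cint; congr (xget _ _); apply/funext => v; apply/propext.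
by split=> -[P pP ->]; exists P => // t tab; have := pP t tab; rewrite pq.
Qed.

Lemma cint_split p a b c : a <= b -> b <= c -> conton a c p ->
  cint a c p = cint a b p + cint b c p.
Proof.
move=> ab bc cp; have ac := le_trans ab bc; have [P pP] := prim_exists ac cp.
rewrite (cintE ac pP) (@cintE _ _ _ P ab) ?(@cintE _ _ _ P bc); first by ring.
  by move=> t /andP[bt tc]; apply: pP; rewrite tc (le_trans ab).
by move=> t /andP[at_ tb]; apply: pP; rewrite at_ (le_trans tb).
Qed.

Definition inR a b c d z :=
  (a <= complex.Re z <= b) && (c <= complex.Im z <= d).
Definition onB a b c d z := inR a b c d z /\
  [\/ complex.Re z = a, complex.Re z = b, complex.Im z = c | complex.Im z = d].

(** The boundary is run counterclockwise; on the vertical edges [dz] is ['i] times [dy]. *)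
Definition rint f a b c d : C :=
  cint a b (fun x => f (x +i* c)) - cint a b (fun x => f (x +i* d)) +
  'i * (cint c d (fun y => f (b +i* y)) - cint c d (fun y => f (a +i* y))).

Lemma crd_hor c t : crd (fun x => x +i* c) t (1 : C).
Proof. by split=> /=; [exact: is_derive_id|exact: is_derive_cst]. Qed.
Lemma crd_ver a t : crd (fun y => a +i* y) t ('i : C).
Proof. by split=> /=; [exact: is_derive_cst|exact: is_derive_id]. Qed.

Section Boundary.
Variables a b c d : R.
Hypotheses (ab : a <= b) (cd : c <= d).

Lemma onB_hor x : a <= x <= b -> onB a b c d (x +i* c) /\ onB a b c d (x +i* d).
Proof.
by rewrite /onB /inR /= => ->; rewrite !lexx cd; split; split=> //;
  [apply: Or43|apply: Or44].
Qed.
Lemma onB_ver y : c <= y <= d -> onB a b c d (a +i* y) /\ onB a b c d (b +i* y).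
Proof.
by rewrite /onB /inR /= => ->; rewrite !lexx ab; split; split=> //;
  [apply: Or41|apply: Or42].
Qed.

Lemma ccont_sides f : (forall z, onB a b c d z -> ccont f z) ->
  [/\ conton a b (fun x => f (x +i* c)), conton a b (fun x => f (x +i* d)),
      conton c d (fun y => f (a +i* y)) & conton c d (fun y => f (b +i* y))].
Proof.
move=> cf; split=> t tI.
- by apply: ccont_comp; [exact: crd_ccont (crd_hor _ _)|apply: cf; case: (onB_hor tI)].
- by apply: ccont_comp; [exact: crd_ccont (crd_hor _ _)|apply: cf; case: (onB_hor tI)].
- by apply: ccont_comp; [exact: crd_ccont (crd_ver _ _)|apply: cf; case: (onB_ver tI)].
- by apply: ccont_comp; [exact: crd_ccont (crd_ver _ _)|apply: cf; case: (onB_ver tI)].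
Qed.

Lemma rint_bound f (M : R) : (forall z, onB a b c d z -> ccont f z) ->
  (forall z, onB a b c d z -> cmod (f z) <= M) ->
  cmod (rint f a b c d) <= 2 * M * ((b - a) + (d - c)).
Proof.
move=> /ccont_sides[s1 s2 s3 s4] fM; rewrite /rint.
have H1 : cmod (cint a b (fun x => f (x +i* c))) <= M * (b - a).
  by apply: cint_bound => // t /onB_hor[? ?]; apply: fM.
have H2 : cmod (cint a b (fun x => f (x +i* d))) <= M * (b - a).
  by apply: cint_bound => // t /onB_hor[? ?]; apply: fM.
have H3 : cmod (cint c d (fun y => f (a +i* y))) <= M * (d - c).
  by apply: cint_bound => // t /onB_ver[? ?]; apply: fM.
have H4 : cmod (cint c d (fun y => f (b +i* y))) <= M * (d - c).
  by apply: cint_bound => // t /onB_ver[? ?]; apply: fM.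
apply: (le_trans (cmodD _ _)); rewrite cmodM cmod_i mul1r.
apply: (le_trans (lerD (cmodBD _ _) (cmodBD _ _))); lra.
Qed.

Lemma rintD f g : (forall z, onB a b c d z -> ccont f z) ->
  (forall z, onB a b c d z -> ccont g z) ->
  rint (fun z => f z + g z) a b c d = rint f a b c d + rint g a b c d.
Proof.
move=> /ccont_sides[s1 s2 s3 s4] /ccont_sides[r1 r2 r3 r4].
by rewrite /rint !cintD //; ring.
Qed.

Lemma rintZ w f : (forall z, onB a b c d z -> ccont f z) ->
  rint (fun z => w * f z) a b c d = w * rint f a b c d.
Proof. by move=> /ccont_sides[s1 s2 s3 s4]; rewrite /rint !cintZ //; ring. Qed.

Lemma eq_rint f g : (forall z, onB a b c d z -> f z = g z) ->
  rint f a b c d = rint g a b c d.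
Proof.
move=> fg; rewrite /rint; congr (_ - _ + _ * (_ - _)); apply: eq_cint => t tI;
  apply: fg.
- by case: (onB_hor tI).
- by case: (onB_hor tI).
- by case: (onB_ver tI).
- by case: (onB_ver tI).
Qed.

Lemma rint_primitive f (P : C -> C) :
  (forall z, onB a b c d z -> cdiff P z (f z)) -> rint f a b c d = 0.
Proof.
move=> PP; rewrite /rint.
rewrite (@cintE _ a b (fun x => P (x +i* c))) //; last first.
  move=> t /onB_hor[t1 t2]; rewrite -[f _]mulr1.
  exact: (crd_comp (crd_hor _ _) (PP _ _)).
rewrite (@cintE _ a b (fun x => P (x +i* d))) //; last first.
  move=> t /onB_hor[t1 t2]; rewrite -[f _]mulr1.
  exact: (crd_comp (crd_hor _ _) (PP _ _)).
(* Along a vertical edge [P] has derivative [f * 'i], so [- 'i * P] is a primitive of [f] there. *)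
have ii : 'i * 'i = -1 :> C by rewrite -expr2 sqr_i.
rewrite (@cintE _ c d (fun y => - 'i * P (b +i* y))) //; last first.
  move=> t /onB_ver[t1 t2].
  have -> : f (b +i* t) = - 'i * (f (b +i* t) * 'i).
    by rewrite mulrCA mulNr ii opprK mulr1.
  by apply: crdZ; exact: (crd_comp (crd_ver _ _) (PP _ _)).
rewrite (@cintE _ c d (fun y => - 'i * P (a +i* y))) //; last first.
  move=> t /onB_ver[t1 t2].
  have -> : f (a +i* t) = - 'i * (f (a +i* t) * 'i).
    by rewrite mulrCA mulNr ii opprK mulr1.
  by apply: crdZ; exact: (crd_comp (crd_ver _ _) (PP _ _)).
have -> : 'i * (- 'i * P (b +i* d) - - 'i * P (b +i* c) -
  (- 'i * P (a +i* d) - - 'i * P (a +i* c))) = - ('i * 'i) *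
  (P (b +i* d) - P (b +i* c) - P (a +i* d) + P (a +i* c)) by ring.
by rewrite ii; ring.
Qed.

End Boundary.

Lemma onB_inR a b c d z : onB a b c d z -> inR a b c d z.
Proof. by case. Qed.

Lemma inR_sub a b c d a' b' c' d' z : a' <= a -> b <= b' -> c' <= c -> d <= d' ->
  inR a b c d z -> inR a' b' c' d' z.
Proof.
move=> aa bb cc dd /andP[/andP[h1 h2] /andP[h3 h4]]; rewrite /inR.
by rewrite (le_trans aa) // (le_trans h2) // (le_trans cc) // (le_trans h4).
Qed.

Lemma rint_splitx f a m b c d : a <= m -> m <= b -> c <= d ->
  (forall z, inR a b c d z -> ccont f z) ->
  rint f a b c d = rint f a m c d + rint f m b c d.
Proof.
move=> am mb cd cf.
have [s1 s2 _ _] := ccont_sides (le_trans am mb) cd (fun z zB => cf z (onB_inR zB)).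
by rewrite /rint !(cint_split am mb) //; ring.
Qed.

Lemma rint_splity f a b c m d : a <= b -> c <= m -> m <= d ->
  (forall z, inR a b c d z -> ccont f z) ->
  rint f a b c d = rint f a b c m + rint f a b m d.
Proof.
move=> ab cm md cf.
have [_ _ s1 s2] := ccont_sides ab (le_trans cm md) (fun z zB => cf z (onB_inR zB)).
by rewrite /rint !(cint_split cm md) //; ring.
Qed.

End LineIntegrals.

(** * Goursat's theorem *)

Section Goursat.
Variable R : realType.
Notation C := R[i].
Implicit Types (x y a b c d s t : R) (z w l : C) (f g : C -> C).

Lemma cdiff_eq f z l l' : cdiff f z l -> l = l' -> cdiff f z l'.
Proof. by move=> ? <-. Qed.

Lemma two_pow_gt (x : R) : exists n, x < 2 ^+ n.
Proof.
exists (Num.bound `|x|); apply: (le_lt_trans (ler_norm x)).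
apply: (lt_trans (archi_boundP (normr_ge0 x))).
by rewrite -natrX ltr_nat ltn_expl.
Qed.

Lemma inR_dist a b c d z w : inR a b c d z -> inR a b c d w ->
  cmod (z - w) <= (b - a) + (d - c).
Proof.
move=> /andP[/andP[z1 z2] /andP[z3 z4]] /andP[/andP[w1 w2] /andP[w3 w4]].
apply: (le_trans (cmod_le_ReIm _)); rewrite cReD cReN cImD cImN.
by apply: lerD; rewrite ler_norml; lra.
Qed.

(** The affine function [h] has a quadratic primitive and integrates to 0, so only the error of the
    linear approximation remains. *)
Lemma rint_affine_err f a b c d zs l (e : R) : a <= b -> c <= d ->
  (forall z, inR a b c d z -> ccont f z) ->
  (forall z, inR a b c d z -> cmod (f z - f zs - l * (z - zs)) <= e) ->
  cmod (rint f a b c d) <= 2 * e * ((b - a) + (d - c)).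
Proof.
move=> ab cd cf fe.
pose g z := f z - f zs - l * (z - zs); pose h z := f zs + l * (z - zs).
have ch z : ccont h z.
  apply: ccontD; first exact: ccont_cst.
  apply: ccontM; first exact: ccont_cst.
  by apply: ccontB; [exact: ccont_id|exact: ccont_cst].
have cg z : onB a b c d z -> ccont g z.
  move=> /onB_inR zR; apply: ccontB; first by apply: ccontB; [exact: cf|exact: ccont_cst].
  apply: ccontM; first exact: ccont_cst.
  by apply: ccontB; [exact: ccont_id|exact: ccont_cst].
have -> : rint f a b c d = rint (fun z => g z + h z) a b c d.
  by apply: eq_rint => // z _; rewrite /g /h; ring.
rewrite rintD //.
rewrite (@rint_primitive _ _ _ _ _ ab cd h
  (fun z => f zs * z + l / 2 * (z - zs) ^+ 2)) ?addr0.
  by apply: rint_bound => // z /onB_inR; exact: fe.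
move=> z _; apply: cdiff_eq.
  exact: cdiffD (cdiffM (cdiff_cst (f zs) z) (cdiff_id z))
    (cdiffM (cdiff_cst (l/2) z) (cdiffX 1 (cdiffB (cdiff_id z) (cdiff_cst zs z)))).
by rewrite /h; field.
Qed.

Lemma rint_quarter f x y (w h : R) : 0 <= w -> 0 <= h ->
  (forall z, inR x (x + w + w) y (y + h + h) z -> ccont f z) ->
  rint f x (x + w + w) y (y + h + h) =
  rint f x (x + w) y (y + h) + rint f x (x + w) (y + h) (y + h + h) +
  (rint f (x + w) (x + w + w) y (y + h) +
   rint f (x + w) (x + w + w) (y + h) (y + h + h)).
Proof.
move=> w0 h0 cf; have x1 : x <= x + w by rewrite lerDl.
have x2 : x + w <= x + w + w by rewrite lerDl.
have y1 : y <= y + h by rewrite lerDl.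
have y2 : y + h <= y + h + h by rewrite lerDl.
rewrite (@rint_splitx _ _ _ (x + w)) ?(le_trans y1) //.
rewrite (@rint_splity _ _ _ _ _ (y + h)) //; last first.
  by move=> z zR; apply: cf; apply: inR_sub zR.
rewrite (@rint_splity _ _ (x + w) _ _ (y + h)) //.
by move=> z zR; apply: cf; apply: inR_sub zR.
Qed.

(** Repeated quartering: a nonzero integral leaves, in each generation [n], a rectangle carrying at
    least [4 ^- n] of it. Differentiability at the common point of these rectangles bounds their
    integrals by an arbitrarily small multiple of the squared size, which is of the same order
    [4 ^- n]. *)
Lemma goursat f a b c d : a <= b -> c <= d ->
  (forall z, inR a b c d z -> cder f z) -> rint f a b c d = 0.
Proof.
move=> ab cd df; have cf z : inR a b c d z -> ccont f z by move=> /df/cder_ccont.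
apply/eqP; rewrite -cmod_eq0; apply/negPn/negP => r0.
set eta := cmod (rint f a b c d) in r0.
have eta0 : 0 < eta by rewrite lt_def r0 cmod_ge0.
pose wd n := (b - a) / 2 ^+ n; pose ht n := (d - c) / 2 ^+ n.
have wd0 n : 0 <= wd n by rewrite divr_ge0 ?subr_ge0 ?exprn_ge0.
have ht0 n : 0 <= ht n by rewrite divr_ge0 ?subr_ge0 ?exprn_ge0.
have wdS n : wd n = wd n.+1 + wd n.+1.
  by rewrite /wd exprS; field; rewrite expf_neq0 ?pnatr_eq0.
have htS n : ht n = ht n.+1 + ht n.+1.
  by rewrite /ht exprS; field; rewrite expf_neq0 ?pnatr_eq0.
pose ri n (p : R * R) := cmod (rint f p.1 (p.1 + wd n) p.2 (p.2 + ht n)).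
(* A rectangle is coded by its lower left corner, its size being fixed by the generation [n]. *)
pose P n (p : R * R) := [/\ a <= p.1, p.1 + wd n <= b, c <= p.2,
  p.2 + ht n <= d & eta <= 4 ^+ n * ri n p].
pose Q n (p p' : R * R) := [/\ P n.+1 p', p.1 <= p'.1, p'.1 + wd n.+1 <= p.1 + wd n,
  p.2 <= p'.2 & p'.2 + ht n.+1 <= p.2 + ht n].
have step (np : nat * (R * R)) : exists p', P np.1 np.2 -> Q np.1 np.2 p'.
  case: np => n [x y] /=.
  (* If no quarter inherits the invariant, the four integrals are each below a quarter of the
     required size, and their sum falls short. *)
  apply: contrapT => /forallNP noP; have Pn : P n (x, y).
    by apply: contrapT => nP; apply: (noP (x, y)) => /nP.
  case: (Pn) => /= ax xb cy yd; rewrite /ri /=.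
  have [w0 h0] := (wd0 n.+1, ht0 n.+1).
  move: xb yd; rewrite (wdS n) (htS n) !addrA => xb yd.
  have cf' z : inR x (x + wd n.+1 + wd n.+1) y (y + ht n.+1 + ht n.+1) z -> ccont f z.
    by move=> zR; apply: cf; exact: inR_sub zR.
  rewrite rint_quarter //.
  pose p1 := (x, y); pose p2 := (x, y + ht n.+1).
  pose p3 := (x + wd n.+1, y); pose p4 := (x + wd n.+1, y + ht n.+1).
  have bad p' : p' = p1 \/ p' = p2 \/ p' = p3 \/ p' = p4 ->
      4 ^+ n * (4 * ri n.+1 p') < eta.
    move=> Hp; rewrite ltNge mulrA -exprSr; apply/negP => etale.
    apply: (noP p') => _; rewrite /Q /P /= (wdS n) (htS n).
    have x1 := lerDl x (wd n.+1); have y1 := lerDl y (ht n.+1); rewrite w0 in x1; rewrite h0 in y1.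
    have x2 := lerDl (x + wd n.+1) (wd n.+1); have y2 := lerDl (y + ht n.+1) (ht n.+1).
    rewrite w0 in x2; rewrite h0 in y2.
    have axw := le_trans ax x1; have cyh := le_trans cy y1.
    have xwb := le_trans x2 xb; have yhd := le_trans y2 yd.
    by move: Hp etale => [|[|[|]]] ->; rewrite /p1 /p2 /p3 /p4 /= => etale;
      split; rewrite ?addrA //; split; rewrite /= ?addrA.
  have B1 := bad p1 (or_introl erefl).
  have B2 := bad p2 (or_intror (or_introl erefl)).
  have B3 := bad p3 (or_intror (or_intror (or_introl erefl))).
  have B4 := bad p4 (or_intror (or_intror (or_intror erefl))).
  move=> etale.
  suff : eta < eta by rewrite ltxx.
  apply: (le_lt_trans etale).
  have := cmodD (rint f x (x + wd n.+1) y (y + ht n.+1) +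
    rint f x (x + wd n.+1) (y + ht n.+1) (y + ht n.+1 + ht n.+1))
    (rint f (x + wd n.+1) (x + wd n.+1 + wd n.+1) y (y + ht n.+1) +
    rint f (x + wd n.+1) (x + wd n.+1 + wd n.+1) (y + ht n.+1) (y + ht n.+1 + ht n.+1)).
  have := cmodD (rint f x (x + wd n.+1) y (y + ht n.+1))
    (rint f x (x + wd n.+1) (y + ht n.+1) (y + ht n.+1 + ht n.+1)).
  have := cmodD (rint f (x + wd n.+1) (x + wd n.+1 + wd n.+1) y (y + ht n.+1))
    (rint f (x + wd n.+1) (x + wd n.+1 + wd n.+1) (y + ht n.+1) (y + ht n.+1 + ht n.+1)).
  move: B1 B2 B3 B4; rewrite /ri /p1 /p2 /p3 /p4 /=.
  move: (cmod (rint f x _ y _)) (cmod (rint f x _ (y + _) _)) (cmod (rint f (x + _) _ y _))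
    (cmod (rint f (x + _) _ (y + _) _)) => r1 r2 r3 r4 B1 B2 B3 B4 T1 T2 T3.
  set S := cmod _ in T3 *; have k0 : 0 < 4 ^+ n :> R by rewrite exprn_gt0.
  have : 4 ^+ n * S <= 4 ^+ n * (r1 + r2 + (r3 + r4)) by rewrite ler_pM2l //; lra.
  by move/le_lt_trans; apply; lra.
have [F FP] := choice step.
pose s n := iteri n (fun k p => F (k, p)) (a, c).
have Ps n : P n (s n).
  elim: n => [|n IH]; last by case: (FP (n, s n) IH).
  rewrite /P /ri /= /wd /ht expr0 !divr1 mul1r.
  by rewrite ![_ + (_ - _)]addrC !subrK !lexx.
have nest n := FP (n, s n) (Ps n).
have s1 m n : (m <= n)%N -> (s m).1 <= (s n).1.
  elim: n => [|n IH]; first by rewrite leqn0 => /eqP->.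
  rewrite leq_eqVlt => /predU1P[-> //|/IH/le_trans]; apply.
  by case: (nest n).
have s2 m n : (m <= n)%N -> (s m).2 <= (s n).2.
  elim: n => [|n IH]; first by rewrite leqn0 => /eqP->.
  rewrite leq_eqVlt => /predU1P[-> //|/IH/le_trans]; apply.
  by case: (nest n).
have s1' m n : (m <= n)%N -> (s n).1 + wd n <= (s m).1 + wd m.
  elim: n => [|n IH]; first by rewrite leqn0 => /eqP->.
  rewrite leq_eqVlt => /predU1P[-> //|/IH]; apply: le_trans.
  by case: (nest n).
have s2' m n : (m <= n)%N -> (s n).2 + ht n <= (s m).2 + ht m.
  elim: n => [|n IH]; first by rewrite leqn0 => /eqP->.
  rewrite leq_eqVlt => /predU1P[-> //|/IH]; apply: le_trans.
  by case: (nest n).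
have s1u m n : (s m).1 <= (s n).1 + wd n.
  have [mn|/ltnW nm] := leqP m n.
    by apply: (le_trans (s1 _ _ mn)); rewrite lerDl.
  by apply: le_trans (s1' _ _ nm); rewrite lerDl.
have s2u m n : (s m).2 <= (s n).2 + ht n.
  have [mn|/ltnW nm] := leqP m n.
    by apply: (le_trans (s2 _ _ mn)); rewrite lerDl.
  by apply: le_trans (s2' _ _ nm); rewrite lerDl.
(* The common point of the nested rectangles: its coordinates are the suprema of those of the
   corners. *)
pose p := sup (range (fun n => (s n).1)); pose q := sup (range (fun n => (s n).2)).
have pI n : (s n).1 <= p <= (s n).1 + wd n.
  apply/andP; split.
    apply: ub_le_sup; last by exists n.
    by exists ((s n).1 + wd n) => _ [m _ <-].
  by apply: ge_sup => [|_ [m _ <-]//]; exists (s 0%N).1, 0%N.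
have qI n : (s n).2 <= q <= (s n).2 + ht n.
  apply/andP; split.
    apply: ub_le_sup; last by exists n.
    by exists ((s n).2 + ht n) => _ [m _ <-].
  by apply: ge_sup => [|_ [m _ <-]//]; exists (s 0%N).2, 0%N.
have zsI n : inR (s n).1 ((s n).1 + wd n) (s n).2 ((s n).2 + ht n) (p +i* q).
  by rewrite /inR /= pI qI.
have sub n z : inR (s n).1 ((s n).1 + wd n) (s n).2 ((s n).2 + ht n) z -> inR a b c d z.
  by case: (Ps n) => *; apply: inR_sub; eassumption.
have [l /cdiffP lP] := df _ (sub _ _ (zsI 0%N)).
pose L := (b - a) + (d - c).
have L0 : 0 <= L by rewrite addr_ge0 ?subr_ge0.
(* The final bound is [2 * e * L ^+ 2], and this choice puts it below [eta]; the [+ 1] covers the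
   degenerate case [L = 0]. *)
pose e := eta / (4 * (L ^+ 2 + 1)).
have L1 : 0 < L ^+ 2 + 1 by rewrite ltr_wpDl ?sqr_ge0.
have e0 : 0 < e by rewrite divr_gt0 // mulr_gt0.
have [del del0 delP] := lP _ e0.
have [n nP] := two_pow_gt (L / del).
have k0 : 0 < 2 ^+ n :> R by rewrite exprn_gt0.
have LnE : wd n + ht n = L / 2 ^+ n by rewrite /wd /ht /L -mulrDl.
have Ln : L / 2 ^+ n < del.
  by rewrite ltr_pdivrMr // mulrC -ltr_pdivrMr.
have [_ _ _ _] := Ps n; rewrite /ri.
apply/negP; rewrite -ltNge.
have := @rint_affine_err f (s n).1 ((s n).1 + wd n) (s n).2 ((s n).2 + ht n)
  (p +i* q) l (e * (L / 2 ^+ n)).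
rewrite !lerDl wd0 ht0 => /(_ isT isT) H.
have E1 : (s n).1 + wd n - (s n).1 + ((s n).2 + ht n - (s n).2) = L / 2 ^+ n.
  by rewrite -LnE; ring.
rewrite E1 in H.
apply: (@le_lt_trans _ _ (4 ^+ n * (2 * (e * (L / 2 ^+ n)) * (L / 2 ^+ n)))).
  rewrite ler_pM2l ?exprn_gt0 //; apply: H => [z /sub/cf//|z zR].
  have zd : cmod (z - (p +i* q)) <= L / 2 ^+ n.
    by rewrite -E1; exact: inR_dist (zsI n).
  apply: (le_trans (delP z (le_lt_trans zd Ln))).
  by rewrite ler_pM2l.
have -> : 4 ^+ n * (2 * (e * (L / 2 ^+ n)) * (L / 2 ^+ n)) = 2 * e * L ^+ 2.
  have -> : 4 ^+ n = 2 ^+ n * 2 ^+ n :> R by rewrite -exprMn -natrM.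
  by field; rewrite gt_eqF.
rewrite /e.
have -> : 2 * (eta / (4 * (L ^+ 2 + 1))) * L ^+ 2 =
  eta * (L ^+ 2 / (2 * (L ^+ 2 + 1))) by field; rewrite gt_eqF.
rewrite -[ltRHS]mulr1 ltr_pM2l // ltr_pdivrMr ?mulr_gt0 // mul1r.
by move: (sqr_ge0 L); lra.
Qed.

(** Four rectangles on which [f] is differentiable are cut off, leaving a small square around [zs];
    continuity at [zs] bounds the integral over its boundary by a multiple of the perimeter. *)
Lemma goursat_punctured f a b c d zs : a < complex.Re zs < b ->
  c < complex.Im zs < d ->
  (forall z, inR a b c d z -> ccont f z) ->
  (forall z, inR a b c d z -> z != zs -> cder f z) -> rint f a b c d = 0.
Proof.
case: zs => p q /= /andP[ap pb] /andP[cq qd] cf df.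
apply/eqP; rewrite -cmod_eq0 eq_le cmod_ge0 andbT.
apply/ler_addgt0Pr => e e0; rewrite add0r.
have pqI : inR a b c d (p +i* q) by rewrite /inR /= !ltW.
have /ccontCP/(_ 1 ltr01)[d0 d00 d0P] := cf _ pqI.
pose M := cmod (f (p +i* q)) + 1.
have M0 : 0 < M by rewrite ltr_wpDl ?cmod_ge0.
(* [d0 / 5] because points of the small square are within [4 * del] of its centre, [e / (8 * M)]
   because its perimeter is [8 * del]. *)
pose del := Num.min (Num.min (d0 / 5) (e / (8 * M)))
  (Num.min (Num.min (p - a) (b - p)) (Num.min (q - c) (d - q))).
have del0 : 0 < del.
  by rewrite !lt_min !subr_gt0 ap pb cq qd !divr_gt0 // mulr_gt0.
have : del <= del by [].
rewrite {2}/del !le_min => /andP[/andP[k1 k2] /andP[/andP[k3 k4] /andP[k5 k6]]].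
rewrite (@rint_splitx _ _ _ (p - del)) //; try lra.
rewrite goursat ?add0r; try lra; last first.
  move=> z zR; apply: df; first by apply: inR_sub zR; lra.
  by apply/eqP => zE; move: zR; rewrite zE /inR /=; lra.
rewrite (@rint_splitx _ _ _ (p + del)) //; try lra; last first.
  by move=> z zR; apply: cf; apply: inR_sub zR; lra.
rewrite [X in _ + X]goursat ?addr0; try lra; last first.
  move=> z zR; apply: df; first by apply: inR_sub zR; lra.
  by apply/eqP => zE; move: zR; rewrite zE /inR /=; lra.
rewrite (@rint_splity _ _ _ _ _ (q - del)) //; try lra; last first.
  by move=> z zR; apply: cf; apply: inR_sub zR; lra.
rewrite goursat ?add0r; try lra; last first.
  move=> z zR; apply: df; first by apply: inR_sub zR; lra.
  by apply/eqP => zE; move: zR; rewrite zE /inR /=; lra.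
rewrite (@rint_splity _ _ _ _ _ (q + del)) //; try lra; last first.
  by move=> z zR; apply: cf; apply: inR_sub zR; lra.
rewrite [X in _ + X]goursat ?addr0; try lra; last first.
  move=> z zR; apply: df; first by apply: inR_sub zR; lra.
  by apply/eqP => zE; move: zR; rewrite zE /inR /=; lra.
apply: (@le_trans _ _ (2 * M * ((p + del - (p - del)) + (q + del - (q - del))))).
  apply: rint_bound; try lra.
    by move=> z /onB_inR zR; apply: cf; apply: inR_sub zR; lra.
  move=> z /onB_inR zR.
  have /d0P fz : cmod (z - (p +i* q)) < d0.
    apply: (@le_lt_trans _ _ (p + del - (p - del) + (q + del - (q - del)))); last lra.
    by apply: inR_dist zR _; rewrite /inR /=; lra.
  rewrite /M -lerBlDl; apply: (le_trans (cmod_sub_le _ _)); exact: ltW.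
have -> : 2 * M * (p + del - (p - del) + (q + del - (q - del))) = del * (8 * M) by ring.
by rewrite -ler_pdivlMr // mulr_gt0.
Qed.

End Goursat.

(** * Cauchy's integral formula on a square *)

Section CauchyFormula.
Variable R : realType.
Notation C := R[i].
Implicit Types (x y a b c d t : R) (z w l : C) (f g p : C -> C).

Lemma conton_bounded a b (p : R -> C) : a <= b -> conton a b p ->
  exists M : R, forall t, a <= t <= b -> cmod (p t) <= M.
Proof.
move=> ab cp; have [|t tI tM] := @EVT_max R (fun t => cmod (p t)) a b ab.
  apply: continuous_in_subspaceT => t; rewrite inE /= in_itv /= => tI.
  exact: ccont_cmod (cp t tI).
by exists (cmod (p t)) => u uI; apply: tM; rewrite in_itv.
Qed.

Variables (z0 : C) (s : R).
Hypothesis s0 : 0 < s.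

Let a := complex.Re z0 - s.
Let b := complex.Re z0 + s.
Let c := complex.Im z0 - s.
Let d := complex.Im z0 + s.
Let ab : a <= b. Proof. by rewrite /a /b; move: s0; lra. Qed.
Let cd : c <= d. Proof. by rewrite /c /d; move: s0; lra. Qed.

Definition square z := inR (complex.Re z0 - s) (complex.Re z0 + s)
  (complex.Im z0 - s) (complex.Im z0 + s) z.
Definition onS z := onB (complex.Re z0 - s) (complex.Re z0 + s)
  (complex.Im z0 - s) (complex.Im z0 + s) z.
Definition bint p := rint p (complex.Re z0 - s) (complex.Re z0 + s)
  (complex.Im z0 - s) (complex.Im z0 + s).
Definition contS p := forall z, onS z -> ccont p z.
(* Up to a constant factor, the Cauchy transform of [p]. *)
Definition CT p z := bint (fun u => p u / (u - z)).

Lemma square_le z : square z -> cmod (z - z0) <= 2 * s.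
Proof.
move=> /andP[/andP[h1 h2] /andP[h3 h4]].
apply: (le_trans (cmod_le_ReIm _)); rewrite cReD cReN cImD cImN.
rewrite mulrDl mul1r; apply: lerD; rewrite ler_norml.
  by apply/andP; split; lra.
by apply/andP; split; lra.
Qed.

Lemma onS_square z : onS z -> square z. Proof. by case. Qed.

Lemma onS_ge z : onS z -> s <= cmod (z - z0).
Proof.
have s1 : `|s| = s by rewrite gtr0_norm.
case=> _ [] E; rewrite -{1}s1.
- apply: le_trans (Re_le_cmod _); rewrite cReD cReN E.
  by rewrite (_ : _ - _ - _ = - s) ?normrN //; ring.
- apply: le_trans (Re_le_cmod _); rewrite cReD cReN E.
  by rewrite (_ : _ + _ - _ = s) //; ring.
- apply: le_trans (Im_le_cmod _); rewrite cImD cImN E.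
  by rewrite (_ : _ - _ - _ = - s) ?normrN //; ring.
- apply: le_trans (Im_le_cmod _); rewrite cImD cImN E.
  by rewrite (_ : _ + _ - _ = s) //; ring.
Qed.

Lemma onS_dist z u : onS u -> s - cmod (z - z0) <= cmod (u - z).
Proof.
by move=> /onS_ge su; have := cmod_tri u z z0; lra.
Qed.

Lemma onS_neq z u : cmod (z - z0) < s -> onS u -> u - z != 0.
Proof.
move=> zs /(onS_dist z) uz; rewrite -cmod_gt0; apply: lt_le_trans uz.
by rewrite subr_gt0.
Qed.

Lemma square_in z : cmod (z - z0) < s ->
  (a < complex.Re z < b) /\ (c < complex.Im z < d).
Proof.
move=> zs; have := le_lt_trans (Re_le_cmod _) zs.
have := le_lt_trans (Im_le_cmod _) zs.
rewrite cImD cImN cReD cReN !ltr_norml => /andP[h1 h2] /andP[h3 h4].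
by rewrite /a /b /c /d; split; apply/andP; split; lra.
Qed.

Lemma bint_bound p (M : R) : contS p -> (forall u, onS u -> cmod (p u) <= M) ->
  cmod (bint p) <= 8 * s * M.
Proof.
move=> cp pM; apply: (le_trans (rint_bound ab cd cp pM)).
by rewrite /a /b /c /d le_eqVlt; apply/orP; left; apply/eqP; ring.
Qed.

Lemma bintD p g : contS p -> contS g -> bint (fun u => p u + g u) = bint p + bint g.
Proof. exact: rintD. Qed.

Lemma bintZ w p : contS p -> bint (fun u => w * p u) = w * bint p.
Proof. exact: rintZ. Qed.

Lemma bintB p g : contS p -> contS g -> bint (fun u => p u - g u) = bint p - bint g.
Proof.
move=> cp cg; have cN : contS (fun u => -1 * g u).
  by move=> u uS; apply: ccontM; [exact: ccont_cst|exact: cg].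
rewrite -mulN1r -(bintZ (-1) cg) -(bintD cp cN).
by congr bint; apply/funext => u; rewrite mulN1r.
Qed.

Lemma eq_bint p g : (forall u, onS u -> p u = g u) -> bint p = bint g.
Proof. exact: eq_rint. Qed.

Lemma contS_bounded p : contS p ->
  exists2 M : R, 0 <= M & forall u, onS u -> cmod (p u) <= M.
Proof.
move=> /(ccont_sides ab cd)[s1 s2 s3 s4].
have [M1 M1P] := conton_bounded ab s1; have [M2 M2P] := conton_bounded ab s2.
have [M3 M3P] := conton_bounded cd s3; have [M4 M4P] := conton_bounded cd s4.
exists (`|M1| + `|M2| + `|M3| + `|M4|); first by rewrite !addr_ge0.
have H1 := ler_norm M1; have H2 := ler_norm M2; have H3 := ler_norm M3.
have H4 := ler_norm M4; have N1 := normr_ge0 M1; have N2 := normr_ge0 M2.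
have N3 := normr_ge0 M3; have N4 := normr_ge0 M4.
case=> x y [/= /andP[xI yI] []] E; move: xI yI; rewrite /= in E; rewrite /= E => xI yI.
- by have := M3P y yI; rewrite /a; lra.
- by have := M4P y yI; rewrite /b; lra.
- by have := M1P x xI; rewrite /c; lra.
- by have := M2P x xI; rewrite /d; lra.
Qed.

Lemma ccont_shift z u : ccont (fun v : C => v - z) u.
Proof. by apply: ccontB; [exact: ccont_id|exact: ccont_cst]. Qed.

Lemma contS_div p z : cmod (z - z0) < s -> contS p ->
  contS (fun u => p u / (u - z)).
Proof.
move=> zs cp u uS; apply: ccont_div; [exact: onS_neq|exact: cp|].
exact: ccont_shift.
Qed.

(** The resolvent identity for the kernel [1 / (u - z)]. It replaces differentiation under the
    integral sign: the difference quotient of a Cauchy transform is again a Cauchy transform, so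
    continuity of these yields differentiability. *)
Lemma CT_sub p z w : contS p -> cmod (z - z0) < s -> cmod (w - z0) < s ->
  CT p w - CT p z = (w - z) * CT (fun u => p u / (u - z)) w.
Proof.
move=> cp zs ws; have cz := contS_div zs cp; have cw := contS_div ws cp.
rewrite /CT -(bintB cw cz) -(bintZ (w - z) (contS_div ws cz)).
apply: eq_bint => u uS; field.
by rewrite !onS_neq.
Qed.

Lemma CT_bound p z (M : R) : contS p -> cmod (z - z0) < s ->
  (forall u, onS u -> cmod (p u) <= M) ->
  cmod (CT p z) <= 8 * s * (M / (s - cmod (z - z0))).
Proof.
move=> cp zs pM; apply: bint_bound; first exact: contS_div.
move=> u uS; rewrite cmodM cmodV; apply: ler_pM; rewrite ?cmod_ge0 ?invr_ge0 ?cmod_ge0 //.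
  exact: pM.
rewrite lef_pV2 ?posrE ?cmod_gt0 ?onS_neq ?subr_gt0 //; exact: onS_dist.
Qed.

Lemma CT_ccont p z : contS p -> cmod (z - z0) < s -> ccont (CT p) z.
Proof.
move=> cp zs; have [M M0 MP] := contS_bounded (contS_div zs cp).
pose del := s - cmod (z - z0); have del0 : 0 < del by rewrite subr_gt0.
pose K := 8 * s * (M / (del / 2)).
have del2 : 0 < del / 2 by rewrite divr_gt0.
have K0 : 0 <= K.
  by apply: mulr_ge0; [rewrite mulr_ge0 // ltW|rewrite divr_ge0 // ltW].
apply/ccontCP => e e0; exists (Num.min (del / 2) (e / (K + 1))).
  by rewrite lt_min !divr_gt0 // ltr_wpDl.
move=> w; rewrite lt_min => /andP[w1 w2].
have wd : del / 2 <= s - cmod (w - z0).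
  by have := cmod_tri w z z0; move: w1; rewrite /del; lra.
have ws : cmod (w - z0) < s.
  by move: wd del2; lra.
rewrite CT_sub // cmodM.
apply: (@le_lt_trans _ _ (cmod (w - z) * K)).
  rewrite ler_wpM2l ?cmod_ge0 //.
  apply: (le_trans (CT_bound (contS_div zs cp) ws MP)).
  rewrite /K ler_pM2l ?mulr_gt0 // ler_wpM2l // lef_pV2 // posrE ?divr_gt0 ?subr_gt0 //.
move: w2; rewrite ltr_pdivlMr ?ltr_wpDl //; apply: le_lt_trans.
by rewrite ler_wpM2l ?cmod_ge0 // lerDl.
Qed.

Lemma near_disc z (r : R) : cmod (z - z0) < r ->
  \forall w \near z, cmod (w - z0) < r.
Proof.
move=> zs; apply/nbhsCP; exists (r - cmod (z - z0)); first by rewrite subr_gt0.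
by move=> w wz; have := cmod_tri w z z0; move: wz; lra.
Qed.

Lemma CT_cdiff p z : contS p -> cmod (z - z0) < s ->
  cdiff (CT p) z (CT (fun u => p u / (u - z)) z).
Proof.
move=> cp zs; apply: cdiff_near; first by apply: CT_ccont => //; exact: contS_div.
apply: filterS (near_disc zs) => w ws.
by rewrite -CT_sub // addrC subrK.
Qed.

(* [bint (u |-> 1 / (u - z))] is the constant [2 * pi * i]; only its
   independence of [z] and a lower bound of its modulus are needed. *)
Definition Wind := CT (fun=> 1) z0.

(** The derivative in [z] is the boundary integral of [1 / (u - z) ^+ 2], which has the primitive
    [- 1 / (u - z)]. The transform is therefore constant along the segment from [z0] to [z]. *)
Lemma Wind_const z : cmod (z - z0) < s -> CT (fun=> 1) z = Wind.
Proof.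
move=> zs; have c1 : contS (fun=> 1) by move=> u _; exact: ccont_cst.
pose k (t : R) := z0 + t%:C * (z - z0).
have kin t : 0 <= t <= 1 -> cmod (k t - z0) < s.
  move=> /andP[t0 t1]; rewrite /k addrC addKr cmodM cmodR ger0_norm //.
  by apply: le_lt_trans zs; rewrite -[leRHS]mul1r ler_wpM2r ?cmod_ge0.
apply/eqP; rewrite -subr_eq0 -cmod_eq0 eq_le cmod_ge0 andbT.
have -> : CT (fun=> 1) z = CT (fun=> 1) (k 1).
  by rewrite /k mul1r addrC subrK.
have -> : Wind = CT (fun=> 1) (k 0) by rewrite /k mul0r addr0.
have := @crd_bound _ (fun t => CT (fun=> 1) (k t)) (fun _ => 0) 0 1 0 ler01.
rewrite mul0r; apply => t tI.
  have {1}-> : (0 : C) = 0 * (z - z0) by rewrite mul0r.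
  apply: crd_comp; first exact: crd_line.
  apply: cdiff_eq; first exact: (CT_cdiff c1 (kin _ tI)).
  apply: (@rint_primitive _ _ _ _ _ ab cd _ (fun u => - (u - k t)^-1)) => u uS.
  apply: cdiff_eq.
    apply: cdiffN; apply: cdiffV; last exact: cdiffB (cdiff_id _) (cdiff_cst _ _).
    exact: (onS_neq (kin _ tI) uS).
  by have := onS_neq (kin _ tI) uS; move: (u - k t) => v v0 /=; field.
by rewrite cmod0.
Qed.

Lemma Im_cint_ge k (p : R -> C) x y (m : R) : x <= y -> conton x y p ->
  (forall t, x <= t <= y -> m <= complex.Im (k * p t)) ->
  m * (y - x) <= complex.Im (k * cint x y p).
Proof.
move=> xy cp pm; rewrite -cintZ //; apply: cint_Im_ge => // t tI.
by apply: ccontM; [exact: ccont_cst|exact: cp].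
Qed.

(** On each edge, with its direction included, the integrand has imaginary part
    [s / (x ^+ 2 + s ^+ 2)], which is at least [1 / (2 * s)]. An edge has length [2 * s], so each of
    the four contributes at least 1. *)
Lemma Wind_ge : 4 <= cmod Wind.
Proof.
apply: le_trans (Im_le_cmod _); apply: le_trans (ler_norm _).
have z0s : cmod (z0 - z0) < s by rewrite subrr cmod0.
have c1 : contS (fun u => 1 / (u - z0)).
  by apply: contS_div => // u _; exact: ccont_cst.
have [s1 s2 s3 s4] := ccont_sides ab cd c1.
have key (x : R) : - s <= x <= s -> (2 * s)^-1 <= s / (x ^+ 2 + s ^+ 2).
  move=> /andP[h1 h2]; rewrite ler_pdivlMr ?ltr_wpDl ?sqr_ge0 ?exprn_gt0 //.
  rewrite mulrC ler_pdivrMr ?mulr_gt0 //.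
  have : 0 <= (s - x) * (s + x) by apply: mulr_ge0; lra.
  by rewrite !expr2; nra.
have B k (p : R -> C) x y : y - x = 2 * s -> conton x y p ->
    (forall t, x <= t <= y -> (2 * s)^-1 <= complex.Im (k * p t)) ->
    1 <= complex.Im (k * cint x y p).
  move=> yx cp pm; have xy : x <= y by move: s0; lra.
  apply: le_trans (Im_cint_ge xy cp pm).
  by rewrite yx mulVf // gt_eqF // mulr_gt0.
have -> : complex.Im Wind =
  complex.Im (1 * cint a b (fun x => 1 / ((x +i* c) - z0))) +
  complex.Im (-1 * cint a b (fun x => 1 / ((x +i* d) - z0))) +
  complex.Im ('i * cint c d (fun y => 1 / ((b +i* y) - z0))) +
  complex.Im (- 'i * cint c d (fun y => 1 / ((a +i* y) - z0))).
  rewrite /Wind /CT /bint /rint -/a -/b -/c -/d -!cImD; congr (complex.Im _); ring.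
have baE : b - a = 2 * s by rewrite /a /b; ring.
have dcE : d - c = 2 * s by rewrite /c /d; ring.
have E1 := B 1 _ _ _ baE s1; have E2 := B (-1) _ _ _ baE s2.
have E3 := B 'i _ _ _ dcE s4; have E4 := B (- 'i) _ _ _ dcE s3.
suff : [/\ 1 <= complex.Im (1 * cint a b (fun x => 1 / ((x +i* c) - z0))),
  1 <= complex.Im (-1 * cint a b (fun x => 1 / ((x +i* d) - z0))),
  1 <= complex.Im ('i * cint c d (fun y => 1 / ((b +i* y) - z0))) &
  1 <= complex.Im (- 'i * cint c d (fun y => 1 / ((a +i* y) - z0)))].
  by case; lra.
split.
- apply: E1 => t tI; rewrite !mul1r cImV sqr_cmod cImD cImN cReD cReN /=.
  have -> : c - complex.Im z0 = - s by rewrite /c; ring.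
  rewrite opprK sqrrN; apply: key; move: tI; rewrite /a /b; lra.
- apply: E2 => t tI; rewrite mul1r mulN1r cImN cImV sqr_cmod cImD cImN cReD cReN /=.
  have -> : d - complex.Im z0 = s by rewrite /d; ring.
  rewrite mulNr opprK; apply: key; move: tI; rewrite /a /b; lra.
- apply: E3 => t tI; rewrite mul1r cImM /= mul0r mul1r add0r cReV sqr_cmod.
  rewrite cImD cImN cReD cReN /=.
  have -> : b - complex.Re z0 = s by rewrite /b; ring.
  rewrite [_ + (_ - _) ^+ 2]addrC; apply: key; move: tI; rewrite /c /d; lra.
- apply: E4 => t tI; rewrite mul1r mulNr cImN cImM /= mul0r mul1r add0r cReV sqr_cmod.
  rewrite cImD cImN cReD cReN /=.
  have -> : a - complex.Re z0 = - s by rewrite /a; ring.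
  rewrite mulNr opprK sqrrN [_ + (_ - _) ^+ 2]addrC; apply: key.
  by move: tI; rewrite /c /d; lra.
Qed.

Lemma Wind_neq0 : Wind != 0.
Proof. by rewrite -cmod_gt0; apply: lt_le_trans Wind_ge; rewrite ltr0n. Qed.

(** The difference quotient [g] of [f] at [z], completed by the derivative, is continuous on the
    square and differentiable off [z], so its boundary integral vanishes. That integral is
    [CT f z - f z * CT (fun=> 1) z]. *)
Lemma cauchy_formula f z : (forall w, square w -> cder f w) ->
  cmod (z - z0) < s -> f z = Wind^-1 * CT f z.
Proof.
move=> df zs; have [zR zI] := square_in zs.
have sz : square z.
  by rewrite /square /inR; move: zR zI; rewrite /a /b /c /d => /andP[? ?] /andP[? ?];
    rewrite !ltW.
have [q cq [qz qE]] := derP (df _ sz).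
pose g w := if w == z then der f z else (f w - f z) / (w - z).
have gq : g = q.
  apply/funext => w; rewrite /g; have [->//|wz] := eqVneq w z.
  by rewrite qE [X in X / _]addrC addKr mulrAC divff ?mul1r ?subr_eq0.
have dg w : square w -> w != z -> cder g w.
  move=> sw wz; apply: (@eq_near_cder _ (fun w => (f w - f z) / (w - z))).
    have : \forall v \near w, v != z.
      apply/nbhsCP; exists (cmod (w - z)); first by rewrite cmod_gt0 subr_eq0.
      by move=> v vw; apply/eqP => vz; move: vw; rewrite vz cmodB ltxx.
    by apply: filterS => v vz; rewrite /g (negbTE vz).
  apply: cder_div; first by rewrite subr_eq0.
    by apply: cderB; [exact: df|exact: cder_cst].
  by apply: cderB; [exact: cder_id|exact: cder_cst].
have cg w : square w -> ccont g w.
  move=> sw; have [->|wz] := eqVneq w z; first by rewrite gq.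
  exact: cder_ccont (dg _ sw wz).
have := goursat_punctured zR zI cg dg.
have cf : contS f by move=> u /onS_square/df/cder_ccont.
have c1 : contS (fun=> 1) by move=> u _; exact: ccont_cst.
rewrite -/(bint g) (@eq_bint _ (fun u => f u / (u - z) + (- f z) * (1 / (u - z)))).
  have c1z := contS_div zs c1.
  have c2 : contS (fun u => - f z * (1 / (u - z))).
    by move=> u uS; apply: ccontM; [exact: ccont_cst|exact: c1z].
  rewrite (bintD (contS_div zs cf) c2) (bintZ _ c1z).
  rewrite -/(CT f z) -/(CT (fun=> 1) z) Wind_const // mulNr => /eqP.
  by rewrite subr_eq0 => /eqP ->; rewrite mulrCA mulVf ?mulr1 // Wind_neq0.
move=> u uS; have uz := onS_neq zs uS.
rewrite /g; have -> : (u == z) = false by apply/negbTE; rewrite -subr_eq0.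
by field.
Qed.

(** Up to the factor [Wind], Cauchy's integral for the derivative. Its differentiability, again from
    a resolvent identity, shows that derivatives are holomorphic. *)
Definition CT2 p z := bint (fun u => p u / (u - z) / (u - z)).

Lemma CT2_sub p z w : contS p -> cmod (z - z0) < s -> cmod (w - z0) < s ->
  CT2 p w - CT2 p z = (w - z) * (CT2 (fun u => p u / (u - z)) w +
    CT (fun u => p u / (u - z) / (u - z)) w).
Proof.
move=> cp zs ws; have cz := contS_div zs cp; have cw := contS_div ws cp.
have c1 := contS_div ws (contS_div ws cz); have c2 := contS_div ws (contS_div zs cz).
have c3 : contS (fun u => p u / (u - z) / (u - w) / (u - w) +
    p u / (u - z) / (u - z) / (u - w)).
  by move=> u uS; apply: ccontD; [exact: c1|exact: c2].
rewrite /CT2 /CT -(bintB (contS_div ws cw) (contS_div zs cz)) -(bintD c1 c2).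
rewrite -(bintZ (w - z) c3).
apply: eq_bint => u uS; field.
by rewrite !onS_neq.
Qed.

Lemma CT2_bound p z (M : R) : contS p -> cmod (z - z0) < s -> 0 <= M ->
  (forall u, onS u -> cmod (p u) <= M) ->
  cmod (CT2 p z) <= 8 * s * (M / (s - cmod (z - z0)) / (s - cmod (z - z0))).
Proof.
move=> cp zs M0 pM; apply: (@CT_bound (fun u => p u / (u - z))) => //.
  exact: contS_div.
move=> u uS; rewrite cmodM cmodV; apply: ler_pM; rewrite ?cmod_ge0 ?invr_ge0 ?cmod_ge0 //.
  exact: pM.
rewrite lef_pV2 ?posrE ?cmod_gt0 ?onS_neq ?subr_gt0 //; exact: onS_dist.
Qed.

Lemma CT2_ccont p z : contS p -> cmod (z - z0) < s -> ccont (CT2 p) z.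
Proof.
move=> cp zs; have [M M0 MP] := contS_bounded (contS_div zs cp).
have cT := CT_ccont (contS_div zs (contS_div zs cp)) zs.
have /ccontCP/(_ 1 ltr01)[d1 d10 d1P] := cT.
pose del := s - cmod (z - z0); have del0 : 0 < del by rewrite subr_gt0.
pose K := 8 * s * (M / (del / 2) / (del / 2)) +
  (cmod (CT (fun u => p u / (u - z) / (u - z)) z) + 1).
have del2 : 0 < del / 2 by rewrite divr_gt0.
have K0 : 0 < K.
  rewrite /K ltr_wpDl ?ltr_wpDl ?cmod_ge0 //.
  by apply: mulr_ge0; [rewrite mulr_ge0 // ltW|rewrite !divr_ge0 // ltW].
apply/ccontCP => e e0; exists (Num.min d1 (Num.min (del / 2) (e / K))).
  by rewrite !lt_min d10 !divr_gt0.
move=> w; rewrite !lt_min => /andP[/d1P w0 /andP[w1 w2]].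
have wd : del / 2 <= s - cmod (w - z0).
  by have := cmod_tri w z z0; move: w1; rewrite /del; lra.
have ws : cmod (w - z0) < s.
  by move: wd del2; lra.
rewrite CT2_sub // cmodM.
apply: (@le_lt_trans _ _ (cmod (w - z) * K)); last by rewrite -ltr_pdivlMr.
rewrite ler_wpM2l ?cmod_ge0 //; apply: (le_trans (cmodD _ _)).
apply: lerD; last first.
  rewrite -lerBlDl; apply: (le_trans (cmod_sub_le _ _)); exact: ltW.
apply: (le_trans (CT2_bound (contS_div zs cp) ws M0 MP)).
have H : (s - cmod (w - z0))^-1 <= (del / 2)^-1.
  by rewrite lef_pV2 // posrE ?divr_gt0 ?subr_gt0.
have H0 : 0 <= (s - cmod (w - z0))^-1 by rewrite invr_ge0 subr_ge0 ltW.
rewrite ler_pM2l ?mulr_gt0 //; apply: ler_pM => //; first exact: mulr_ge0.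
by rewrite ler_wpM2l.
Qed.

Lemma CT2_cder p z : contS p -> cmod (z - z0) < s -> cder (CT2 p) z.
Proof.
move=> cp zs; pose q w := CT2 (fun u => p u / (u - z)) w +
  CT (fun u => p u / (u - z) / (u - z)) w.
exists (q z); apply: cdiff_near; last first.
  by apply: filterS (near_disc zs) => w ws; rewrite -CT2_sub // addrC subrK.
apply: ccontD; first by apply: CT2_ccont => //; exact: contS_div.
by apply: CT_ccont => //; do 2 apply: contS_div => //.
Qed.

End CauchyFormula.

(** * Local theory of holomorphic functions *)

Section Holomorphic.
Variable R : realType.
Notation C := R[i].
Implicit Types (z w u : C) (f g h q : C -> C) (r s M : R).

Definition holD f z0 r := forall w, cmod (w - z0) < r -> cder f w.

Lemma holD_le f z0 r s : s <= r -> holD f z0 r -> holD f z0 s.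
Proof. by move=> sr hf w ws; apply: hf; exact: lt_le_trans sr. Qed.

Lemma holD_sub f z0 r w : cmod (w - z0) < r -> holD f z0 r ->
  holD f w (r - cmod (w - z0)).
Proof.
by move=> wr hf v vw; apply: hf; have := cmod_tri v w z0; move: vw; lra.
Qed.

Lemma div3_gt0 r : 0 < r -> 0 < r / 3.
Proof. by move=> r0; rewrite divr_gt0. Qed.

(** The square of half-side [r / 3] lies inside the disc of radius [r] and contains the disc of
    radius [r / 3], whence the thirds in the radii below. *)
Lemma square_disc z0 r w : 0 < r -> square z0 (r / 3) w -> cmod (w - z0) < r.
Proof. by move=> r0 /square_le wr; move: wr; lra. Qed.

Lemma contS_holD f z0 r : 0 < r -> holD f z0 r -> contS z0 (r / 3) f.
Proof.
move=> r0 hf u /onS_square/(square_disc r0) ur; apply: cder_ccont; exact: hf.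
Qed.

Lemma cauchy_disc f z0 r z : 0 < r -> holD f z0 r -> cmod (z - z0) < r / 3 ->
  f z = (Wind z0 (r / 3))^-1 * CT z0 (r / 3) f z.
Proof.
move=> r0 hf zr; apply: cauchy_formula => //; first exact: div3_gt0.
by move=> w /(square_disc r0); exact: hf.
Qed.

Lemma near_neqC z0 z : z != z0 -> \forall w \near z, w != z0.
Proof.
move=> zz; apply/nbhsCP; exists (cmod (z - z0)); first by rewrite cmod_gt0 subr_eq0.
by move=> v vw; apply/eqP => vz; move: vw; rewrite vz cmodB ltxx.
Qed.

Lemma cder_der f z0 r : 0 < r -> holD f z0 r -> cder (der f) z0.
Proof.
move=> r0 hf; have s0 := div3_gt0 r0; set s := r / 3 in s0 *.
have z0s : cmod (z0 - z0) < s by rewrite subrr cmod0.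
have cf := contS_holD r0 hf.
apply: (@eq_near_cder _ (fun w => (Wind z0 s)^-1 * CT2 z0 s f w)); last first.
  by apply: cderM; [exact: cder_cst|exact: CT2_cder].
apply: filterS (near_disc z0s) => z zs; apply/esym/derE.
apply: (@eq_near_cdiff _ (fun w => (Wind z0 s)^-1 * CT z0 s f w)).
  by apply: filterS (near_disc zs) => w ws; rewrite -cauchy_disc.
apply: cdiff_eq; first exact: (cdiffM (cdiff_cst _ _) (CT_cdiff s0 cf zs)).
by rewrite mul0r add0r.
Qed.

Lemma holD_der f z0 r : holD f z0 r -> holD (der f) z0 r.
Proof.
move=> hf w wr; apply: (@cder_der _ _ (r - cmod (w - z0))).
  by rewrite subr_gt0.
exact: holD_sub.
Qed.

(** Near [z0] the quotient coincides with [q1], a multiple of the Cauchy transform of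
    [f u / (u - z0)], which is holomorphic at [z0] too. *)
Lemma holD_quot f z0 r : 0 < r -> holD f z0 r ->
  exists2 q, holD q z0 r & forall w, f w = f z0 + (w - z0) * q w.
Proof.
move=> r0 hf; have s0 := div3_gt0 r0; set s := r / 3 in s0 *.
have z0s : cmod (z0 - z0) < s by rewrite subrr cmod0.
have cf := contS_holD r0 hf.
pose q1 w := (Wind z0 s)^-1 * CT z0 s (fun u => f u / (u - z0)) w.
pose q w := if w == z0 then q1 z0 else (f w - f z0) / (w - z0).
exists q; last first.
  move=> w; rewrite /q; have [->|wz] := eqVneq w z0.
    by rewrite subrr mul0r addr0.
  by rewrite mulrC divfK ?subr_eq0 // addrC subrK.
move=> w wr; have [->|wz] := eqVneq w z0.
  apply: (@eq_near_cder _ q1).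
    apply: filterS (near_disc z0s) => z zs; rewrite /q.
    have [->//|zz] := eqVneq z z0.
    rewrite (cauchy_disc r0 hf zs) (cauchy_disc r0 hf z0s) -mulrBr.
    by rewrite CT_sub // mulrCA [X in X / _]mulrC mulfK // subr_eq0.
  apply: cderM; first exact: cder_cst.
  eexists; apply: (CT_cdiff s0) => //; exact: contS_div.
apply: (@eq_near_cder _ (fun w => (f w - f z0) / (w - z0))).
  by apply: filterS (near_neqC wz) => z zz; rewrite /q (negbTE zz).
apply: cder_div; first by rewrite subr_eq0.
  by apply: cderB; [exact: hf|exact: cder_cst].
by apply: cderB; [exact: cder_id|exact: cder_cst].
Qed.

Lemma Wind_inv_le z0 s : 0 < s -> cmod (Wind z0 s)^-1 <= 1 / 4.
Proof.
move=> s0; have W4 := Wind_ge z0 s0.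
have W0 : 0 < cmod (Wind z0 s) by lra.
by rewrite cmodV mul1r lef_pV2 // posrE.
Qed.

(** The contour keeps at distance at least [r / 3] from [z0], so a bound on the outer annulus
    controls the function inside. In this way a degeneration of the bounds at the centre is
    bypassed. *)
Lemma cauchy_bound f z0 r z M : 0 < r -> holD f z0 r ->
  (forall u, r / 3 <= cmod (u - z0) -> cmod (u - z0) < r -> cmod (f u) <= M) ->
  cmod (z - z0) < r / 3 ->
  cmod (f z) <= 2 * (r / 3) * (M / (r / 3 - cmod (z - z0))).
Proof.
move=> r0 hf fM zs; have s0 := div3_gt0 r0.
rewrite (cauchy_disc r0 hf zs) cmodM.
have := CT_bound s0 (contS_holD r0 hf) zs (M := M) => H.
have {}H : cmod (CT z0 (r / 3) f z) <=
    8 * (r / 3) * (M / (r / 3 - cmod (z - z0))).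
  apply: H => u uS; apply: fM; first exact: onS_ge.
  by apply: square_disc => //; exact: onS_square.
apply: (@le_trans _ _ (1 / 4 * (8 * (r / 3) * (M / (r / 3 - cmod (z - z0)))))).
  by apply: ler_pM; rewrite ?cmod_ge0 //; exact: Wind_inv_le.
set K := M / _; lra.
Qed.

(** Equicontinuity of bounded families. The constant collects [1 / 4] for the inverse of [Wind],
    [8 * (r / 3)] for the contour, and two factors [r / 6] for its distances from [z] and [w]. *)
Lemma cauchy_lip f z0 r z w M : 0 < r -> holD f z0 r ->
  (forall u, r / 3 <= cmod (u - z0) -> cmod (u - z0) < r -> cmod (f u) <= M) ->
  cmod (z - z0) <= r / 6 -> cmod (w - z0) <= r / 6 ->
  cmod (f w - f z) <= 24 * M / r * cmod (w - z).
Proof.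
move=> r0 hf fM zs' ws'; have s0 := div3_gt0 r0.
have zs : cmod (z - z0) < r / 3 by lra.
have ws : cmod (w - z0) < r / 3 by lra.
have cf := contS_holD r0 hf.
have M0 : 0 <= M.
  have E : z0 + (r / 2)%:C - z0 = (r / 2)%:C by ring.
  have r2 : 0 <= r / 2 by lra.
  apply: (le_trans (cmod_ge0 (f (z0 + (r / 2)%:C)))); apply: fM;
    by rewrite E cmodR ger0_norm //; lra.
rewrite (cauchy_disc r0 hf zs) (cauchy_disc r0 hf ws) -mulrBr CT_sub // !cmodM.
have := CT_bound s0 (contS_div s0 zs cf) ws (M := M / (r / 6)) => H.
have {}H : cmod (CT z0 (r / 3) (fun u => f u / (u - z)) w) <=
    8 * (r / 3) * (M / (r / 6) / (r / 6)).
  apply: le_trans (H _) _.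
    move=> u uS; rewrite cmodM cmodV; apply: ler_pM; rewrite ?cmod_ge0 ?invr_ge0 ?cmod_ge0 //.
      apply: fM; first exact: onS_ge.
      by apply: square_disc => //; exact: onS_square.
    have uz := onS_dist s0 z uS.
    by rewrite lef_pV2 ?posrE //; lra.
  rewrite ler_pM2l; last by rewrite mulr_gt0.
  apply: ler_wpM2l; first by rewrite divr_ge0 //; lra.
  by rewrite lef_pV2 ?posrE //; lra.
have -> : 24 * M / r * cmod (w - z) =
  1 / 4 * (cmod (w - z) * (8 * (r / 3) * (M / (r / 6) / (r / 6)))).
  by field; rewrite gt_eqF.
apply: ler_pM; rewrite ?mulr_ge0 ?cmod_ge0 //; first exact: Wind_inv_le.
by rewrite ler_wpM2l ?cmod_ge0.
Qed.

Lemma geometric_small (x e : R) : 0 <= x < 1 -> 0 < e -> exists n, x ^+ n < e.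
Proof.
move=> /andP[x0 x1] e0.
have /cvgrPdist_lt/(_ _ e0) : x ^+ n @[n --> \oo] --> (0 : R).
  by apply: cvg_expr; rewrite ger0_norm.
case=> N _ /(_ N (leqnn N)); rewrite sub0r normrN => xe.
by exists N; exact: le_lt_trans (ler_norm _) xe.
Qed.

(** If factors [w - z0] can be split off indefinitely, Cauchy's bound for the [m]-th cofactor gives
    |f w| <= K (|w - z0| / (r / 3))^m for every [m], hence [f w = 0]. The ratio is below 1 in the
    disc of radius [r / 3], which is why the first alternative is stated there. *)
Lemma zero_factor f z0 r : 0 < r -> holD f z0 r ->
  (forall w, cmod (w - z0) < r / 3 -> f w = 0) \/
  exists m h, [/\ holD h z0 r, h z0 != 0 & forall w, f w = (w - z0) ^+ m * h w].
Proof.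
move=> r0 hf; have s0 := div3_gt0 r0.
have [E|nE] := pselect (exists m h, [/\ holD h z0 r, h z0 != 0 &
    forall w, f w = (w - z0) ^+ m * h w]); first by right.
left; have fac m : exists2 h, holD h z0 r & forall w, f w = (w - z0) ^+ m * h w.
  elim: m => [|m [h hh fE]]; first by exists f => // w; rewrite mul1r.
  have [h0|h0] := eqVneq (h z0) 0; last by exfalso; apply: nE; exists m, h.
  have [q hq qE] := holD_quot r0 hh.
  by exists q => // w; rewrite fE qE h0 add0r exprSr mulrA.
have [M M0 MP] := contS_bounded s0 (contS_holD r0 hf).
move=> w ws; apply/eqP; rewrite -cmod_eq0 eq_le cmod_ge0 andbT.
set del := r / 3 - cmod (w - z0); have del0 : 0 < del by rewrite subr_gt0.
pose K := 2 * (r / 3) * (M / del).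
have K0 : 0 <= K by rewrite mulr_ge0 ?divr_ge0 // ?ltW // mulr_gt0.
have B m : cmod (f w) <= K * (cmod (w - z0) / (r / 3)) ^+ m.
  have [h hh fE] := fac m; rewrite fE cmodM cmodX.
  have hM u : onS z0 (r / 3) u -> cmod (h u) <= M / (r / 3) ^+ m.
    move=> uS; have su := onS_ge s0 uS.
    rewrite ler_pdivlMr ?exprn_gt0 //; apply: le_trans (MP u uS).
    rewrite (fE u) cmodM cmodX mulrC ler_wpM2r ?cmod_ge0 //.
    by apply: lerXn2r => //; rewrite nnegrE ?cmod_ge0 // ltW.
  have H := CT_bound s0 (contS_holD r0 hh) ws hM.
  have {}H : cmod (h w) <= K / (r / 3) ^+ m.
    rewrite (cauchy_disc r0 hh ws) cmodM.
    apply: (@le_trans _ _ (1 / 4 * (8 * (r / 3) * (M / (r / 3) ^+ m / del)))).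
      by apply: ler_pM; rewrite ?cmod_ge0 //; exact: Wind_inv_le.
    rewrite le_eqVlt /K; apply/orP; left; apply/eqP; field.
    by rewrite expf_neq0 ?gt_eqF.
  rewrite expr_div_n mulrCA ler_wpM2l ?exprn_ge0 ?cmod_ge0 //.
apply/ler_addgt0Pr => e e0; rewrite add0r.
have [|n nP] := @geometric_small (cmod (w - z0) / (r / 3)) (e / (K + 1)) _
    (divr_gt0 e0 (ltr_wpDl K0 ltr01)).
  by rewrite divr_ge0 ?cmod_ge0 ?ltW //= ltr_pdivrMr // mul1r.
apply: (le_trans (B n)); apply: (@le_trans _ _ (K * (e / (K + 1)))).
  by rewrite ler_wpM2l // ltW.
rewrite mulrA ler_pdivrMr ?ltr_wpDl // mulrC ler_pM2l //.
by rewrite lerDl.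
Qed.

Lemma ccont_eq_punctured f g z0 r : 0 < r -> ccont f z0 -> ccont g z0 ->
  (forall w, w != z0 -> cmod (w - z0) < r -> f w = g w) -> f z0 = g z0.
Proof.
move=> r0 /ccontCP cf /ccontCP cg fg; apply/eqP/negPn/negP => fg0.
have e0 : 0 < cmod (f z0 - g z0) / 2 by rewrite divr_gt0 ?cmod_gt0 ?subr_eq0.
have [d1 d10 d1P] := cf _ e0; have [d2 d20 d2P] := cg _ e0.
pose x := Num.min r (Num.min d1 d2) / 2.
have x0 : 0 < x by rewrite divr_gt0 // !lt_min r0 d10.
have : x < Num.min r (Num.min d1 d2).
  by rewrite /x ltr_pdivrMr // mulrDr mulr1 ltrDr !lt_min r0 d10.
have xE : cmod (z0 + x%:C - z0) = x by rewrite addrC addKr cmodR gtr0_norm.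
rewrite !lt_min -xE => /andP[h1 /andP[/d1P h2 /d2P h3]].
have xz : z0 + x%:C != z0.
  by rewrite -subr_eq0 -cmod_gt0 xE.
move: h3; rewrite -(fg _ xz h1) => h3.
have := cmod_tri (f z0) (f (z0 + x%:C)) (g z0).
by rewrite [cmod (f z0 - f _)]cmodB; move: h2 h3; lra.
Qed.

(** Multiplication by [w - z0] creates differentiability: by continuity of [f] the product has
    derivative [f z0] at [z0]. Splitting the factor off again returns a holomorphic function. *)
Lemma removable f z0 r : 0 < r -> ccont f z0 ->
  (forall w, w != z0 -> cmod (w - z0) < r -> cder f w) -> holD f z0 r.
Proof.
move=> r0 cf df.
pose k w := (w - z0) * f w.
have hk : holD k z0 r.
  move=> w wr; have [->|wz] := eqVneq w z0.
    exists (f z0); exists f => //; split=> // v.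
    by rewrite /k subrr mul0r add0r.
  apply: cderM; last exact: df.
  by apply: cderB; [exact: cder_id|exact: cder_cst].
have [q hq qE] := holD_quot r0 hk.
have fq w : w != z0 -> f w = q w.
  move=> wz; have := qE w; rewrite /k subrr mul0r add0r.
  by apply: mulfI; rewrite subr_eq0.
have fE : f = q.
  apply/funext => w; have [->|/fq//] := eqVneq w z0.
  apply: (ccont_eq_punctured r0 cf) => [|w' + _]; last exact: fq.
  by apply: cder_ccont; apply: hq; rewrite subrr cmod0.
by rewrite fE.
Qed.

(** Cauchy's formula passes to the limit, and Cauchy transforms are holomorphic. The filter is
    arbitrary because the limit will be taken along an ultrafilter. *)
Lemma hol_uniform_limit (I : Type) (F : set_system I) (FF : ProperFilter F)
  (fs : I -> C -> C) f z0 r : 0 < r ->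
  (\forall i \near F, holD (fs i) z0 r) ->
  (forall e, 0 < e -> \forall i \near F,
     forall w, cmod (w - z0) < r -> cmod (fs i w - f w) < e) ->
  holD f z0 (r / 3).
Proof.
move=> r0 hfs cvf; have s0 := div3_gt0 r0.
have cf w : cmod (w - z0) < r -> ccont f w.
  move=> wr; apply/ccontP => e e0.
  have e3 : 0 < e / 3 by rewrite divr_gt0.
  have [i [hi fi]] := filter_ex (filterI hfs (cvf _ e3)).
  have /ccontP/(_ _ e3) := cder_ccont (hi w wr).
  move: (near_disc wr); apply: filterS2 => v vr fv.
  have h1 := fi v vr; have h2 := fi w wr.
  have := cmod_tri (f v) (fs i v) (f w); have := cmod_tri (fs i v) (fs i w) (f w).
  by rewrite [cmod (f v - fs _ _)]cmodB; lra.
have cS : contS z0 (r / 3) f.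
  by move=> u /onS_square/(square_disc r0); exact: cf.
have rep w : cmod (w - z0) < r / 3 ->
    f w = (Wind z0 (r / 3))^-1 * CT z0 (r / 3) f w.
  move=> ws; apply/eqP; rewrite -subr_eq0 -cmod_eq0 eq_le cmod_ge0 andbT.
  apply/ler_addgt0Pr => e e0; rewrite add0r.
  set del := r / 3 - cmod (w - z0); have del0 : 0 < del by rewrite subr_gt0.
  pose K := 2 * (r / 3) / del.
  have K0 : 0 < K by rewrite divr_gt0 // mulr_gt0.
  have K1 : 0 < K + 1 by rewrite ltr_wpDl // ltW.
  have eK : 0 < e / (K + 1) by rewrite divr_gt0.
  have [i [hi fi]] := filter_ex (filterI hfs (cvf _ eK)).
  have wr : cmod (w - z0) < r by lra.
  have ci := contS_holD r0 hi.
  have H : cmod (CT z0 (r / 3) (fs i) w - CT z0 (r / 3) f w) <=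
      8 * (r / 3) * (e / (K + 1) / del).
    rewrite /CT -(bintB s0 (contS_div s0 ws ci) (contS_div s0 ws cS)).
    rewrite (@eq_bint _ _ _ s0 _ (fun u => (fs i u - f u) / (u - w))); last first.
      by move=> u _; rewrite mulrBl.
    apply: (@CT_bound _ _ _ s0 (fun u => fs i u - f u)) => //.
      by move=> u uS; apply: ccontB; [exact: ci|exact: cS].
    by move=> u /onS_square/(square_disc r0)/fi/ltW.
  have -> : f w - (Wind z0 (r / 3))^-1 * CT z0 (r / 3) f w =
    (f w - fs i w) + (Wind z0 (r / 3))^-1 *
      (CT z0 (r / 3) (fs i) w - CT z0 (r / 3) f w).
    by rewrite (cauchy_disc r0 hi ws); ring.
  apply: (le_trans (cmodD _ _)); rewrite cmodM cmodB.
  apply: (@le_trans _ _ (e / (K + 1) +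
    1 / 4 * (8 * (r / 3) * (e / (K + 1) / del)))).
    apply: lerD; first exact: ltW (fi w wr).
    by apply: ler_pM; rewrite ?cmod_ge0 //; exact: Wind_inv_le.
  have gen (E : R) : E + 1 / 4 * (8 * (r / 3) * (E / del)) = E * (K + 1).
    by rewrite /K; field; rewrite gt_eqF.
  by rewrite gen divfK // gt_eqF.
move=> w ws; apply: (@eq_near_cder _ (fun w => (Wind z0 (r / 3))^-1 * CT z0 (r / 3) f w)).
  by apply: filterS (near_disc ws) => v vs; rewrite -rep.
apply: cderM; first exact: cder_cst.
by eexists; exact: CT_cdiff.
Qed.

End Holomorphic.

(** * Laplacians of functions of [ln |h|^2] *)

Section Laplacian.
Variable R : realType.
Notation C := R[i].
Implicit Types (z w e : C) (h : C -> C) (x t : R) (P Q : C -> R).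

Section RealDerivative.
Implicit Types f g : R -> R.

Lemma rdD f g x (a b : R) : is_derive x 1 f a -> is_derive x 1 g b ->
  is_derive x 1 (fun t => f t + g t) (a + b).
Proof. exact: is_deriveD. Qed.
Lemma rdM f g x (a b : R) : is_derive x 1 f a -> is_derive x 1 g b ->
  is_derive x 1 (fun t => f t * g t) (a * g x + f x * b).
Proof.
move=> df dg; have := is_deriveM df dg.
by rewrite /GRing.scale /= addrC [g x * a]mulrC.
Qed.
Lemma rdZ k f x (a : R) : is_derive x 1 f a ->
  is_derive x 1 (fun t => k * f t) (k * a).
Proof. exact: is_deriveZ. Qed.
Lemma rd_comp f g x (a b : R) : is_derive (g x) 1 f a -> is_derive x 1 g b ->
  is_derive x 1 (fun t => f (g t)) (a * b).
Proof. exact: is_derive1_comp. Qed.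
Lemma rdV f x (a : R) : f x != 0 -> is_derive x 1 f a ->
  is_derive x 1 (fun t => (f t)^-1) (- a / f x ^+ 2).
Proof.
move=> fx [df <-]; split; first exact: derivableV.
by rewrite deriveV // /GRing.scale /= mulNr mulrC -mulNr.
Qed.
Lemma rd_ln f x (a : R) : 0 < f x -> is_derive x 1 f a ->
  is_derive x 1 (fun t => ln (f t)) (a / f x).
Proof. by move=> fx df; rewrite mulrC; apply: rd_comp df; exact: is_derive1_ln. Qed.

(** The first derivative vanishes at the maximum; a positive second derivative would make it
    positive just to the right of 0, and the mean value theorem would produce a larger value. *)
Lemma second_derivative_at_max f (df : R -> R) (d A : R) : 0 < d ->
  (forall t, `|t| < d -> is_derive t 1 f (df t)) -> is_derive (0 : R) 1 df A ->
  (forall t, `|t| < d -> f t <= f 0) -> A <= 0.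
Proof.
move=> d0 dfP ddf fmax; rewrite leNgt; apply/negP => A0.
have df0 : df 0 = 0.
  have H : is_derive (0 : R) 1 f 0.
    apply: (@derive1_at_max R f (- d) d 0) => //.
    - by rewrite ltW // gtrN.
    - move=> t; rewrite in_itv /= => tI; case: (dfP t) => //.
      by rewrite ltr_norml.
    - by rewrite in_itv /= d0 oppr_lt0 d0.
    - by move=> t; rewrite in_itv /= => tI; apply: fmax; rewrite ltr_norml.
  have H' : is_derive (0 : R) 1 f (df 0) by apply: dfP; rewrite normr0.
  by rewrite -(@derive_val _ _ _ _ _ _ _ H') (@derive_val _ _ _ _ _ _ _ H).
move: ddf => /is_derive1_caratheodory[g [gE /cvgrPdist_lt cg g0]].
have /cg : 0 < A by [].
rewrite near_simpl => -[e /= e0 eP].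
pose m := Num.min d e / 2.
have m0 : 0 < m by rewrite divr_gt0 // lt_min d0.
have : m < Num.min d e by rewrite ltr_pdivrMr // mulrDr mulr1 ltrDr lt_min d0.
rewrite lt_min => /andP[md me].
have dI t : 0 <= t <= m -> is_derive t 1 f (df t).
  by move=> /andP[t0 tm]; apply: dfP; rewrite ger0_norm // (le_lt_trans tm).
have [|||t] := @MVT R f df 0 m.
- exact: m0.
- by move=> t; rewrite in_itv /= => /andP[t0 tm]; apply: dI; rewrite !ltW.
- apply: derivable_within_continuous => t; rewrite in_itv /= => tI.
  by case: (dI t tI).
rewrite in_itv /= => /andP[t0 tm] E.
have gt0 : 0 < g t.
  have : `|A - g t| < A.
    rewrite -[X in `|X - _|]g0; apply: eP.
    by rewrite /= sub0r normrN gtr0_norm // (lt_trans tm).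
  by rewrite ltr_norml => /andP[_]; lra.
have := gE t; rewrite df0 !subr0 => dft.
have := fmax m; rewrite gtr0_norm // => /(_ md); rewrite leNgt => /negP; apply.
by rewrite -subr_gt0 E subr0 dft; apply: mulr_gt0 => //; apply: mulr_gt0.
Qed.

End RealDerivative.

(** The sum of the second derivatives along [1] and ['i], which are required at [z] only. As a
    relation, it carries the existence of these derivatives along with the value. *)
Definition lap P z (A : R) := exists d (d1 d2 : R -> R) (A1 A2 : R),
  [/\ 0 < d,
    forall t, `|t| < d -> is_derive t 1 (fun t => P (z + t%:C * 1)) (d1 t) /\
                          is_derive t 1 (fun t => P (z + t%:C * 'i)) (d2 t),
    is_derive (0 : R) 1 d1 A1, is_derive (0 : R) 1 d2 A2 & A = A1 + A2].

Lemma lapD P Q z A B : lap P z A -> lap Q z B ->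
  lap (fun w => P w + Q w) z (A + B).
Proof.
move=> [d [d1 [d2 [A1 [A2 [d0 dP a1 a2 ->]]]]]].
move=> [d' [d1' [d2' [B1 [B2 [d0' dP' b1 b2 ->]]]]]].
exists (Num.min d d'), (fun t => d1 t + d1' t), (fun t => d2 t + d2' t).
exists (A1 + B1), (A2 + B2); split.
- by rewrite lt_min d0.
- move=> t; rewrite lt_min => /andP[/dP[h1 h2] /dP'[h3 h4]].
  by split; exact: rdD.
- exact: rdD.
- exact: rdD.
- ring.
Qed.

Lemma lap_max P z A : lap P z A -> (\forall w \near z, P w <= P z) -> A <= 0.
Proof.
move=> [d [d1 [d2 [A1 [A2 [d0 dP a1 a2 ->]]]]]] /nbhsCP[e e0 eP].
have m0 : 0 < Num.min d e by rewrite lt_min d0.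
have H1 : A1 <= 0.
  apply: (@second_derivative_at_max (fun t => P (z + t%:C * 1)) d1 _ _ m0 _ a1).
    by move=> t; rewrite lt_min => /andP[/dP[]].
  move=> t; rewrite lt_min => /andP[_ te]; rewrite mul0r addr0; apply: eP.
  by rewrite addrC addKr mulr1 cmodR.
have H2 : A2 <= 0.
  apply: (@second_derivative_at_max (fun t => P (z + t%:C * 'i)) d2 _ _ m0 _ a2).
    by move=> t; rewrite lt_min => /andP[/dP[]].
  move=> t; rewrite lt_min => /andP[_ te]; rewrite mul0r addr0; apply: eP.
  by rewrite addrC addKr cmodM cmod_i mulr1 cmodR.
by lra.
Qed.

Lemma crd_ln_sqr_cmod (c : R -> C) t (v : C) : c t != 0 -> crd c t v ->
  is_derive t 1 (fun s => ln (cmod (c s) ^+ 2)) (2 * complex.Re (v / c t)).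
Proof.
move=> c0 [d1 d2]; have m0 : 0 < cmod (c t) ^+ 2 by rewrite exprn_gt0 // cmod_gt0.
have -> : 2 * complex.Re (v / c t) = (complex.Re v * complex.Re (c t) +
   complex.Re (c t) * complex.Re v + (complex.Im v * complex.Im (c t) +
   complex.Im (c t) * complex.Im v)) / cmod (c t) ^+ 2.
  by rewrite cReM cReV cImV; field; rewrite -(sqrf_eq0 (cmod _)) gt_eqF.
apply: rd_ln => //.
have -> : (fun s => cmod (c s) ^+ 2) = (fun s => complex.Re (c s) * complex.Re (c s)
    + complex.Im (c s) * complex.Im (c s)).
  by apply/funext => s; rewrite sqr_cmod !expr2.
by apply: rdD; exact: rdM.
Qed.

Section LogPotential.
Variables (a b c k : R).
Let E x := expR (x / 48).
(** At [x = ln |h|^2] the exponential of [pot] is (b + c |h|^(1/24))^a |h|^(2k). The comparison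
    function of the Ahlfors argument is a product of four such expressions. *)
Definition pot x := a * ln (b + c * expR (x / 48)) + k * x.
Let dpot x := a * c / 48 * (E x * (b + c * E x)^-1) + k.

Let dE x : is_derive x 1 E (E x / 48).
Proof.
rewrite /E; apply: (@rd_comp (@expR R) (fun t => t / 48)).
have -> : (fun t : R => t / 48) = (fun t => 48^-1 * t).
  by apply/funext => t; rewrite mulrC.
rewrite -[X in is_derive _ _ _ X]mulr1; exact: (rdZ _ (is_derive_id x 1)).
Qed.

Let dbE x : is_derive x 1 (fun t => b + c * E t) (c * (E x / 48)).
Proof.
rewrite -[X in is_derive _ _ _ X]add0r.
exact: (rdD (is_derive_cst b x 1) (rdZ c (dE x))).
Qed.

Let pot_d1 x : 0 < b + c * E x -> is_derive x 1 pot (dpot x).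
Proof.
move=> h; have -> : dpot x = a * (c * (E x / 48) / (b + c * E x)) + k * 1.
  by rewrite /dpot; field; rewrite gt_eqF.
have dln := @rd_ln (fun t => b + c * E t) x _ h (dbE x).
exact: (rdD (rdZ a dln) (rdZ k (is_derive_id x 1))).
Qed.

Let pot_d2 x : 0 < b + c * E x ->
  is_derive x 1 dpot (a * b * c / 48 ^+ 2 * (E x / (b + c * E x) ^+ 2)).
Proof.
move=> h; have h0 : b + c * E x != 0 by rewrite gt_eqF.
have -> : a * b * c / 48 ^+ 2 * (E x / (b + c * E x) ^+ 2) =
  a * c / 48 * (E x / 48 * (b + c * E x)^-1 +
    E x * (- (c * (E x / 48)) / (b + c * E x) ^+ 2)) + 0 by field.
exact: (rdD (rdZ _ (rdM (dE x) (@rdV (fun t => b + c * E t) x _ h0 (dbE x)))) (is_derive_cst k x 1)).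
Qed.

(** [ln |h|^2] is harmonic with squared gradient 4 |h' / h|^2, so only the second derivative of
    [pot] survives; the linear term [k * x] contributes nothing. *)
Lemma lap_pot h z r : 0 < r -> holD h z r -> h z != 0 ->
  0 < b + c * E (ln (cmod (h z) ^+ 2)) ->
  lap (fun w => pot (ln (cmod (h w) ^+ 2))) z
   (4 * (a * b * c / 48 ^+ 2 * (E (ln (cmod (h z) ^+ 2)) /
     (b + c * E (ln (cmod (h z) ^+ 2))) ^+ 2)) * cmod (der h z / h z) ^+ 2).
Proof.
move=> r0 hh hz hb.
have z_r : cmod (z - z) < r by rewrite subrr cmod0.
pose X w := ln (cmod (h w) ^+ 2).
have cX : {for z, continuous X}.
  apply: (@continuous_comp _ _ _ (fun w => cmod (h w) ^+ 2) (@ln R)).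
    exact: ccont_sqr_cmod (cder_ccont (hh _ z_r)).
  by apply: continuous_ln; rewrite exprn_gt0 // cmod_gt0.
have nb : \forall w \near z, 0 < b + c * E (X w).
  have : {for z, continuous (fun w => b + c * E (X w))}.
    apply: (@continuous_comp _ _ _ X (fun x => b + c * E x)) => //.
    by apply: differentiable_continuous; apply/derivable1_diffP; case: (dbE (X z)).
  by move=> /(@cvgr_gt _ _ _ _ _ _) => /(_ _ hb).
have nh : \forall w \near z, h w != 0.
  have /ccontP/(_ (cmod (h z))) := cder_ccont (hh _ z_r).
  rewrite cmod_gt0 => /(_ hz); apply: filterS => w; apply: contraTneq => ->.
  by rewrite sub0r cmodN ltxx.
have [d d0 dP] : exists2 d, 0 < d & forall w, cmod (w - z) < d ->
    [/\ 0 < b + c * E (X w), h w != 0 & cmod (w - z) < r].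
  by apply/nbhsCP; move: nb nh (near_disc z_r); apply: filterS3 => w.
pose l w := der h w / h w.
have dl : cder l z.
  by apply: cder_div => //; [exact: (holD_der hh)|exact: hh].
pose D e t := dpot (X (z + t%:C * e)) * (2 * complex.Re (e * l (z + t%:C * e))).
have key e : cmod e = 1 ->
    (forall t, `|t| < d -> is_derive t 1 (fun t => pot (X (z + t%:C * e))) (D e t)) /\
    is_derive (0 : R) 1 (D e) (a * b * c / 48 ^+ 2 * (E (X z) / (b + c * E (X z)) ^+ 2) *
      (2 * complex.Re (e * l z)) * (2 * complex.Re (e * l z)) +
      dpot (X z) * (2 * complex.Re (e * (der l z * e)))).
  move=> e1; have inb t : `|t| < d -> cmod (z + t%:C * e - z) < d.
    by move=> td; rewrite addrC addKr cmodM e1 mulr1 cmodR.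
  have dX t : `|t| < d -> is_derive t 1 (fun t => X (z + t%:C * e))
      (2 * complex.Re (e * l (z + t%:C * e))).
    move=> td; have [h1 h2 h3] := dP _ (inb _ td).
    have -> : e * l (z + t%:C * e) = der h (z + t%:C * e) * e / h (z + t%:C * e).
      by rewrite /l mulrCA mulrA.
    apply: (@crd_ln_sqr_cmod (fun t => h (z + t%:C * e))) => //.
    by apply: crd_comp; [exact: crd_line|apply: derP; exact: hh].
  have d00 : `|0 : R| < d by rewrite normr0.
  split=> [t td|].
    have [h1 h2 h3] := dP _ (inb _ td).
    exact: (@rd_comp pot (fun t => X (z + t%:C * e)) t _ _ (pot_d1 h1) (dX _ td)).
  have zE : z + (0 : R)%:C * e = z by rewrite mul0r addr0.
  have [h1 h2 h3] := dP _ (inb _ d00); rewrite -{1 2 3 4 5}zE.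
  have dl' : cdiff l (z + (0 : R)%:C * e) (der l z) by rewrite zE; exact: derP.
  have dl2 := rdZ 2 (crdZ e (crd_comp (crd_line z e 0) dl')).1.
  exact: (rdM (@rd_comp dpot (fun t => X (z + t%:C * e)) 0 _ _ (pot_d2 h1) (dX _ d00)) dl2).
have [k1 k1'] := key 1 (@cmod1 R); have [k2 k2'] := key 'i (@cmod_i R).
exists d, (D 1), (D 'i); do 2 eexists; split; [exact: d0| |exact: k1'|exact: k2'|].
  by move=> t td; split; [exact: k1|exact: k2].
rewrite -/(X z) -/(l z) (sqr_cmod (l z)) !mul1r mulr1.
(* Harmonicity: as the square of ['i] is -1, the terms with [dpot] for the two directions are
   opposite. *)
have -> : 'i * (der l z * 'i) = - der l z.
  by rewrite mulrCA -expr2 sqr_i mulrN1.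
have -> : complex.Re ('i * l z) = - complex.Im (l z).
  by rewrite cReM /= mul0r mul1r sub0r.
by rewrite cReN; ring.
Qed.

End LogPotential.
End Laplacian.

(** * The cone metric and the Ahlfors estimate *)

Section ConeMetric.
Variable R : realType.
Notation C := R[i].
Implicit Types (z w : C) (x y u v : R).

(** The 24th root. In terms of it the densities have integral exponents, and orders of vanishing are
    compared in [nat]. *)
Definition rt x : R := powR x (24^-1).

Lemma rt_ge0 x : 0 <= rt x. Proof. exact: powR_ge0. Qed.
Lemma rt0 : rt 0 = 0.
Proof. by rewrite /rt powR0 // invr_eq0 pnatr_eq0. Qed.
Lemma rtX x : 0 <= x -> rt x ^+ 24 = x.
Proof.
move=> x0; rewrite /rt -powR_mulrn ?powR_ge0 // -powRrM mulVf ?pnatr_eq0 //.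
by rewrite powRr1.
Qed.
Lemma rt_gt0 x : 0 < x -> 0 < rt x. Proof. exact: powR_gt0. Qed.
Lemma rtM x y : 0 <= x -> 0 <= y -> rt (x * y) = rt x * rt y.
Proof. by move=> x0 y0; rewrite /rt powRM. Qed.
Lemma rt_exp x n : 0 <= x -> rt (x ^+ n) = rt x ^+ n.
Proof.
move=> x0; elim: n => [|n IH]; first by rewrite !expr0 /rt powR1.
by rewrite !exprS rtM ?exprn_ge0 // IH.
Qed.
Lemma rt1 : rt 1 = 1. Proof. by rewrite /rt powR1. Qed.
Lemma rtV x : 0 <= x -> rt x^-1 = (rt x)^-1.
Proof.
rewrite le_eqVlt => /predU1P[<-|x0]; first by rewrite invr0 rt0 invr0.
have rx0 : rt x != 0 by rewrite gt_eqF // rt_gt0.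
apply: (mulfI rx0); rewrite -rtM ?invr_ge0 ?(ltW x0) // !mulfV ?rt1 //.
by rewrite gt_eqF.
Qed.
Lemma rt_le x y : 0 <= x -> x <= y -> rt x <= rt y.
Proof.
move=> x0 xy; rewrite /rt; apply: ge0_ler_powR; rewrite ?nnegrE ?invr_ge0 //.
exact: le_trans xy.
Qed.
Lemma rt_lt x y : 0 <= x -> x < y -> rt x < rt y.
Proof.
move=> x0 xy; rewrite /rt; apply: gt0_ltr_powR; rewrite ?nnegrE ?invr_gt0 //.
by rewrite ltW // (le_lt_trans x0).
Qed.
Lemma expR_ln_rt x : 0 < x -> expR (ln (x ^+ 2) / 48) = rt x.
Proof.
move=> x0; rewrite /rt /powR gt_eqF // lnXn // -mulr_natl; congr expR.
by field.
Qed.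
Lemma rt_cont (T : topologicalType) (F : T -> C) (t : T) : ccont F t ->
  {for t, continuous (fun s => rt (cmod (F s)))}.
Proof.
move=> cF; have [F0|F0] := eqVneq (F t) 0; last first.
  apply: (@continuous_comp _ _ _ (fun s => cmod (F s)) rt).
    exact: ccont_cmod.
  apply: differentiable_continuous; apply/derivable1_diffP.
  by have [] := @is_derive1_powR R (24^-1) (cmod (F t)) _; rewrite ?cmod_gt0.
(* The root is not differentiable at 0; taking 24th powers reduces the claim to continuity of
   [F]. *)
apply/cvgrPdist_lt => e e0; rewrite F0 cmod0 rt0.
have /ccontP := cF; have e24 : 0 < e ^+ 24 by rewrite exprn_gt0.
move=> /(_ _ e24); apply: filterS => s.
rewrite F0 subr0 sub0r normrN ger0_norm ?rt_ge0 // => Fe.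
rewrite -(@ltr_pXn2r _ 24) ?nnegrE ?rt_ge0 ?(ltW e0) //.
by rewrite rtX // cmod_ge0.
Qed.

Lemma max_ge_half u v : 0 <= u -> 0 <= v -> 1 <= u ^+ 24 + v ^+ 24 ->
  1 / 2 <= Num.max u v.
Proof.
move=> u0 v0 h; rewrite leNgt; apply/negP; rewrite gt_max => /andP[u2 v2].
have p24 x : 0 <= x -> x < 1 / 2 -> x ^+ 24 < 1 / 2.
  move=> x0 x2; rewrite exprS.
  have x23 : x ^+ 23 <= 1 by rewrite exprn_ile1 //; lra.
  have x230 : 0 <= x ^+ 23 by rewrite exprn_ge0.
  by nra.
have := p24 _ u0 u2; have := p24 _ v0 v2; lra.
Qed.

(** As [u] is at least [1 / 2] and dominates [v], both [1 + u] and [1 + v] are at most [3 * u];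
    [729] is the sixth power of 3. *)
Lemma curvature_aux u v : 0 < v -> v <= u -> 1 / 2 <= u ->
  (1 + u) ^+ 3 * (1 + v) ^+ 3 * (u ^+ 25 * v ^+ 17) <= 729 * u ^+ 48 /\ (1 + u) ^+ 3 * (1 + v) ^+ 3 * (v ^+ 25 * u ^+ 17) <= 729 * u ^+ 48.
Proof.
move=> v0 vu u2; have u0 : 0 < u by lra.
have h1 : (1 + u) ^+ 3 <= (3 * u) ^+ 3 by apply: lerXn2r; rewrite ?nnegrE; lra.
have h2 : (1 + v) ^+ 3 <= (3 * u) ^+ 3 by apply: lerXn2r; rewrite ?nnegrE; lra.
have p1 : 0 <= (1 + u) ^+ 3 by rewrite exprn_ge0 //; lra.
have p2 : 0 <= (1 + v) ^+ 3 by rewrite exprn_ge0 //; lra.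
have -> : 729 * u ^+ 48 = (3 * u) ^+ 3 * (3 * u) ^+ 3 * u ^+ 42.
  by ring.
have hv n : v ^+ n <= u ^+ n by apply: lerXn2r => //; rewrite nnegrE ltW.
have H : (1 + u) ^+ 3 * (1 + v) ^+ 3 <= (3 * u) ^+ 3 * (3 * u) ^+ 3 by exact: ler_pM.
have p3 : 0 <= (1 + u) ^+ 3 * (1 + v) ^+ 3 by exact: mulr_ge0.
have nu n : 0 <= u ^+ n by rewrite exprn_ge0 // ltW.
have nv n : 0 <= v ^+ n by rewrite exprn_ge0 // ltW.
have E : u ^+ 42 = u ^+ 25 * u ^+ 17 by rewrite -exprD.
split; (apply: ler_pM => //; first exact: mulr_ge0); rewrite E; exact: ler_pM.
Qed.

(* For [u = |w|^(1/24)] and [v = |w - 1|^(1/24)], the square of the density of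
   a metric on the sphere with cone exponents 11/24, 15/24, 23/24 at 0, 1, oo.
   Its curvature is at most a negative constant because the exponents add up
   to more than 2; being less than 1/2, 2/3 and 1, they make the pull-back
   vanish at zeros of order 2 and at 1-points of order 3. *)
Definition dens2 u v := (1 + u) * (1 + v) * (u ^- 22 * v ^- 30).

(** Up to the factor [4 / 48 ^+ 2] the parenthesis is the Laplacian of the logarithm of the squared
    density, since |w|^2 = u^48 and |w - 1|^2 = v^48; so this is the curvature bound. The term of
    the smaller of [u] and [v] carries the estimate. *)
Lemma curvature u v : 0 < u -> 0 < v -> 1 / 2 <= Num.max u v ->
  dens2 u v <= 1458 * (u / (1 + u) ^+ 2 / u ^+ 48 + v / (1 + v) ^+ 2 / v ^+ 48).
Proof.
move=> u0 v0 m2.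
have u1 : 0 < 1 + u by lra.
have v1 : 0 < 1 + v by lra.
pose K := (1 + u) ^+ 2 * (1 + v) ^+ 2 * (u ^+ 47 * v ^+ 47).
have K0 : 0 < K by rewrite !mulr_gt0 ?exprn_gt0.
have E (n m : nat) x : x != 0 -> (n <= m)%N -> x ^+ m / x ^+ n = x ^+ (m - n).
  by move=> x0 nm; rewrite expfB_cond // (negbTE x0) add0n.
have un : u != 0 by rewrite gt_eqF.
have vn : v != 0 by rewrite gt_eqF.
rewrite -(ler_pM2r K0).
have -> : dens2 u v * K = (1 + u) ^+ 3 * (1 + v) ^+ 3 * (u ^+ 25 * v ^+ 17).
  have -> : u ^+ 25 = u ^+ 47 / u ^+ 22 by rewrite E.
  have -> : v ^+ 17 = v ^+ 47 / v ^+ 30 by rewrite E.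
  by rewrite /dens2 /K !exprS; ring.
have -> : 1458 * (u / (1 + u) ^+ 2 / u ^+ 48 + v / (1 + v) ^+ 2 / v ^+ 48) * K =
   1458 * (v ^+ 47 * (1 + v) ^+ 2 + u ^+ 47 * (1 + u) ^+ 2).
  rewrite /K [u ^+ 48]exprS [v ^+ 48]exprS.
  have := expf_neq0 47 un; have := expf_neq0 47 vn.
  move: (u ^+ 47) (v ^+ 47) => U V V0 U0.
  by field; rewrite un vn U0 V0 !gt_eqF.
have pp x : 0 < x -> 729 * x ^+ 48 <= 1458 * (x ^+ 47 * (1 + x) ^+ 2).
  move=> x0; rewrite [x ^+ 48]exprSr.
  have := exprn_gt0 47 x0; move: (x ^+ 47) => X X0; rewrite expr2; nra.
have pu := pp _ u0; have pv := pp _ v0.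
have nu : 0 <= u ^+ 47 * (1 + u) ^+ 2 by rewrite mulr_ge0 ?exprn_ge0 // ltW.
have nv : 0 <= v ^+ 47 * (1 + v) ^+ 2 by rewrite mulr_ge0 ?exprn_ge0 // ltW.
have [vu|/ltW uv] := leP v u.
  have [] := curvature_aux v0 vu _; first by rewrite (max_idPl vu) in m2.
  by move=> h _; lra.
have [] := curvature_aux u0 uv _; first by rewrite (max_idPr uv) in m2.
by rewrite [(1 + v) ^+ 3 * _]mulrC => _ h; lra.
Qed.

(* Comparison with the density of the chordal metric, in the coordinate
   [w / (w - 1)]. *)
Lemma chordal_dens u v : 0 < u -> 0 < v -> 1 / 2 <= Num.max u v ->
  1 / (u ^+ 48 + v ^+ 48) ^+ 2 <= 2 ^+ 44 * dens2 u v.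
Proof.
move=> u0 v0 m2.
have un : u != 0 by rewrite gt_eqF.
have vn : v != 0 by rewrite gt_eqF.
have gen x y : 0 < y -> y <= x -> 1 / 2 <= x ->
    x ^+ 22 * y ^+ 30 <= 2 ^+ 44 * (x ^+ 48) ^+ 2 /\ y ^+ 22 * x ^+ 30 <= 2 ^+ 44 * (x ^+ 48) ^+ 2.
  move=> y0 yx x2; have x0 : 0 < x by lra.
  have E : 2 ^+ 44 * (x ^+ 48) ^+ 2 = (2 * x) ^+ 44 * (x ^+ 22 * x ^+ 30).
    by ring.
  have p : 1 <= (2 * x) ^+ 44 by rewrite exprn_ege1 //; lra.
  have hy n : y ^+ n <= x ^+ n by apply: lerXn2r => //; rewrite nnegrE ltW.
  have nn n : 0 <= x ^+ n by rewrite exprn_ge0 // ltW.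
  have nny n : 0 <= y ^+ n by rewrite exprn_ge0 // ltW.
  have q : x ^+ 22 * x ^+ 30 <= 2 ^+ 44 * (x ^+ 48) ^+ 2.
    by rewrite E -[leLHS]mul1r ler_wpM2r // mulr_ge0.
  by split; apply: le_trans q; apply: ler_pM.
have S0 : 0 < u ^+ 48 + v ^+ 48 by rewrite addr_gt0 ?exprn_gt0.
rewrite ler_pdivrMr ?exprn_gt0 // /dens2.
have -> : 2 ^+ 44 * ((1 + u) * (1 + v) * (u ^- 22 * v ^- 30)) * (u ^+ 48 + v ^+ 48) ^+ 2
  = 2 ^+ 44 * ((1 + u) * (1 + v)) * (u ^+ 48 + v ^+ 48) ^+ 2 / (u ^+ 22 * v ^+ 30).
  by field; rewrite un vn.
rewrite ler_pdivlMr ?mulr_gt0 ?exprn_gt0 // mul1r.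
have one : 1 <= (1 + u) * (1 + v) by nra.
have U0 : 0 <= u ^+ 48 by rewrite exprn_ge0 // ltW.
have V0 : 0 <= v ^+ 48 by rewrite exprn_ge0 // ltW.
have fin x : 0 <= x -> x <= u ^+ 48 + v ^+ 48 -> 2 ^+ 44 * x ^+ 2 <=
    2 ^+ 44 * ((1 + u) * (1 + v)) * (u ^+ 48 + v ^+ 48) ^+ 2.
  move=> x0 xs; rewrite -mulrA ler_pM2l ?exprn_gt0 //.
  rewrite -[leLHS]mul1r; apply: ler_pM => //; first exact: sqr_ge0.
  by apply: lerXn2r => //; rewrite nnegrE ltW.
have [vu|/ltW uv] := leP v u.
  have [] := gen _ _ v0 vu _; first by rewrite (max_idPl vu) in m2.
  by move=> h _; apply: (le_trans h); apply: fin => //; rewrite lerDl.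
have [] := gen _ _ u0 uv _; first by rewrite (max_idPr uv) in m2.
by move=> _ h; apply: (le_trans h); apply: fin => //; rewrite lerDr.
Qed.

End ConeMetric.

(** * Compactness of closed discs *)

Section CompactDisc.
Variable R : realType.
Notation C := R[i].

Lemma closed_disc_closed (z0 : C) (r : R) : closed [set w : C | cmod (w - z0) <= r].
Proof.
rewrite -openC openE => w /negP; rewrite -ltNge => wr.
apply/nbhsCP; exists (cmod (w - z0) - r); first by rewrite subr_gt0.
move=> v vw /=; apply/negP; rewrite -ltNge.
by have := cmod_tri w v z0; rewrite [cmod (w - v)]cmodB; lra.
Qed.

Lemma compact_disc (z0 : C) (r : R) : compact [set w : C | cmod (w - z0) <= r].
Proof.
pose mk (p : R * R) : C := p.1 +i* p.2.
have mkc : continuous mk.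
  move=> p A /nbhsCP[d d0 dP].
  have d2 : 0 < d / 2 by rewrite divr_gt0.
  exists ([set x | `|p.1 - x| < d / 2], [set y | `|p.2 - y| < d / 2]).
    by split; apply: nbhsx_ballx.
  move=> [x y] [/= xd yd]; apply: dP.
  apply: (le_lt_trans (cmod_le_ReIm _)); rewrite (splitr d) /=.
  by apply: ltrD; rewrite distrC.
pose a := complex.Re z0; pose b := complex.Im z0.
have cK : compact (mk @` (`[a - r, a + r] `*` `[b - r, b + r])).
  apply: continuous_compact; first exact: continuous_subspaceT.
  by apply: compact_setX; exact: segment_compact.
apply: (subclosed_compact (@closed_disc_closed z0 r) cK).
case=> x y /= wr; exists (x, y) => //=; rewrite !in_itv /=.
have := le_trans (Re_le_cmod _) wr; have := le_trans (Im_le_cmod _) wr.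
rewrite cReD cReN cImD cImN /= !ler_norml -/a -/b => /andP[h1 h2] /andP[h3 h4].
by split; apply/andP; split; lra.
Qed.

Lemma max_on_disc (z0 : C) (r : R) (f : C -> R) : 0 <= r ->
  (forall w, cmod (w - z0) <= r -> {for w, continuous f}) ->
  exists2 c, cmod (c - z0) <= r & forall w, cmod (w - z0) <= r -> f w <= f c.
Proof.
move=> r0 cf.
have [|||c] := @compact_EVT_max C R f [set w : C | cmod (w - z0) <= r].
- by exists z0; rewrite /= subrr cmod0.
- exact: compact_disc.
- by apply: continuous_in_subspaceT => w; rewrite inE; exact: cf.
by rewrite inE => cr cM; exists c => // w wr; apply: cM; rewrite inE.
Qed.

End CompactDisc.

(** * Orders of vanishing of the pulled-back density *)

Section Vanishing.
Variable R : realType.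
Notation C := R[i].
Implicit Types (z w : C) (h W : C -> C) (u v x : R).

Lemma rt_ge_pow (a x : R) : 0 <= a -> a ^+ 24 <= x -> a <= rt x.
Proof.
move=> a0 ax; have := rt_le (exprn_ge0 24 a0) ax; rewrite rt_exp // rtX //.
Qed.
Lemma rt_le_pow (a x : R) : 0 <= a -> 0 <= x -> x <= a ^+ 24 -> rt x <= a.
Proof. by move=> a0 x0 xa; have := rt_le x0 xa; rewrite rt_exp // rtX. Qed.

Lemma near_bound_cont (f : C -> R) z : {for z, continuous f} ->
  \forall w \near z, f w <= f z + 1.
Proof.
move=> /cvgrPdist_lt/(_ 1 ltr01); apply: filterS => w.
by rewrite ltr_norml => /andP[]; lra.
Qed.

(** A count of powers of [n = rt (cmod (w - z1))]: the negative power of [W] contributes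
    [- m.+1 * N], the squared derivative [48 * m], the weight [e]. The hypothesis on exponents
    leaves at least one power of [n]. *)
Lemma vanishing_rate W h z1 r (m N e : nat) : 0 < r -> holD h z1 r -> h z1 != 0 ->
  (forall w, w != z1 -> cmod (w - z1) < r -> W w = (w - z1) ^+ m.+1 * h w) ->
  (m.+1 * N + 1 <= 48 * m + e)%N ->
  exists K d, [/\ 0 <= K, 0 < d & forall w, w != z1 -> cmod (w - z1) < d ->
   rt (cmod (W w)) ^- N * cmod (der W w) ^+ 2 * rt (cmod (w - z1)) ^+ e <=
     K * rt (cmod (w - z1))].
Proof.
move=> r0 hh h0 WE mN.
have z_r : cmod (z1 - z1) < r by rewrite subrr cmod0.
have ch : {for z1, continuous (fun w => cmod (h w))} by exact: ccont_cmod (cder_ccont (hh _ z_r)).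
have cd : {for z1, continuous (fun w => cmod (der h w))}.
  exact: ccont_cmod (cder_ccont (holD_der hh z_r)).
have hp : 0 < cmod (h z1) by rewrite cmod_gt0.
have hlow : \forall w \near z1, cmod (h z1) / 2 < cmod (h w).
  have h2 : 0 < cmod (h z1) / 2 by lra.
  move/cvgrPdist_lt/(_ _ h2): ch; apply: filterS => w.
  by rewrite ltr_norml => /andP[]; lra.
pose M1 := cmod (h z1) + 1; pose M2 := cmod (der h z1) + 1.
have M10 : 0 <= M1 by rewrite addr_ge0 ?cmod_ge0.
have M20 : 0 <= M2 by rewrite addr_ge0 ?cmod_ge0.
have [d d0 dP] : exists2 d, 0 < d & forall w, cmod (w - z1) < d ->
    [/\ cmod (h z1) / 2 < cmod (h w), cmod (h w) <= M1 & cmod (der h w) <= M2].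
  apply/nbhsCP; move: hlow (near_bound_cont ch) (near_bound_cont cd).
  by apply: filterS3 => w.
pose c := rt (cmod (h z1) / 2); have c0 : 0 < c by apply: rt_gt0; lra.
pose B := m.+1%:R * M1 + M2.
have B0 : 0 <= B by rewrite addr_ge0 ?mulr_ge0.
exists (c ^- N * B ^+ 2), (Num.min d (Num.min r 1)); split.
- by rewrite mulr_ge0 ?sqr_ge0 // invr_ge0 exprn_ge0 // ltW.
- by rewrite !lt_min d0 r0 ltr01.
move=> w wz; rewrite !lt_min => /andP[/dP[hl hM dM] /andP[wr w1]].
set y := cmod (w - z1) in wr w1 *.
have y0 : 0 < y by rewrite cmod_gt0 subr_eq0.
set n := rt y; have n0 : 0 < n by exact: rt_gt0.
have n1 : n <= 1 by apply: rt_le_pow; rewrite ?expr1n ?ltW.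
have nE : y = n ^+ 24 by rewrite rtX // ltW.
have dW : cmod (der W w) <= n ^+ (24 * m) * B.
  have -> : der W w = (w - z1) ^+ m * (m.+1%:R * h w + (w - z1) * der h w).
    apply: derE; apply: (@eq_near_cdiff _ (fun w => (w - z1) ^+ m.+1 * h w)).
      move: (near_neqC wz) (near_disc wr).
      by apply: filterS2 => v vz vr; rewrite WE.
    apply: cdiff_eq.
      apply: cdiffM; last by apply: derP; exact: hh.
      apply: cdiffX; exact: cdiffB (cdiff_id _) (cdiff_cst _ _).
    by rewrite /= exprS; ring.
  rewrite cmodM cmodX -/y nE -exprM; apply: ler_wpM2l; first by rewrite exprn_ge0 // ltW.
  apply: (le_trans (cmodD _ _)); rewrite !cmodM -/y; apply: lerD.
    have -> : cmod (m.+1%:R : C) = m.+1%:R.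
      by rewrite -(rmorph_nat (real_complex R)) cmodR ger0_norm.
    by rewrite ler_pM2l.
  by rewrite -[M2]mul1r; apply: ler_pM; rewrite ?cmod_ge0 // ltW.
have rW : n ^+ m.+1 * c <= rt (cmod (W w)).
  rewrite WE // cmodM cmodX rtM ?exprn_ge0 ?cmod_ge0 // rt_exp ?cmod_ge0 //.
  apply: ler_wpM2l; first by rewrite exprn_ge0 // ltW.
  by apply: rt_le; [rewrite divr_ge0 // ltW|exact: ltW].
have nc0 : 0 < n ^+ m.+1 * c by rewrite mulr_gt0 ?exprn_gt0.
have H1 : rt (cmod (W w)) ^- N <= (n ^+ m.+1 * c) ^- N.
  rewrite lef_pV2 ?posrE ?exprn_gt0 //; last exact: lt_le_trans rW.
  by apply: lerXn2r => //; rewrite nnegrE ?rt_ge0 // ltW.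
have H2 : cmod (der W w) ^+ 2 <= (n ^+ (24 * m) * B) ^+ 2.
  apply: lerXn2r; rewrite ?nnegrE ?cmod_ge0 //.
  by rewrite mulr_ge0 // exprn_ge0 // ltW.
apply: (@le_trans _ _ ((n ^+ m.+1 * c) ^- N * (n ^+ (24 * m) * B) ^+ 2 * n ^+ e)).
  rewrite ler_pM2r ?exprn_gt0 //; apply: ler_pM => //.
    by rewrite invr_ge0 exprn_ge0 // rt_ge0.
  by rewrite exprn_ge0 // cmod_ge0.
have -> : (n ^+ m.+1 * c) ^- N * (n ^+ (24 * m) * B) ^+ 2 * n ^+ e =
  c ^- N * B ^+ 2 * (n ^+ (48 * m + e) / n ^+ (m.+1 * N)).
  rewrite !exprMn -!exprM invfM.
  have -> : (48 * m + e = 24 * m * 2 + e)%N.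
    by rewrite mulnAC.
  by rewrite exprD; ring.
rewrite ler_wpM2l //.
  by rewrite mulr_ge0 ?sqr_ge0 // invr_ge0 exprn_ge0 // ltW.
rewrite ler_pdivrMr ?exprn_gt0 // -exprS.
rewrite -(subnK mN) exprD addn1 -[leRHS]mul1r ler_wpM2r ?exprn_ge0 ?(ltW n0) //.
by rewrite exprn_ile1 // ltW.
Qed.

Lemma rt_half x : 1 / 2 <= x -> 1 / 2 <= rt x.
Proof.
move=> x2; apply: rt_ge_pow; first by lra.
apply: le_trans x2; rewrite exprS -[leRHS]mulr1 ler_pM2l; last by lra.
by rewrite exprn_ile1 //; lra.
Qed.
Lemma rt_le2 x : 0 <= x -> x <= 4 -> rt x <= 2.
Proof.
move=> x0 x4; apply: rt_le_pow => //; apply: (le_trans x4).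
have -> : 4 = 2 ^+ 2 :> R by ring.
by rewrite ler_eXn2l // ltrDl.
Qed.
Lemma rt_le1 x : 0 <= x -> x <= 1 -> rt x <= 1.
Proof. by move=> x0 x1; apply: rt_le_pow => //; rewrite expr1n. Qed.

Lemma dens2_ge0 u v : 0 <= u -> 0 <= v -> 0 <= dens2 u v.
Proof.
move=> u0 v0; rewrite /dens2 mulr_ge0 //; first by rewrite mulr_ge0 // addr_ge0.
by rewrite mulr_ge0 // invr_ge0 exprn_ge0.
Qed.

Let nn (n : nat) u : 0 <= u -> 0 <= u ^- n.
Proof. by move=> u0; rewrite invr_ge0 exprn_ge0. Qed.

Let half_inv (n : nat) u : 1 / 2 <= u -> u ^- n <= 2 ^+ n.
Proof.
move=> u2; have u0 : 0 < u by lra.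
rewrite -[2 ^+ n]invrK lef_pV2 ?posrE ?invr_gt0 ?exprn_gt0 //.
by rewrite -exprVn; apply: lerXn2r; rewrite ?nnegrE; lra.
Qed.

(** The constant is crude so that one value serves near 0, 1 and infinity. *)
Lemma dens2_near0 w : cmod w <= 1 / 2 ->
  dens2 (rt (cmod w)) (rt (cmod (w - 1))) <= 2 ^+ 33 * rt (cmod w) ^- 22.
Proof.
move=> w2; have w0 := cmod_ge0 w.
have l1 : 1 / 2 <= cmod (w - 1).
  by have := cmod_sub_le 1 w; rewrite cmodB cmod1; lra.
have l2 : cmod (w - 1) <= 4 by have := cmodBD w 1; rewrite cmod1; lra.
have u1 : rt (cmod w) <= 1 by apply: rt_le1 => //; lra.
have v1 := rt_half l1; have v2 := rt_le2 (cmod_ge0 _) l2.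
have u0 := rt_ge0 (cmod w).
rewrite /dens2; move: (rt (cmod w)) (rt (cmod (w - 1))) u1 v1 v2 u0 => u v u1 v1 v2 u0.
have h1 : (1 + u) * (1 + v) <= 8 by nra.
have h2 := half_inv 30 v1.
have -> : 2 ^+ 33 * u ^- 22 = 8 * (u ^- 22 * 2 ^+ 30).
  by rewrite [u ^- 22 * _]mulrC mulrA; congr (_ * _); rewrite -(natrX _ 2 33); ring.
apply: ler_pM => //.
- by rewrite mulr_ge0 //; lra.
- by rewrite mulr_ge0 ?nn //; lra.
by rewrite ler_wpM2l // nn.
Qed.

Lemma dens2_near1 w : cmod (w - 1) <= 1 / 2 ->
  dens2 (rt (cmod w)) (rt (cmod (w - 1))) <= 2 ^+ 33 * rt (cmod (w - 1)) ^- 30.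
Proof.
move=> w2; have w0 := cmod_ge0 (w - 1).
have l1 : 1 / 2 <= cmod w.
  by have := cmod_tri 1 w 0; rewrite !subr0 cmod1 [cmod (1 - w)]cmodB; lra.
have l2 : cmod w <= 4 by have := cmodD (w - 1) 1; rewrite subrK cmod1; lra.
have v1 : rt (cmod (w - 1)) <= 1 by apply: rt_le1 => //; lra.
have u1 := rt_half l1; have u2 := rt_le2 (cmod_ge0 _) l2.
have v0 := rt_ge0 (cmod (w - 1)).
rewrite /dens2; move: (rt (cmod w)) (rt (cmod (w - 1))) u1 v1 u2 v0 => u v u1 v1 u2 v0.
have h1 : (1 + u) * (1 + v) <= 2 ^+ 11 by rewrite -(natrX _ 2 11); nra.
have h2 := half_inv 22 u1.
have -> : 2 ^+ 33 * v ^- 30 = 2 ^+ 11 * (2 ^+ 22 * v ^- 30).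
  by rewrite mulrA -exprD.
apply: ler_pM => //.
- by rewrite mulr_ge0 //; lra.
- by rewrite mulr_ge0 ?nn //; lra.
by rewrite ler_wpM2r // nn.
Qed.

(** The factors [1 + u] and [1 + v] give back two of the [22 + 30] powers, whence [50]. In the
    coordinate [1 / w] the change of |dw|^2 costs 96 powers and leaves exponent -46, that is the
    cone exponent 23/24. *)
Lemma dens2_nearoo w : 2 <= cmod w ->
  dens2 (rt (cmod w)) (rt (cmod (w - 1))) <= 2 ^+ 33 * rt (cmod w) ^- 50.
Proof.
move=> w2.
have l1 : cmod w / 2 <= cmod (w - 1).
  by have := cmod_sub_le w 1; rewrite cmod1; lra.
have l2 : cmod (w - 1) <= cmod w * 2 by have := cmodBD w 1; rewrite cmod1; lra.
have u1 : 1 <= rt (cmod w).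
  by apply: rt_ge_pow => //; rewrite expr1n; lra.
have w0 := cmod_ge0 w.
have v1 : rt (cmod w) / 2 <= rt (cmod (w - 1)).
  apply: (@le_trans _ _ (rt (cmod w / 2))); last by apply: rt_le => //; lra.
  rewrite rtM ?invr_ge0 // ler_wpM2l ?rt_ge0 //.
  by have := @rt_half (2^-1) _; rewrite mul1r; apply.
have v2 : rt (cmod (w - 1)) <= rt (cmod w) * 2.
  apply: (@le_trans _ _ (rt (cmod w * 2))).
    by apply: rt_le => //; exact: cmod_ge0.
  rewrite rtM // ler_wpM2l ?rt_ge0 //; apply: rt_le2 => //; lra.
rewrite /dens2; move: (rt (cmod w)) (rt (cmod (w - 1))) u1 v1 v2 => u v u1 v1 v2.
have u0 : 0 < u by lra.
have v0 : 0 < v by lra.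
have h1 : (1 + u) * (1 + v) <= 8 * u ^+ 2 by rewrite expr2; nra.
have h2 : v ^- 30 <= 2 ^+ 30 * u ^- 30.
  have -> : 2 ^+ 30 * u ^- 30 = (u / 2) ^- 30.
    by field; rewrite gt_eqF.
  rewrite lef_pV2 ?posrE ?exprn_gt0 //; last lra.
  by apply: lerXn2r; rewrite ?nnegrE; lra.
have -> : 2 ^+ 33 * u ^- 50 = 8 * u ^+ 2 * (u ^- 22 * (2 ^+ 30 * u ^- 30)).
  by field; rewrite gt_eqF.
apply: ler_pM => //.
- by rewrite mulr_ge0 //; lra.
- by rewrite mulr_ge0 ?nn // ltW.
by rewrite ler_wpM2l // nn // ltW.
Qed.

End Vanishing.

(** * The comparison function and its maximum *)

Section Ahlfors.
Variable R : realType.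
Notation C := R[i].
Implicit Types (z w : C) (h W f g : C -> C) (x : R).

Lemma eq_near_der f g z : (\forall w \near z, f w = g w) -> cder f z ->
  der f z = der g z.
Proof. by move=> fg /derP df; apply/esym/derE; exact: eq_near_cdiff df. Qed.

Lemma der_sub1 f z : cder f z -> der (fun w => f w - 1) z = der f z.
Proof.
move=> /derP df; apply: derE; apply: cdiff_eq.
  exact: (cdiffB df (cdiff_cst 1 z)).
by rewrite subr0.
Qed.

Lemma rcontP (T : topologicalType) (f : T -> R) (t : T) :
  (forall e, 0 < e -> \forall s \near t, `|f t - f s| < e) ->
  {for t, continuous f}.
Proof. by move=> H; apply/cvgrPdist_lt. Qed.

Lemma expR_pot (n : nat) (b c k x : R) : 0 < x -> 0 < b + c * rt x ->
  expR (pot n%:R b c k (ln (x ^+ 2))) =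
  (b + c * rt x) ^+ n * expR (k * ln (x ^+ 2)).
Proof.
move=> x0 h; rewrite /pot expRD expR_ln_rt //; congr (_ * _).
by rewrite expRM_natl lnK.
Qed.

Lemma expR_pos (j : nat) x : 0 < x -> expR (j%:R / 48 * ln (x ^+ 2)) = rt x ^+ j.
Proof.
move=> x0; rewrite -mulrA [48^-1 * _]mulrC expRM_natl expR_ln_rt //.
Qed.

Lemma expR_neg (j : nat) x : 0 < x ->
  expR (- (j%:R / 48) * ln (x ^+ 2)) = rt x ^- j.
Proof. by move=> x0; rewrite mulNr expRN expR_pos. Qed.

Section RealContinuity.
Variables (T : topologicalType) (t : T).
Implicit Types a b : T -> R.
Lemma rcont_cD (c : R) a : {for t, continuous a} ->
  {for t, continuous (fun s => c + a s)}.
Proof. by move=> ca; apply: (@cvgD _ _ _ _ _ (fun=> c) a) => //; exact: cvg_cst. Qed.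
Lemma rcont_cB (c : R) a : {for t, continuous a} ->
  {for t, continuous (fun s => c - a s)}.
Proof. by move=> ca; apply: (@cvgB _ _ _ _ _ (fun=> c) a) => //; exact: cvg_cst. Qed.
Lemma rcontM a b : {for t, continuous a} -> {for t, continuous b} ->
  {for t, continuous (fun s => a s * b s)}.
Proof. exact: continuousM. Qed.
Lemma rcontX n a : {for t, continuous a} ->
  {for t, continuous (fun s => a s ^+ n)}.
Proof.
by move=> ca; apply: (@continuous_comp _ _ _ a (fun x => x ^+ n)) => //;
  exact: exprn_continuous.
Qed.
Lemma rcontVX n a : a t != 0 -> {for t, continuous a} ->
  {for t, continuous (fun s => a s ^- n)}.
Proof.
by move=> a0 ca; apply: continuousV; [rewrite expf_neq0|exact: rcontX].
Qed.
Lemma dens2_cont a b : a t != 0 -> b t != 0 -> {for t, continuous a} ->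
  {for t, continuous b} -> {for t, continuous (fun s => dens2 (a s) (b s))}.
Proof.
move=> a0 b0 ca cb; apply: rcontM; first by apply: rcontM; exact: rcont_cD.
by apply: rcontM; exact: rcontVX.
Qed.
End RealContinuity.

Variables (z0 : C) (r r1 : R) (G : C -> C).
Hypotheses (r_gt0 : 0 < r) (r_lt : r < r1).

(* The comparison function of the Ahlfors-Schwarz argument: the pull-back of the
   cone metric by [G], squared and divided by (a multiple of) the square of the
   density [1 / (|w|^(47/48) (r^(1/24) - |w|^(1/24)))] of a metric on the
   disc punctured at [z0 = 0]. *)
Definition Psi w := dens2 (rt (cmod (G w))) (rt (cmod (G w - 1))) *
  cmod (der G w) ^+ 2 *
  (rt (cmod (w - z0)) ^+ 47 * (rt r - rt (cmod (w - z0))) ^+ 2).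

Lemma Psi_ge0 w : 0 <= Psi w.
Proof.
apply: mulr_ge0; last by rewrite mulr_ge0 ?sqr_ge0 // exprn_ge0 // rt_ge0.
by rewrite mulr_ge0 ?sqr_ge0 //; apply: dens2_ge0; exact: rt_ge0.
Qed.

Lemma Psi_center : Psi z0 = 0.
Proof. by rewrite /Psi subrr cmod0 rt0 expr0n /= mul0r mulr0. Qed.

Lemma Psi_G0 w : G w = 0 -> Psi w = 0.
Proof.
by move=> Gw; rewrite /Psi /dens2 Gw cmod0 rt0 expr0n /= invr0 !(mul0r, mulr0).
Qed.

Lemma Psi_G1 w : G w = 1 -> Psi w = 0.
Proof.
by move=> Gw; rewrite /Psi /dens2 Gw subrr cmod0 rt0 expr0n /= invr0 !(mul0r, mulr0).
Qed.

Lemma Psi_cont0 z : Psi z = 0 ->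
  (exists K d, [/\ 0 <= K, 0 < d & forall w, w != z -> cmod (w - z) < d ->
     Psi w <= K * rt (cmod (w - z))]) ->
  {for z, continuous Psi}.
Proof.
move=> Pz [K [d [K0 d0 dP]]]; apply: rcontP => e e0; rewrite Pz.
have cs : ccont (fun w => w - z) z by apply: ccontB; [exact: ccont_id|exact: ccont_cst].
have K1 : 0 < K + 1 by rewrite ltr_wpDl.
have /cvgrPdist_lt/(_ _ (divr_gt0 e0 K1)) n1 := rt_cont cs.
have n2 : \forall w \near z, cmod (w - z) < d by apply/nbhsCP; exists d.
move: n1 n2; apply: filterS2 => w h1 h2.
rewrite sub0r normrN ger0_norm ?Psi_ge0 //.
have [->|wz] := eqVneq w z; first by rewrite Pz.
apply: (le_lt_trans (dP w wz h2)).
move: h1; rewrite subrr cmod0 rt0 sub0r normrN ger0_norm ?rt_ge0 // ltr_pdivlMr //.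
apply: le_lt_trans; rewrite mulrC ler_wpM2l ?rt_ge0 //.
by rewrite lerDl.
Qed.

Let T := rt r1.
Let Bd := (T + T) ^+ 2.
Let T0 : 0 <= T. Proof. exact: rt_ge0. Qed.
Let r_le : rt r <= T. Proof. by apply: rt_le; exact: ltW. Qed.

Let tau_le w : cmod (w - z0) < r1 -> rt (cmod (w - z0)) <= T.
Proof. by move=> wr; apply: rt_le; [exact: cmod_ge0|exact: ltW]. Qed.

Let factor_le w : cmod (w - z0) < r1 ->
  (rt r - rt (cmod (w - z0))) ^+ 2 <= Bd.
Proof.
move=> /tau_le wr; have t0 := rt_ge0 (cmod (w - z0)); have r0 := rt_ge0 r.
have tT := T0; have rT := r_le; rewrite /Bd; move: T wr tT rT => S wr tT rT.
rewrite -[leLHS]real_normK ?num_real //; apply: lerXn2r; rewrite ?nnegrE ?addr_ge0 //.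
by rewrite ler_norml; apply/andP; split; lra.
Qed.

(* [e = 0] away from the center, [e = 47] at the center. *)
Let local_bound W h z d (m N e : nat) : cmod (z - z0) < r1 ->
  (e = 0%N \/ (e = 47%N /\ z = z0)) ->
  0 < d -> holD h z d -> h z != 0 ->
  (forall w, w != z -> cmod (w - z) < d -> W w = (w - z) ^+ m.+1 * h w) ->
  (m.+1 * N + 1 <= 48 * m + e)%N ->
  (exists2 d', 0 < d' & forall w, w != z -> cmod (w - z) < d' ->
    dens2 (rt (cmod (G w))) (rt (cmod (G w - 1))) * cmod (der G w) ^+ 2 <=
    2 ^+ 33 * (rt (cmod (W w)) ^- N * cmod (der W w) ^+ 2)) ->
  exists K d, [/\ 0 <= K, 0 < d & forall w, w != z -> cmod (w - z) < d ->
     Psi w <= K * rt (cmod (w - z))].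
Proof.
move=> zr ee d0 hh h0 WE mN [d' d'0 d'P].
have [K [d1 [K0 d10 d1P]]] := vanishing_rate d0 hh h0 WE mN.
have B0 : 0 <= 2 ^+ 33 * Bd :> R by rewrite mulr_ge0 ?sqr_ge0 // exprn_ge0.
(* Away from the centre the weight is merely bounded; at the centre its 47 powers of the root are
   kept. *)
pose S := if e == 0%N then T ^+ 47 else 1.
have S0 : 0 <= S by rewrite /S; case: ifP => _ //; rewrite exprn_ge0 // T0.
exists (2 ^+ 33 * Bd * (S * K)), (Num.min (r1 - cmod (z - z0)) (Num.min d' d1)); split.
- by rewrite mulr_ge0 // mulr_ge0.
- by rewrite !lt_min subr_gt0 zr d'0 d10.
move=> w wz; rewrite !lt_min => /andP[w1 /andP[w2 w3]].
have wr1 : cmod (w - z0) < r1 by have := cmod_tri w z z0; move: w1; lra.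
have H1 := d'P w wz w2; have H2 := d1P w wz w3; have H3 := factor_le wr1.
have X0 : 0 <= rt (cmod (W w)) ^- N * cmod (der W w) ^+ 2.
  by rewrite mulr_ge0 ?sqr_ge0 // invr_ge0 exprn_ge0 // rt_ge0.
have H4 : rt (cmod (w - z0)) ^+ 47 <= S * rt (cmod (w - z)) ^+ e.
  rewrite /S; case: ee => [->|[-> zz]] /=.
    by rewrite expr0 mulr1; apply: lerXn2r => //; rewrite ?nnegrE ?rt_ge0 // tau_le.
  by rewrite zz mul1r.
rewrite /Psi.
apply: (@le_trans _ _ ((2 ^+ 33 * (rt (cmod (W w)) ^- N * cmod (der W w) ^+ 2)) *
   ((S * rt (cmod (w - z)) ^+ e) * Bd))).
  apply: ler_pM => //.
  - by rewrite mulr_ge0 ?sqr_ge0 //; apply: dens2_ge0; exact: rt_ge0.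
  - by rewrite mulr_ge0 ?sqr_ge0 // exprn_ge0 // rt_ge0.
  by apply: ler_pM; rewrite ?sqr_ge0 ?exprn_ge0 ?rt_ge0.
have -> : (2 ^+ 33 * (rt (cmod (W w)) ^- N * cmod (der W w) ^+ 2)) *
   ((S * rt (cmod (w - z)) ^+ e) * Bd) = (2 ^+ 33 * Bd * S) *
   (rt (cmod (W w)) ^- N * cmod (der W w) ^+ 2 * rt (cmod (w - z)) ^+ e) by ring.
by rewrite [in leRHS]mulrA -[leRHS]mulrA ler_wpM2l // mulr_ge0.
Qed.

Hypothesis G_hol : forall w, w != z0 -> cmod (w - z0) < r1 -> cder G w.
Hypothesis G_zero : forall z, z != z0 -> cmod (z - z0) < r1 -> G z = 0 ->
  (\forall w \near z, G w = 0) \/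
  exists m h d, [/\ (2 <= m)%N, 0 < d, holD h z d, h z != 0 &
    forall w, cmod (w - z) < d -> G w = (w - z) ^+ m * h w].
Hypothesis G_one : forall z, z != z0 -> cmod (z - z0) < r1 -> G z = 1 ->
  (\forall w \near z, G w = 1) \/
  exists m h d, [/\ (3 <= m)%N, 0 < d, holD h z d, h z != 0 &
    forall w, cmod (w - z) < d -> G w - 1 = (w - z) ^+ m * h w].
Hypothesis G_center :
  (exists h d, [/\ 0 < d, holD h z0 d &
     forall w, w != z0 -> cmod (w - z0) < d -> G w = h w]) \/
  (exists k h d, [/\ 0 < d, holD h z0 d, h z0 != 0 &
     forall w, w != z0 -> cmod (w - z0) < d -> G w = h w / (w - z0) ^+ k.+1]).

Let near_small f z (e : R) : ccont f z -> f z = 0 -> 0 < e ->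
  exists2 d, 0 < d & forall w, cmod (w - z) < d -> cmod (f w) <= e.
Proof.
move=> cf fz e0; move/ccontP/(_ _ e0)/nbhsCP: cf => [d d0 dP]; exists d => // w /dP.
by rewrite fz subr0 => /ltW.
Qed.

Let cderG1 z : cder G z -> cder (fun w => G w - 1) z.
Proof. by move=> dG; apply: cderB => //; exact: cder_cst. Qed.

Lemma G_hol_near z : z != z0 -> cmod (z - z0) < r1 ->
  exists2 d, 0 < d & holD G z d.
Proof.
move=> zz zr; apply/nbhsCP; move: (near_neqC zz) (near_disc zr).
by apply: filterS2; exact: G_hol.
Qed.

Let Psi_zero_near z : (\forall w \near z, Psi w = 0) -> {for z, continuous Psi}.
Proof.
move=> Pn; apply: Psi_cont0; first exact: nbhs_singleton Pn.
move: Pn => /nbhsCP[d d0 dP]; exists 0, d; split => // w _ /dP ->.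
by rewrite mul0r.
Qed.

(** Continuity is what provides a maximum. As the inverse of 0 is 0, [Psi] has the value 0 at [z0],
    at zeros and at 1-points of [G], and the content is that it tends to 0 there. At [z0] the weight
    tolerates zeros, 1-points and poles of any order. *)
Lemma Psi_cont z : cmod (z - z0) < r1 -> {for z, continuous Psi}.
Proof.
move=> zr; have [zE|zz] := eqVneq z z0.
  rewrite zE in zr *.
  case: G_center => [[h [d [d0 hh GE]]]|[k [h [d [d0 hh h0 GE]]]]].
    have z0d : cmod (z0 - z0) < d by rewrite subrr cmod0.
    have derGE w : w != z0 -> cmod (w - z0) < d -> der G w = der h w.
      move=> wz wd; apply/esym/eq_near_der; last exact: hh.
      by move: (near_neqC wz) (near_disc wd); apply: filterS2 => v vz vd; rewrite GE.
    have ch := cder_ccont (hh _ z0d).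
    have hh1 : holD (fun w => h w - 1) z0 d.
      by move=> w wd; apply: cderB; [exact: hh|exact: cder_cst].
    have [h0|h0] := eqVneq (h z0) 0.
      case: (zero_factor d0 hh) => [hz|[[|m] [h2 [hh2 h20 hE]]]].
      - apply: Psi_zero_near; apply/nbhsCP; exists (d / 3); first by rewrite divr_gt0.
        move=> w wd; have [->|wz] := eqVneq w z0; first exact: Psi_center.
        by apply: Psi_G0; rewrite GE ?hz //; lra.
      - by move: h0; rewrite hE mul1r => h2z; rewrite h2z eqxx in h20.
      apply: Psi_cont0; first exact: Psi_center.
      apply: (@local_bound h h2 z0 d m 22 47) => //; first by right.
        by clear; lia.
      have h12 : 0 < 1 / 2 :> R by lra.
      have [d2 d20 d2P] := near_small ch h0 h12.
      exists (Num.min d d2); first by rewrite lt_min d0.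
      move=> w wz; rewrite lt_min => /andP[wd /d2P w2].
      rewrite derGE // GE // mulrA ler_wpM2r ?sqr_ge0 //; exact: dens2_near0.
    have [h1|h1] := eqVneq (h z0) 1.
      have h10 : h z0 - 1 = 0 by rewrite h1 subrr.
      case: (zero_factor d0 hh1) => [hz|[[|m] [h2 [hh2 h20 hE]]]].
      - apply: Psi_zero_near; apply/nbhsCP; exists (d / 3); first by rewrite divr_gt0.
        move=> w wd; have [->|wz] := eqVneq w z0; first exact: Psi_center.
        apply: Psi_G1; rewrite GE //; last by lra.
        by apply/eqP; rewrite -subr_eq0 hz.
      - by move: h10; rewrite hE mul1r => h2z; rewrite h2z eqxx in h20.
      apply: Psi_cont0; first exact: Psi_center.
      apply: (@local_bound (fun w => h w - 1) h2 z0 d m 30 47) => //; first by right.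
        by clear; lia.
      have h12 : 0 < 1 / 2 :> R by lra.
      have [d2 d20 d2P] := near_small (cder_ccont (hh1 _ z0d)) h10 h12.
      exists (Num.min d d2); first by rewrite lt_min d0.
      move=> w wz; rewrite lt_min => /andP[wd /d2P w2].
      rewrite derGE // GE // der_sub1; last exact: hh.
      rewrite mulrA ler_wpM2r ?sqr_ge0 //; exact: dens2_near1.
    pose X w := dens2 (rt (cmod (h w))) (rt (cmod (h w - 1))) * cmod (der h w) ^+ 2.
    have cX : {for z0, continuous X}.
      have cu := rt_cont ch; have cv := rt_cont (cder_ccont (hh1 _ z0d)).
      have u0 : rt (cmod (h z0)) != 0 by rewrite gt_eqF // rt_gt0 // cmod_gt0.
      have v0 : rt (cmod (h z0 - 1)) != 0.
        by rewrite gt_eqF // rt_gt0 // cmod_gt0 subr_eq0.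
      apply: rcontM; first exact: dens2_cont.
      exact: ccont_sqr_cmod (cder_ccont (holD_der hh z0d)).
    have /nbhsCP[d2 d20 d2P] := near_bound_cont cX.
    apply: Psi_cont0; first exact: Psi_center.
    have X0 : 0 <= X z0 + 1.
      rewrite addr_ge0 // mulr_ge0 ?sqr_ge0 //; apply: dens2_ge0; exact: rt_ge0.
    exists ((X z0 + 1) * Bd), (Num.min (Num.min d d2) (Num.min 1 r1)); split.
    - by rewrite mulr_ge0 ?sqr_ge0.
    - by rewrite !lt_min d0 d20 ltr01 (lt_trans r_gt0).
    move=> w wz; rewrite !lt_min => /andP[/andP[wd /d2P wX] /andP[w1 wr]].
    rewrite /Psi derGE // GE // -/(X w).
    have t0 := rt_ge0 (cmod (w - z0)).
    have t1 : rt (cmod (w - z0)) <= 1 by apply: rt_le1; [exact: cmod_ge0|exact: ltW].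
    have t47 : rt (cmod (w - z0)) ^+ 47 <= rt (cmod (w - z0)).
      by rewrite exprS -[leRHS]mulr1 ler_wpM2l // exprn_ile1.
    apply: (@le_trans _ _ ((X z0 + 1) * (rt (cmod (w - z0)) * Bd))); last first.
      by rewrite le_eqVlt; apply/orP; left; apply/eqP; ring.
    apply: ler_pM => //.
    - by rewrite mulr_ge0 ?sqr_ge0 //; apply: dens2_ge0; exact: rt_ge0.
    - by rewrite mulr_ge0 ?sqr_ge0 // exprn_ge0.
    by apply: ler_pM; rewrite ?sqr_ge0 ?exprn_ge0 ?factor_le.
  have z0d : cmod (z0 - z0) < d by rewrite subrr cmod0.
  have ch := cder_ccont (hh _ z0d).
  have hp : 0 < cmod (h z0) by rewrite cmod_gt0.
  have [d2 d20 d2P] : exists2 d2, 0 < d2 & forall w, cmod (w - z0) < d2 ->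
      cmod (h z0) / 2 < cmod (h w) /\ cmod (w - z0) < d.
    apply/nbhsCP; have h2 : 0 < cmod (h z0) / 2 by lra.
    move/ccontP/(_ _ h2): ch => n1; move: n1 (near_disc z0d); apply: filterS2 => w h1.
    by split=> //; have := cmod_sub_le (h z0) (h w); rewrite cmodB; lra.
  have hn0 w : cmod (w - z0) < d2 -> h w != 0.
    by move=> /d2P[h1 _]; rewrite -cmod_gt0; lra.
  (* At a pole the count is made for [V = 1 / G]: |G|^(-50/24) |G'|^2 becomes |V|^(-46/24) |V'|^2. A
     simple pole requires [46 + 1 <= 47], so the exponent of the weight is exactly sufficient. *)
  pose V w := (w - z0) ^+ k.+1 * (h w)^-1.
  have hV : holD (fun w => (h w)^-1) z0 d2.
    move=> w wd; apply: cderV; first exact: hn0.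
    by apply: hh; case: (d2P w wd).
  apply: Psi_cont0; first exact: Psi_center.
  have z0d2 : cmod (z0 - z0) < d2 by rewrite subrr cmod0.
  apply: (@local_bound V (fun w => (h w)^-1) z0 d2 k 46 47) => //; first by right.
  - by rewrite invr_eq0.
  - by clear; lia.
  pose d3 := Num.min 1 (cmod (h z0) / 4).
  exists (Num.min d2 d3); first by rewrite !lt_min d20 ltr01; lra.
  move=> w wz; rewrite /d3 !lt_min => /andP[wd2 /andP[w1 w4]].
  have [hw wd] := d2P w wd2; have hw0 := hn0 w wd2.
  have wz0 : w - z0 != 0 by rewrite subr_eq0.
  have GV : G w = (V w)^-1 by rewrite GE // /V invfM invrK mulrC.
  have V0 : V w != 0 by rewrite mulf_neq0 ?expf_neq0 ?invr_eq0.
  have cV : cder V w.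
    apply: cderM; last exact: hV.
    by apply: cderX; apply: cderB; [exact: cder_id|exact: cder_cst].
  have dGE : der G w = - der V w / V w ^+ 2.
    apply: derE; apply: (@eq_near_cdiff _ (fun w => (V w)^-1)).
      move: (near_neqC wz) (near_disc wd); apply: filterS2 => v vz vd.
      by rewrite GE // /V invfM invrK mulrC.
    by apply: cdiffV => //; exact: derP.
  have G2 : 2 <= cmod (G w).
    rewrite GE // cmodM cmodV cmodX ler_pdivlMr ?exprn_gt0 ?cmod_gt0 //.
    have : cmod (w - z0) ^+ k.+1 <= cmod (w - z0).
      rewrite exprS -[leRHS]mulr1 ler_wpM2l ?cmod_ge0 // exprn_ile1 ?cmod_ge0 //.
      exact: ltW.
    by lra.
  apply: (@le_trans _ _ (2 ^+ 33 * rt (cmod (G w)) ^- 50 * cmod (der G w) ^+ 2)).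
    by rewrite ler_wpM2r ?sqr_ge0 //; exact: dens2_nearoo.
  rewrite le_eqVlt; apply/orP; left; apply/eqP; rewrite -mulrA; congr (_ * _).
  rewrite dGE GV cmodM cmodN !cmodV cmodX rtV ?cmod_ge0 // exprVn invrK.
  have vp : 0 < rt (cmod (V w)) by rewrite rt_gt0 // cmod_gt0.
  rewrite -[X in _ / X ^+ 2](rtX (cmod_ge0 (V w))).
  by move: (rt (cmod (V w))) vp => v vp; field; rewrite gt_eqF.
have dG := G_hol zz zr; have cG := cder_ccont dG.
have [d d0 dP] := G_hol_near zz zr.
have h12 : 0 < 1 / 2 :> R by lra.
have [G0|G0] := eqVneq (G z) 0.
  case: (G_zero zz zr G0) => [Gn|[m [h [d1 [m2 d10 hh h0 GE]]]]].
    by apply: Psi_zero_near; apply: filterS Gn => w; exact: Psi_G0.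
  apply: Psi_cont0; first exact: Psi_G0.
  case: m m2 GE => // m m2 GE.
  (* There is no help from the weight here, and [m] is the order less 1: order 2 requires
     [45 <= 48], whereas order 1 would fail. *)
  apply: (@local_bound G h z d1 m 22 0) => //; first by left.
  - by move=> w _; exact: GE.
  - by move: m2; clear; lia.
  have [d2 d20 d2P] := near_small cG G0 h12.
  exists d2 => // w wz /d2P w2.
  by rewrite mulrA ler_wpM2r ?sqr_ge0 //; exact: dens2_near0.
have [G1|G1] := eqVneq (G z) 1.
  have G10 : G z - 1 = 0 by rewrite G1 subrr.
  case: (G_one zz zr G1) => [Gn|[m [h [d1 [m2 d10 hh h0 GE]]]]].
    by apply: Psi_zero_near; apply: filterS Gn => w; exact: Psi_G1.
  apply: Psi_cont0; first exact: Psi_G1.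
  case: m m2 GE => // m m2 GE.
  (* Order 3 requires [91 <= 96]; order 2 would fail. *)
  apply: (@local_bound (fun w => G w - 1) h z d1 m 30 0) => //; first by left.
  - by move=> w _; exact: GE.
  - by move: m2; clear; lia.
  have [d2 d20 d2P] := near_small (cder_ccont (cderG1 dG)) G10 h12.
  exists (Num.min d d2); first by rewrite lt_min d0.
  move=> w wz; rewrite lt_min => /andP[wd /d2P w2].
  rewrite der_sub1; last exact: dP.
  by rewrite mulrA ler_wpM2r ?sqr_ge0 //; exact: dens2_near1.
have cu := rt_cont cG; have cv := rt_cont (cder_ccont (cderG1 dG)).
have u0 : rt (cmod (G z)) != 0 by rewrite gt_eqF // rt_gt0 // cmod_gt0.
have v0 : rt (cmod (G z - 1)) != 0.
  by rewrite gt_eqF // rt_gt0 // cmod_gt0 subr_eq0.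
have z_d : cmod (z - z) < d by rewrite subrr cmod0.
have ct : {for z, continuous (fun w => rt (cmod (w - z0)))}.
  by apply: rt_cont; apply: ccontB; [exact: ccont_id|exact: ccont_cst].
apply: rcontM; last by apply: rcontM; [exact: rcontX|apply: rcontX; exact: rcont_cB].
apply: rcontM; first exact: dens2_cont.
exact: ccont_sqr_cmod (cder_ccont (holD_der dP z_d)).
Qed.

Lemma der_at_zero z : z != z0 -> cmod (z - z0) < r1 -> G z = 0 -> der G z = 0.
Proof.
move=> zz zr Gz; case: (G_zero zz zr Gz) => [Gn|[m [h [d [m2 d0 hh h0 GE]]]]].
  by apply: derE; apply: eq_near_cdiff (cdiff_cst 0 z); apply: filterS Gn => w ->.
case: m m2 GE => [//|[//|m]] _ GE; apply: derE.
apply: (@eq_near_cdiff _ (fun w => (w - z) ^+ m.+2 * h w)).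
  by apply/nbhsCP; exists d => // w wd; rewrite GE.
apply: cdiff_eq.
  apply: cdiffM; last by apply: derP; apply: hh; rewrite subrr cmod0.
  by apply: cdiffX; exact: cdiffB (cdiff_id _) (cdiff_cst _ _).
by rewrite /= subrr !expr0n /= !(mulr0, mul0r) addr0.
Qed.

Lemma der_at_one z : z != z0 -> cmod (z - z0) < r1 -> G z = 1 -> der G z = 0.
Proof.
move=> zz zr Gz; case: (G_one zz zr Gz) => [Gn|[m [h [d [m2 d0 hh h0 GE]]]]].
  by apply: derE; apply: eq_near_cdiff (cdiff_cst 1 z); apply: filterS Gn => w ->.
case: m m2 GE => [//|[//|m]] _ GE.
rewrite -der_sub1; last exact: G_hol.
apply: derE; apply: (@eq_near_cdiff _ (fun w => (w - z) ^+ m.+2 * h w)).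
  by apply/nbhsCP; exists d => // w wd; rewrite GE.
apply: cdiff_eq.
  apply: cdiffM; last by apply: derP; apply: hh; rewrite subrr cmod0.
  by apply: cdiffX; exact: cdiffB (cdiff_id _) (cdiff_cst _ _).
by rewrite /= subrr !expr0n /= !(mulr0, mul0r) addr0.
Qed.

Lemma max_rt w : 1 / 2 <= Num.max (rt (cmod w)) (rt (cmod (w - 1))).
Proof.
apply: max_ge_half; rewrite ?rt_ge0 // !rtX ?cmod_ge0 //.
by have := cmodBD w (w - 1); rewrite opprB addrC subrK cmod1.
Qed.

(** [Psi] vanishes on the circle of radius [r], so a positive maximum is attained at an interior
    point [c] where no factor of [Psi] vanishes. There [ln Psi] has Laplacian at most 0, which
    compares the curvature terms of the cone metric and of the disc metric and bounds [Psi c]. The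
    margin [r < r1] keeps the closed disc inside the region where [G] is controlled. *)
Lemma Psi_bound w : cmod (w - z0) <= r -> Psi w <= 2916 * rt r.
Proof.
have rho0 : 0 < rt r by exact: rt_gt0.
have [c cr cM] := max_on_disc (ltW r_gt0)
  (fun w wr => @Psi_cont w (le_lt_trans wr r_lt)).
move=> /cM Pw; apply: (le_trans Pw) => {w Pw}.
have [Pc|Pc0] := leP (Psi c) 0.
  by apply: (le_trans Pc); apply: mulr_ge0; [exact: ler0n|exact: ltW].
have cz : c != z0 by apply: contraTneq Pc0 => ->; rewrite Psi_center ltxx.
have Gc0 : G c != 0 by apply/eqP => /Psi_G0 E; rewrite E ltxx in Pc0.
have Gc1 : G c - 1 != 0.
  by rewrite subr_eq0; apply/eqP => /Psi_G1 E; rewrite E ltxx in Pc0.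
have dGc0 : der G c != 0.
  apply/eqP => E; move: Pc0; rewrite /Psi E cmod0 expr0n /= mulr0 mul0r.
  by rewrite ltxx.
have cr' : cmod (c - z0) < r.
  rewrite lt_def cr andbT; apply/eqP => E; move: Pc0.
  by rewrite /Psi -E subrr expr0n /= !mulr0 ltxx.
have cr1 := lt_trans cr' r_lt.
have [d d0 dP] := G_hol_near cz cr1.
have c_d : cmod (c - c) < d by rewrite subrr cmod0.
have hG1 : holD (fun w => G w - 1) c d.
  by move=> w wd; apply: cderG1; exact: dP.
have hz : holD (fun w => w - z0) c d.
  by move=> w wd; apply: cderB; [exact: cder_id|exact: cder_cst].
have hG' := holD_der dP.
have cz0 : c - z0 != 0 by rewrite subr_eq0.
have pos w : 0 < 1 + 1 * rt (cmod w) :> R by rewrite ltr_pwDl // mul1r rt_ge0.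
have posr w : cmod (w - z0) < r -> 0 < rt r + -1 * rt (cmod (w - z0)).
  by move=> wr; rewrite mulN1r subr_gt0; apply: rt_lt => //; exact: cmod_ge0.
(* Four potentials: the two cone factors, |G'|^2, whose logarithm is harmonic, and the weight. A
   coefficient [j / 48] stands for the power [rt ^+ j]. *)
pose L w := pot 1%:R 1 1 (- (22%:R / 48)) (ln (cmod (G w) ^+ 2)) +
  pot 1%:R 1 1 (- (30%:R / 48)) (ln (cmod (G w - 1) ^+ 2)) +
  (pot 0%:R 1 0 (48%:R / 48) (ln (cmod (der G w) ^+ 2)) +
   pot 2%:R (rt r) (-1) (47%:R / 48) (ln (cmod (w - z0) ^+ 2))).
have PE w : w != z0 -> cmod (w - z0) < r -> G w != 0 -> G w - 1 != 0 ->
    der G w != 0 -> Psi w = expR (L w).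
  move=> wz wr G0 G1 D0; have wz0 : w - z0 != 0 by rewrite subr_eq0.
  have e4 (x1 x2 x3 x4 : R) : expR (x1 + x2 + (x3 + x4)) =
    expR x1 * expR x2 * (expR x3 * expR x4) by rewrite !expRD.
  rewrite /L e4 !expR_pot ?cmod_gt0 ?pos ?posr ?mul0r ?addr0 //.
  rewrite !expR_neg ?cmod_gt0 // !expR_pos ?cmod_gt0 // /Psi /dens2.
  rewrite !mul1r !mulN1r !expr1 ?expr0 ?mul1r.
  have -> : rt (cmod (der G w)) ^+ 48 = cmod (der G w) ^+ 2.
    by rewrite -[in RHS](rtX (cmod_ge0 (der G w))) -exprM.
  ring.
have near_neq0 f : ccont f c -> f c != 0 -> \forall w \near c, f w != 0.
  move=> /ccontP cf fc; have := cf (cmod (f c)); rewrite cmod_gt0 => /(_ fc).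
  apply: filterS => w; apply: contraTneq => ->.
  by rewrite sub0r cmodN ltxx.
have Lmax : \forall w \near c, L w <= L c.
  have n1 := near_neq0 _ (cder_ccont (dP _ c_d)) Gc0.
  have n2 := near_neq0 _ (cder_ccont (hG1 _ c_d)) Gc1.
  have n3 := near_neq0 _ (cder_ccont (hG' _ c_d)) dGc0.
  have n4 := near_neqC cz; have n5 := near_disc cr'.
  near=> w; rewrite -ler_expR -!PE //; try (by near: w).
  by apply: cM; apply: ltW; near: w.
have Ec x : 0 < x -> expR (ln (x ^+ 2) / 48) = rt x by exact: expR_ln_rt.
have l1 := @lap_pot R 1%:R 1 1 (- (22%:R / 48)) _ _ _ d0 dP Gc0.
have l2 := @lap_pot R 1%:R 1 1 (- (30%:R / 48)) _ _ _ d0 hG1 Gc1.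
have l3 := @lap_pot R 0%:R 1 0 (48%:R / 48) _ _ _ d0 hG' dGc0.
have l4 := @lap_pot R 2%:R (rt r) (-1) (47%:R / 48) _ _ _ d0 hz cz0.
rewrite /= !Ec ?cmod_gt0 // in l1 l2 l3 l4.
have b3 : 0 < 1 + 0 * rt (cmod (der G c)) :> R by rewrite mul0r addr0.
have := lap_max (lapD (lapD (l1 (pos _)) (l2 (pos _))) (lapD (l3 b3) (l4 (posr _ cr')))) Lmax.
have dz : der (fun w => w - z0) c = 1.
  by apply: derE; apply: cdiff_eq; [exact: (cdiffB (cdiff_id c) (cdiff_cst z0 c))|rewrite subr0].
rewrite dz der_sub1; last exact: dP.
rewrite !cmodM !cmodV cmod1 !mul1r !mulN1r !(mulr0, mul0r) !add0r.
have u0 : 0 < rt (cmod (G c)) by rewrite rt_gt0 ?cmod_gt0.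
have v0 : 0 < rt (cmod (G c - 1)) by rewrite rt_gt0 ?cmod_gt0.
have t0 : 0 < rt (cmod (c - z0)) by rewrite rt_gt0 ?cmod_gt0.
have cv := curvature u0 v0 (max_rt (G c)).
have tr : rt (cmod (c - z0)) < rt r by apply: rt_lt => //; exact: cmod_ge0.
have q1 y : 0 <= y -> y^-1 ^+ 2 = rt y ^- 48.
  by move=> y0; rewrite -{1}(rtX y0) exprVn -exprM.
have q2 a y : 0 <= y -> (a / y) ^+ 2 = a ^+ 2 * rt y ^- 48.
  by move=> y0; rewrite exprMn q1.
rewrite !q2 ?cmod_ge0 // q1 ?cmod_ge0 // /Psi.
have g0 : 0 <= cmod (der G c) ^+ 2 by exact: sqr_ge0.
move: (rt (cmod (G c))) (rt (cmod (G c - 1))) (cmod (der G c) ^+ 2)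
  (rt (cmod (c - z0))) (rt r) u0 v0 g0 t0 tr cv rho0 {Pc0 pos posr} => u v g t p u0 v0 g0 t0 tr cv p0 A.
have pt : 0 < p - t by rewrite subr_gt0.
set cur := u / (1 + u) ^+ 2 / u ^+ 48 + v / (1 + v) ^+ 2 / v ^+ 48 in cv.
(* The maximum condition [A] without its positive factor [4 / 48 ^+ 2]. Together with [cv] it gives
   the final constant [2916 = 2 * 1458]. *)
have B : g * cur <= 2 * p * t / (p - t) ^+ 2 / t ^+ 48.
  have -> : g * cur = g * (u / (1 + u) ^+ 2 * u ^- 48) + g * (v / (1 + v) ^+ 2 * v ^- 48).
    by rewrite /cur mulrDr.
  move: A.
  match goal with |- is_true (?X <= 0) -> _ => have -> : X = 4 / 48 ^+ 2 *
    (g * (u / (1 + u) ^+ 2 * u ^- 48) + g * (v / (1 + v) ^+ 2 * v ^- 48) -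
     2 * p * t / (p - t) ^+ 2 / t ^+ 48) by ring end.
  by rewrite pmulr_rle0 ?subr_le0 // divr_gt0 ?exprn_gt0.
apply: (@le_trans _ _ (1458 * cur * g * (t ^+ 47 * (p - t) ^+ 2))).
  apply: ler_wpM2r; last exact: ler_wpM2r.
  by rewrite mulr_ge0 ?sqr_ge0 // exprn_ge0 // ltW.
have -> : 1458 * cur * g * (t ^+ 47 * (p - t) ^+ 2) =
  1458 * (g * cur * (t ^+ 47 * (p - t) ^+ 2)) by ring.
apply: (@le_trans _ _ (1458 * (2 * p * t / (p - t) ^+ 2 / t ^+ 48 * (t ^+ 47 * (p - t) ^+ 2)))).
  rewrite ler_pM2l ?ltr0n // ler_wpM2r //.
  by rewrite mulr_ge0 ?sqr_ge0 // exprn_ge0 // ltW.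
have -> : 2 * p * t / (p - t) ^+ 2 / t ^+ 48 * (t ^+ 47 * (p - t) ^+ 2) = 2 * p.
  by rewrite [t ^+ 48]exprS; move: (t ^+ 47) (exprn_gt0 47 t0) => s s0; field;
     rewrite !gt_eqF.
lra.
Unshelve. all: by end_near. Qed.

End Ahlfors.

(** * Oscillation along radii *)

Section Oscillation.
Variable R : realType.
Notation C := R[i].
Implicit Types (z w : C) (h G : C -> C) (x s t : R).

Lemma rdX n (f : R -> R) x (a : R) : is_derive x 1 f a ->
  is_derive x 1 (fun t => f t ^+ n.+1) (n.+1%:R * f x ^+ n * a).
Proof.
move=> df; elim: n => [|n IH]; first by rewrite expr0 !mul1r.
have -> : (fun t => f t ^+ n.+2) = (fun t => f t * f t ^+ n.+1).
  by apply/funext => t; rewrite exprS.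
have -> : n.+2%:R * f x ^+ n.+1 * a =
    a * f x ^+ n.+1 + f x * (n.+1%:R * f x ^+ n * a).
  by rewrite [n.+2%:R]mulrS exprS; ring.
exact: rdM IH.
Qed.

(** In the coordinate [w / (w - 1)], which is [f / psi] for [w = f / (f - psi)], this is the height
    on the Riemann sphere of diameter 1: |f|^2 / (|f|^2 + |psi|^2). *)
Definition Theta w : R := cmod w ^+ 2 / (cmod w ^+ 2 + cmod (w - 1) ^+ 2).

Lemma Theta_den w : 0 < cmod w ^+ 2 + cmod (w - 1) ^+ 2.
Proof.
have [->|w0] := eqVneq w 0.
  by rewrite cmod0 expr0n /= add0r sub0r cmodN cmod1 expr1n.
by rewrite ltr_wpDr ?sqr_ge0 // exprn_gt0 // cmod_gt0.
Qed.

(** The height is 1-Lipschitz for the metric of the sphere, whose density, pulled back by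
    [w / (w - 1)], is 1 / (|w|^2 + |w - 1|^2). *)
Lemma Theta_crd (c : R -> C) t (v : C) : crd c t v ->
  exists2 D, is_derive t 1 (fun s => Theta (c s)) D &
    `|D| <= cmod v / (cmod (c t) ^+ 2 + cmod (c t - 1) ^+ 2).
Proof.
move=> [d1 d2].
set p := fun s => complex.Re (c s); set q := fun s => complex.Im (c s).
pose a s := p s * p s + q s * q s.
pose b s : R := (-1 + p s) * (-1 + p s) + q s * q s.
have aE s : cmod (c s) ^+ 2 = a s by rewrite sqr_cmod !expr2.
have bE s : cmod (c s - 1) ^+ 2 = b s.
  by rewrite sqr_cmod cReD cImD cReN cImN /= subr0 !expr2 /b /p /q addrC [-1 + _]addrC addrC.
set p' := complex.Re v in d1; set q' := complex.Im v in d2.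
have da := rdD (rdM d1 d1) (rdM d2 d2).
have d1' := rdD (is_derive_cst (-1 : R) t 1) d1.
have db := rdD (rdM d1' d1') (rdM d2 d2).
have den0 : 0 < a t + b t by rewrite -aE -bE; exact: Theta_den.
have dV := rdV (f := fun s => a s + b s) (x := t) _ (rdD da db).
have {}dV := dV (lt0r_neq0 den0).
have dT := rdM da dV.
have TE : (fun s => Theta (c s)) = (fun s => a s * (a s + b s)^-1).
  by apply/funext => s; rewrite /Theta aE bE.
eexists; first by rewrite TE; exact: dT.
rewrite aE bE /=.
pose N := -2 * (p' * (p t * (p t - 1) - q t * q t) + q' * (q t * (p t - 1) + p t * q t)).
match goal with |- is_true (`|?X| <= _) => have -> : X = N / (a t + b t) ^+ 2 end.
  by rewrite /N /a /b; field; rewrite -/(b t) -/(a t) gt_eqF.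
have ND : N ^+ 2 <= (cmod v * (a t + b t)) ^+ 2.
  rewrite [leRHS]exprMn sqr_cmod -/p' -/q'.
  (* [X] and [Y] are the real and imaginary parts of [c t * (c t - 1)]; the claim is Cauchy-Schwarz
     followed by the inequality of the means. *)
  pose X := p t * (p t - 1) - q t * q t; pose Y := q t * (p t - 1) + p t * q t.
  have XY : X ^+ 2 + Y ^+ 2 = a t * b t by rewrite /X /Y /a /b; ring.
  have -> : N ^+ 2 = 4 * (p' * X + q' * Y) ^+ 2 by rewrite /N /X /Y; ring.
  have h1 : (p' * X + q' * Y) ^+ 2 <= (p' ^+ 2 + q' ^+ 2) * (a t * b t).
    rewrite -XY -subr_ge0.
    have -> : (p' ^+ 2 + q' ^+ 2) * (X ^+ 2 + Y ^+ 2) - (p' * X + q' * Y) ^+ 2 =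
      (p' * Y - q' * X) ^+ 2 by ring.
    exact: sqr_ge0.
  have h2 : 4 * (a t * b t) <= (a t + b t) ^+ 2.
    rewrite -subr_ge0; have -> : (a t + b t) ^+ 2 - 4 * (a t * b t) = (a t - b t) ^+ 2 by ring.
    exact: sqr_ge0.
  apply: (@le_trans _ _ ((p' ^+ 2 + q' ^+ 2) * (4 * (a t * b t)))).
    have -> : (p' ^+ 2 + q' ^+ 2) * (4 * (a t * b t)) =
      4 * ((p' ^+ 2 + q' ^+ 2) * (a t * b t)) by ring.
    by rewrite ler_pM2l.
  by rewrite ler_wpM2l // addr_ge0 ?sqr_ge0.
have {}ND : `|N| <= cmod v * (a t + b t).
  rewrite -(@ler_pXn2r _ 2) ?nnegrE ?mulr_ge0 ?cmod_ge0 ?(ltW den0) //.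
  by rewrite real_normK ?num_real.
rewrite normrM normfV normrX (gtr0_norm den0) ler_pdivrMr ?exprn_gt0 //.
apply: (le_trans ND); rewrite le_eqVlt; apply/orP; left; apply/eqP.
by rewrite expr2 mulrA divfK // gt_eqF.
Qed.

(* Satisfied by [f / (f - psi)] when [f] and [psi] differ off [z0]: its zeros and
   its 1-points are then the zeros and the poles of [f]. *)
Definition admissible z0 (r1 : R) G := [/\
  forall w, w != z0 -> cmod (w - z0) < r1 -> cder G w,
  forall z, z != z0 -> cmod (z - z0) < r1 -> G z = 0 ->
    (\forall w \near z, G w = 0) \/
    exists m h d, [/\ (2 <= m)%N, 0 < d, holD h z d, h z != 0 &
      forall w, cmod (w - z) < d -> G w = (w - z) ^+ m * h w],
  forall z, z != z0 -> cmod (z - z0) < r1 -> G z = 1 ->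
    (\forall w \near z, G w = 1) \/
    exists m h d, [/\ (3 <= m)%N, 0 < d, holD h z d, h z != 0 &
      forall w, cmod (w - z) < d -> G w - 1 = (w - z) ^+ m * h w] &
  (exists h d, [/\ 0 < d, holD h z0 d &
     forall w, w != z0 -> cmod (w - z0) < d -> G w = h w]) \/
  (exists k h d, [/\ 0 < d, holD h z0 d, h z0 != 0 &
     forall w, w != z0 -> cmod (w - z0) < d -> G w = h w / (w - z0) ^+ k.+1])].

(** [2 ^+ 44] comes from the comparison with the chordal density; the rest is the bound
    [2916 * rt r] of [Psi] divided by [(rt r / 2) ^+ 2], a lower bound of its boundary factor in the
    region considered. *)
Definition Kgrad (r : R) : R := 2 ^+ 44 * (2916 * 4 / rt r).

Lemma grad_bound z0 r r1 G w : 0 < r -> r < r1 -> admissible z0 r1 G -> w != z0 ->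
  rt (cmod (w - z0)) <= rt r / 2 ->
  (cmod (der G w) / (cmod (G w) ^+ 2 + cmod (G w - 1) ^+ 2)) ^+ 2 *
    rt (cmod (w - z0)) ^+ 47 <= Kgrad r.
Proof.
move=> r0 rr1 [G1 G2 G3 G4] wz wr.
have p0 : 0 < rt r by exact: rt_gt0.
have K0 : 0 <= Kgrad r.
  apply: mulr_ge0; first exact: exprn_ge0.
  apply: mulr_ge0; last by rewrite invr_ge0 ltW.
  by apply: mulr_ge0; exact: ler0n.
have wr' : cmod (w - z0) <= r.
  rewrite leNgt; apply/negP => /ltW/(rt_le (ltW r0)) h.
  by move: wr h p0; lra.
have wr1 := le_lt_trans wr' rr1.
(* Where [G] is 0 or 1 the bound on [Psi] is void, as the density is 0 there by convention; but the
   multiplicities make the derivative of [G] vanish. *)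
have [Gw0|Gw0] := eqVneq (G w) 0.
  by rewrite (der_at_zero G2) // cmod0 mul0r expr0n mul0r.
have [Gw1|Gw1] := eqVneq (G w) 1.
  by rewrite (der_at_one G1 G3) // cmod0 mul0r expr0n mul0r.
have u0 : 0 < rt (cmod (G w)) by rewrite rt_gt0 // cmod_gt0.
have v0 : 0 < rt (cmod (G w - 1)) by rewrite rt_gt0 // cmod_gt0 subr_eq0.
have PB := Psi_bound r0 rr1 G1 G2 G3 G4 wr'.
have CD := chordal_dens u0 v0 (max_rt (G w)).
have sq x : 0 <= x -> x ^+ 2 = rt x ^+ 48 by move=> x0; rewrite -{1}(rtX x0) -exprM.
rewrite expr_div_n !(sq (cmod (G _))) ?(sq (cmod (G _ - 1))) ?cmod_ge0 //.
move: PB CD wr K0; rewrite /Psi /Kgrad.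
have g0 : 0 <= cmod (der G w) ^+ 2 by exact: sqr_ge0.
have t0 := rt_ge0 (cmod (w - z0)).
have D0 : 0 <= dens2 (rt (cmod (G w))) (rt (cmod (G w - 1))) by apply: dens2_ge0; exact: ltW.
move: (dens2 _ _) D0 (cmod (der G w) ^+ 2) g0 (rt (cmod (w - z0))) t0 (rt r) p0 (rt _ ^+ 48 + _) =>
  D D0 g g0 t t0 p p0 S PB CD tp K0.
have T0 : 0 <= t ^+ 47 by rewrite exprn_ge0.
have p2 : (p / 2) ^+ 2 <= (p - t) ^+ 2.
  have tp2 : p / 2 <= p - t by move: tp; clear; lra.
  have p20 : 0 <= p / 2 by rewrite divr_ge0 // ltW.
  by apply: lerXn2r; rewrite ?nnegrE // (le_trans p20).
have H : D * g * t ^+ 47 * (p / 2) ^+ 2 <= 2916 * p.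
  apply: le_trans PB; rewrite -[leLHS]mulrA.
  apply: ler_wpM2l; first exact: mulr_ge0.
  exact: ler_wpM2l.
have H2 : D * g * t ^+ 47 <= 2916 * 4 / p.
  have pp : 0 < (p / 2) ^+ 2 by rewrite exprn_gt0 // divr_gt0.
  rewrite -(ler_pM2r pp); apply: (le_trans H).
  rewrite le_eqVlt; apply/orP; left; apply/eqP; field.
  by rewrite gt_eqF.
apply: (@le_trans _ _ (2 ^+ 44 * D * g * t ^+ 47)).
  rewrite ler_wpM2r //; have := ler_wpM2r g0 CD; rewrite mul1r mulrC.
  exact.
rewrite -[leLHS]mulrA -[leLHS]mulrA; apply: ler_wpM2l; first exact: exprn_ge0.
by rewrite mulrA.
Qed.

Lemma rt_sqrt x : 0 <= x -> rt x = Num.sqrt (rt x) ^+ 2.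
Proof. by move=> x0; rewrite sqr_sqrtr // rt_ge0. Qed.

(** [G] is meromorphic at [z0], so it has a limit on the sphere, where [Theta] is continuous.
    Neither [T0] nor the rate is uniform in [G]. *)
Lemma Theta_limit z0 r1 G : admissible z0 r1 G ->
  exists T0 : R, forall e, 0 < e -> exists2 d, 0 < d &
    forall w, w != z0 -> cmod (w - z0) < d -> `|Theta (G w) - T0| <= e.
Proof.
have Tc f z : ccont f z -> {for z, continuous (fun w => Theta (f w))}.
  move=> cf; apply: rcontM; first exact: ccont_sqr_cmod.
  apply: continuousV; first by rewrite gt_eqF // Theta_den.
  apply: continuousD; first exact: ccont_sqr_cmod.
  by apply: ccont_sqr_cmod; apply: ccontB => //; exact: ccont_cst.
have fin f z e : ccont f z -> 0 < e -> exists2 d, 0 < d &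
    forall w, cmod (w - z) < d -> `|Theta (f w) - Theta (f z)| <= e.
  move=> /Tc/cvgrPdist_lt cT e0; have /nbhsCP[d d0 dP] := cT e e0.
  by exists d => // w /dP; rewrite distrC => /ltW.
case=> _ _ _ [[h [d [d0 hh GE]]]|[k [h [d [d0 hh h0 GE]]]]].
  have z0d : cmod (z0 - z0) < d by rewrite subrr cmod0.
  exists (Theta (h z0)) => e /(fin _ _ _ (cder_ccont (hh _ z0d)))[d' d'0 d'P].
  exists (Num.min d d'); first by rewrite lt_min d0.
  by move=> w wz; rewrite lt_min => /andP[wd /d'P]; rewrite GE.
have z0d : cmod (z0 - z0) < d by rewrite subrr cmod0.
pose V w := (w - z0) ^+ k.+1 / h w.
have ThV w : w != 0 -> Theta w^-1 = (1 + cmod (1 - w) ^+ 2)^-1.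
  move=> w0; have cw : cmod w != 0 by rewrite cmod_eq0.
  rewrite /Theta; have -> : w^-1 - 1 = (1 - w) / w by rewrite mulrBl mul1r divff.
  rewrite !(cmodM, cmodV) exprMn exprVn.
  have : 0 < 1 + cmod (1 - w) ^+ 2 by rewrite ltr_pwDl // sqr_ge0.
  by move: (cmod (1 - w) ^+ 2) => y y0; field; rewrite cw gt_eqF.
have cV : ccont V z0.
  apply: ccont_div => //; last exact: cder_ccont (hh _ z0d).
  by apply: ccontX; apply: ccontB; [exact: ccont_id|exact: ccont_cst].
have V00 : V z0 = 0 by rewrite /V subrr expr0n /= mul0r.
have cF : {for z0, continuous (fun w => (1 + cmod (1 - V w) ^+ 2)^-1)}.
  apply: continuousV; first by rewrite gt_eqF // ltr_pwDl // sqr_ge0.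
  apply: rcont_cD; apply: ccont_sqr_cmod; apply: ccontB => //; exact: ccont_cst.
exists ((1 + cmod (1 - V z0) ^+ 2)^-1) => e e0.
move/cvgrPdist_lt: cF => /(_ e e0)/nbhsCP[d2 d20 d2P].
have [d3 d30 d3P] : exists2 d3, 0 < d3 & forall w, cmod (w - z0) < d3 -> h w != 0.
  have /ccontCP/(_ (cmod (h z0))) := cder_ccont (hh _ z0d).
  rewrite cmod_gt0 => /(_ h0)[d3 d30 d3P]; exists d3 => // w /d3P.
  by apply: contraTneq => ->; rewrite sub0r cmodN ltxx.
exists (Num.min d (Num.min d2 d3)); first by rewrite !lt_min d0 d20.
move=> w wz; rewrite !lt_min => /andP[wd /andP[/d2P w2 /d3P w3]].
have V0 : V w != 0 by rewrite mulf_neq0 ?invr_eq0 ?expf_neq0 // subr_eq0.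
rewrite GE //; have -> : h w / (w - z0) ^+ k.+1 = (V w)^-1.
  by rewrite /V invfM invrK mulrC.
by rewrite ThV // distrC ltW.
Qed.

(** The gradient bound has the singular density |z - z0|^(-47/48). On a radius parametrised by the
    48th power of [s], the speed 48 s^47 cancels it, and [Theta] is Lipschitz in [s] up to the
    centre. *)
Lemma Theta_osc z0 r r1 G T0 w : 0 < r -> r < r1 -> admissible z0 r1 G ->
  (forall e, 0 < e -> exists2 d, 0 < d &
    forall w, w != z0 -> cmod (w - z0) < d -> `|Theta (G w) - T0| <= e) ->
  w != z0 -> rt (cmod (w - z0)) <= rt r / 2 ->
  `|Theta (G w) - T0| <= 48 * Num.sqrt (Kgrad r) * Num.sqrt (rt (cmod (w - z0))).
Proof.
move=> r0 rr1 aG limT wz wr; have [G1 _ _ _] := aG.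
set y := cmod (w - z0); have y0 : 0 < y by rewrite cmod_gt0 subr_eq0.
set t := Num.sqrt (rt y); have t0 : 0 < t by rewrite sqrtr_gt0 rt_gt0.
have tE : t ^+ 48 = y.
  by rewrite (_ : 48 = 2 * 24)%N // exprM -rt_sqrt ?rtX // ltW.
set K := 48 * Num.sqrt (Kgrad r).
have K0 : 0 <= K by rewrite mulr_ge0 ?sqrtr_ge0.
pose u := (w - z0) / y%:C.
have yC : y%:C != 0 :> C by apply/eqP => -[/eqP]; rewrite gt_eqF.
have u1 : cmod u = 1 by rewrite cmodM cmodV cmodR gtr0_norm // divff // gt_eqF.
pose c s := z0 + (s ^+ 48)%:C * u.
have cmc s : 0 <= s -> cmod (c s - z0) = s ^+ 48.
  by move=> s0; rewrite /c addrC addKr cmodM u1 mulr1 cmodR ger0_norm // exprn_ge0.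
have ct : c t = w by rewrite /c tE /u mulrCA divff // mulr1 addrC subrK.
have rtc s : 0 <= s -> rt (cmod (c s - z0)) = s ^+ 2.
  move=> s0; rewrite cmc // (_ : 48 = 2 * 24)%N // exprM rt_exp ?exprn_ge0 //.
  by rewrite rtX // exprn_ge0.
have dc s : crd c s ((48 * s ^+ 47)%:C * u).
  have := rdX 47 (is_derive_id s (1 : R)); rewrite mulr1 => d48.
  have E1 x : complex.Re (c x) = complex.Re z0 + complex.Re u * x ^+ 48.
    by rewrite cReD cReM /= mul0r subr0 mulrC.
  have E2 x : complex.Im (c x) = complex.Im z0 + complex.Im u * x ^+ 48.
    by rewrite cImD cImM /= mul0r addr0 mulrC.
  split.
    have -> : (fun s => complex.Re (c s)) = (fun x => complex.Re z0 + complex.Re u * x ^+ 48).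
      by apply/funext.
    have -> : complex.Re ((48 * s ^+ 47)%:C * u) = 0 + complex.Re u * (48 * s ^+ 47).
      by rewrite cReM /= mul0r subr0 add0r mulrC.
    exact: (rdD (is_derive_cst (complex.Re z0) s 1) (rdZ (complex.Re u) d48)).
  have -> : (fun s => complex.Im (c s)) = (fun x => complex.Im z0 + complex.Im u * x ^+ 48).
    by apply/funext.
  have -> : complex.Im ((48 * s ^+ 47)%:C * u) = 0 + complex.Im u * (48 * s ^+ 47).
    by rewrite cImM /= mul0r addr0 add0r mulrC.
  exact: (rdD (is_derive_cst (complex.Im z0) s 1) (rdZ (complex.Im u) d48)).
have key s : 0 < s <= t -> exists2 D, is_derive s 1 (fun x => Theta (G (c x))) D & `|D| <= K.
  move=> /andP[s0 st].
  have cz : c s != z0 by rewrite -subr_eq0 -cmod_gt0 cmc ?exprn_gt0 // ltW.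
  have rs : rt (cmod (c s - z0)) <= rt r / 2.
    apply: le_trans wr; apply: rt_le; first exact: cmod_ge0.
    by rewrite cmc ?(ltW s0) // -/y -tE; apply: lerXn2r => //; rewrite nnegrE ltW.
  have gb := grad_bound r0 rr1 aG cz rs.
  have cr1 : cmod (c s - z0) < r1.
    apply: lt_trans rr1; rewrite ltNge; apply/negP => /(rt_le (ltW r0)) h.
    by have := rt_gt0 r0; move: rs h; lra.
  have dG := derP (G1 _ cz cr1).
  have [D dD DB] := Theta_crd (crd_comp (dc s) dG).
  exists D => //; apply: (le_trans DB); rewrite cmodM (cmodM _ u) u1 mulr1 cmodR.
  have s47 : 0 < s ^+ 47 by rewrite exprn_gt0.
  rewrite ger0_norm; last by rewrite mulr_ge0 // ltW.
  rewrite rtc in gb; last exact: ltW.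
  set Q := cmod (der G (c s)) / _ in gb.
  have Q0 : 0 <= Q by rewrite divr_ge0 ?cmod_ge0 // ltW // Theta_den.
  have sQ0 : 0 <= s ^+ 47 * Q by rewrite mulr_ge0 // ltW.
  have {}gb : (s ^+ 47 * Q) ^+ 2 <= Kgrad r.
    by rewrite exprMn mulrC [(s ^+ 47) ^+ 2]exprAC.
  have := ler_wsqrtr gb; rewrite sqrtr_sqr (ger0_norm sQ0) => sq.
  apply: (@le_trans _ _ (48 * (s ^+ 47 * Q))); last exact: ler_wpM2l.
  by rewrite le_eqVlt; apply/orP; left; apply/eqP; rewrite /Q; ring.
apply/ler_addgt0Pr => e e0.
have [d d0 dP] := limT e e0.
(* The path starts so near to [z0] that [Theta] is within [e] of [T0]; [s ^+ 48 <= s] on the unit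
   interval. *)
pose s1 := Num.min t (Num.min 1 (d / 2)).
have s10 : 0 < s1 by rewrite !lt_min t0 ltr01 divr_gt0.
have : s1 <= s1 by []; rewrite {2}/s1 !le_min => /andP[s1t /andP[s11 s1d]].
have cs1 : cmod (c s1 - z0) < d.
  rewrite cmc ?(ltW s10) // exprS; apply: (@le_lt_trans _ _ s1).
    by rewrite -[leRHS]mulr1 ler_pM2l // exprn_ile1 // ltW.
  by apply: (le_lt_trans s1d); rewrite ltr_pdivrMr // mulrDr mulr1 ltrDr.
have cz1 : c s1 != z0 by rewrite -subr_eq0 -cmod_gt0 cmc ?exprn_gt0 // ltW.
have H1 := dP _ cz1 cs1.
have H2 : `|Theta (G (c t)) - Theta (G (c s1))| <= K * (t - s1).
  have E s : exists D, 0 < s <= t ->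
      is_derive s 1 (fun x => Theta (G (c x))) D /\ `|D| <= K.
    have [/key[D h1 h2]|ns] := boolP (0 < s <= t); first by exists D.
    by exists 0.
  have [dT dTP] := choice E.
  have [|x xI ->] := @real_MVT _ (fun x => Theta (G (c x))) dT s1 t s1t.
    move=> s /andP[h1 h2]; apply: (dTP s _).1.
    by rewrite h2 (lt_le_trans s10).
  rewrite normrM [`|t - s1|]ger0_norm ?subr_ge0 // ler_wpM2r ?subr_ge0 //.
  by apply: (dTP x _).2; case/andP: xI => h1 h2; rewrite h2 (lt_le_trans s10).
rewrite -ct; have := ler_normD (Theta (G (c t)) - Theta (G (c s1))) (Theta (G (c s1)) - T0).
rewrite addrA subrK => H3; apply: (le_trans H3); apply: lerD => //.
by apply: (le_trans H2); apply: ler_wpM2l => //; rewrite gerBl ltW.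
Qed.

End Oscillation.

(** * Meromorphic functions *)

Section Meromorphic.
Variable R : realType.
Notation C := R[i].
Implicit Types (z w : C) (h : C -> C) (f : C -> option C) (D : set C).

(** The point of the sphere with homogeneous coordinates [a : b]. Zeros and poles are then treated
    alike, and equality of values becomes the vanishing of a cross product. *)
Definition oquot (a b : C) : option C := if b == 0 then None else Some (a / b).

Lemma oquot1 a : oquot a 1 = Some a.
Proof. by rewrite /oquot oner_eq0 divr1. Qed.

Lemma oquot_eq a b a' b' : (a != 0) || (b != 0) -> (a' != 0) || (b' != 0) ->
  (oquot a b = oquot a' b') <-> (a * b' = a' * b).
Proof.
rewrite /oquot; have [->|b0] := eqVneq b 0; rewrite ?orbF ?orbT => a0.
  have [->|b0'] := eqVneq b' 0; rewrite ?orbF ?orbT => a0'.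
    by rewrite !mulr0.
  split=> // /eqP; rewrite mulr0 mulf_eq0 (negbTE a0) (negbTE b0') //.
have [->|b0'] := eqVneq b' 0; rewrite ?orbF ?orbT => a0'.
  by split=> // /esym/eqP; rewrite mulr0 mulf_eq0 (negbTE b0) (negbTE a0').
split=> [[E]|E].
  by move/eqP: E; rewrite eqr_div // => /eqP.
by congr Some; apply/eqP; rewrite eqr_div // E.
Qed.

Lemma holomorphic_at_holD h z : holomorphic_at h z <->
  exists2 r, 0 < r & holD h z r.
Proof.
split=> [/nbhsCP[r r0 rP]|[r r0 rP]].
  by exists r => // w /rP /derivableCP.
by apply/nbhsCP; exists r => // w /rP /derivableCP.
Qed.

(** At a pole the reciprocal, completed by 0, is continuous, so the singularity is removable. *)
Lemma mero_cases D f z : meromorphic D f -> D z ->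
  exists r h, [/\ 0 < r, holD h z r &
    (forall w, cmod (w - z) < r -> f w = oquot (h w) 1) \/
    [/\ h z = 0, forall w, w != z -> cmod (w - z) < r -> h w != 0 &
        forall w, cmod (w - z) < r -> f w = oquot 1 (h w)]].
Proof.
move=> mf Dz; case: (mf z Dz) => [[h /holomorphic_at_holD[r r0 hh] /nbhsCP[d d0 dP]]|].
  exists (Num.min r d), h; split; first by rewrite lt_min r0.
    by apply: holD_le hh; rewrite ge_min lexx.
  by left=> w; rewrite lt_min => /andP[_ /dP]; rewrite oquot1.
move=> [fz [h /dnbhsCP[d d0 dP] hoo]].
have [d1 d10 d1P] : exists2 d1, 0 < d1 &
    forall w, w != z -> cmod (w - z) < d1 -> 1 <= cmod (h w).
  by apply/dnbhsCP; move/cvgryPge : hoo; apply.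
pose r := Num.min d d1; have r0 : 0 < r by rewrite lt_min d0.
have hn0 w : w != z -> cmod (w - z) < r -> h w != 0.
  move=> wz; rewrite lt_min => /andP[_ /(d1P w wz) h1].
  by rewrite -cmod_gt0 (lt_le_trans ltr01).
pose k w := if w == z then 0 else (h w)^-1.
have kz : k z = 0 by rewrite /k eqxx.
exists r, k; split=> //.
  apply: removable => //.
    apply/ccontCP => e e0; rewrite kz.
    have [d2 d20 d2P] : exists2 d2, 0 < d2 &
        forall w, w != z -> cmod (w - z) < d2 -> e^-1 + 1 <= cmod (h w).
      by apply/dnbhsCP; move/cvgryPge : hoo; apply.
    exists d2 => // w wd; rewrite subr0 /k; have [_|wz] := eqVneq w z.
      by rewrite cmod0.
    have ei : 0 < e^-1 by rewrite invr_gt0.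
    rewrite cmodV -[ltRHS]invrK ltf_pV2 ?posrE //; have := d2P w wz wd; lra.
  move=> w wz wr; apply: (@eq_near_cder _ (fun w => (h w)^-1)).
    by apply: filterS (near_neqC wz) => v vz; rewrite /k (negbTE vz).
  apply: cderV; first exact: hn0.
  apply/derivableCP; move: wr; rewrite lt_min => /andP[wd _].
  by case: (dP w wz wd).
right; split=> //.
  by move=> w wz wr; rewrite /k (negbTE wz) invr_eq0 hn0.
move=> w wr; rewrite /k; have [->|wz] := eqVneq w z; first by rewrite /oquot eqxx.
rewrite /oquot invr_eq0 (negbTE (hn0 w wz wr)) invrK mul1r.
by move: wr; rewrite lt_min => /andP[/(dP w wz)[]].
Qed.

Lemma zero_multI f z m h r : 0 < r -> holD h z r -> h z != 0 -> (0 < m)%N ->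
  (forall w, cmod (w - z) < r -> f w = Some ((w - z) ^+ m * h w)) ->
  zero_mult f z m.
Proof.
move=> r0 hh h0 m0 fE; split=> //; exists h; split=> //.
  by apply/holomorphic_at_holD; exists r.
by apply/nbhsCP; exists r.
Qed.

Lemma pole_multI f z m h r : 0 < r -> holD h z r -> h z != 0 -> (0 < m)%N ->
  (forall w, cmod (w - z) < r -> f w = oquot 1 ((w - z) ^+ m * h w)) ->
  pole_mult f z m.
Proof.
move=> r0 hh h0 m0 fE; split=> //.
  rewrite fE ?subrr ?cmod0 //; case: (m) m0 => // k _.
  by rewrite expr0n /= mul0r /oquot eqxx.
have [d d0 dP] : exists2 d, 0 < d & forall w, cmod (w - z) < d ->
    h w != 0 /\ cmod (w - z) < r.
  apply/nbhsCP; have zr : cmod (z - z) < r by rewrite subrr cmod0.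
  have /ccontP/(_ (cmod (h z))) := cder_ccont (hh _ zr).
  rewrite cmod_gt0 => /(_ h0) n1; move: n1 (near_disc zr); apply: filterS2 => w h1.
  by split=> //; apply: contraTneq h1 => ->; rewrite sub0r cmodN ltxx.
exists (fun w => (h w)^-1); split.
- apply/holomorphic_at_holD; exists d => // w /dP[w0 wr].
  by apply: cderV => //; exact: hh.
- by rewrite invr_eq0.
apply/dnbhsCP; exists d => // w wz /dP[hw0 wr]; rewrite fE //.
have wz0 : (w - z) ^+ m != 0 by rewrite expf_neq0 // subr_eq0.
by rewrite /oquot mulf_eq0 (negbTE wz0) (negbTE hw0) mul1r invfM mulrC.
Qed.

Lemma nonzero_near h z r : 0 < r -> holD h z r -> h z != 0 ->
  exists2 d, 0 < d & d <= r /\ forall w, cmod (w - z) < d -> h w != 0.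
Proof.
move=> r0 hh h0; have zr : cmod (z - z) < r by rewrite subrr cmod0.
have /ccontCP/(_ (cmod (h z))) := cder_ccont (hh _ zr).
rewrite cmod_gt0 => /(_ h0)[d d0 dP]; exists (Num.min r d).
  by rewrite lt_min r0.
split; first by rewrite ge_min lexx.
move=> w; rewrite lt_min => /andP[_ /dP h1].
by apply: contraTneq h1 => ->; rewrite sub0r cmodN ltxx.
Qed.

(** The points near which [P] holds form an open set, and the alternative makes its complement in
    [D] open as well. This is the identity theorem, stated for a property so that it serves for the
    values 0 and infinity. *)
Lemma dichotomy D (P : C -> Prop) : open D -> connected D ->
  (forall z, D z -> (\forall w \near z, P w) \/ (\forall w \near z^', ~ P w)) ->
  (forall z, D z -> \forall w \near z, P w) \/
  (forall z, D z -> \forall w \near z^', ~ P w).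
Proof.
move=> oD cD alt; pose B := [set z | D z /\ \forall w \near z, P w].
have excl z : (\forall w \near z, P w) -> ~ (\forall w \near z^', ~ P w).
  move=> /nbhsCP[d d0 dP] /dnbhsCP[e e0 eP].
  pose x := Num.min d e / 2.
  have x0 : 0 < x by rewrite divr_gt0 // lt_min d0.
  have xE : cmod (z + x%:C - z) = x by rewrite addrC addKr cmodR gtr0_norm.
  have : x < Num.min d e by rewrite ltr_pdivrMr // mulrDr mulr1 ltrDr lt_min d0.
  rewrite lt_min -xE => /andP[/dP h1 h2]; apply: eP h2 h1.
  by rewrite -subr_eq0 -cmod_gt0 xE.
have [[z0 Bz0]|nB] := pselect (B !=set0).
  left=> z Dz; suff : B = D by move=> E; move: Dz; rewrite -E => -[].
  apply: cD; first by exists z0.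
    by exists (interior P); [exact: open_interior|].
  exists (~` [set z | D z /\ \forall w \near z^', ~ P w]).
    apply: open_closedC; rewrite openE => w [Dw /dnbhsCP[d d0 dP]].
    have [r r0 rP] := openCP oD Dw.
    apply/nbhsCP; exists (Num.min d r); first by rewrite lt_min d0.
    move=> v; rewrite lt_min => /andP[vd /rP Dv]; split=> //.
    apply/dnbhsCP; have [->|vw] := eqVneq v w; first by exists d.
    have : \forall u \near v, u != w /\ cmod (u - w) < d.
      by move: (near_neqC vw) (near_disc vd); apply: filterS2.
    move=> /nbhsCP[e e0 eP]; exists e => // u _ /eP[uw ud]; exact: dP.
  apply/seteqP; split=> [w [Dw Pw]|w [Dw nPw]].
    by split=> // -[_]; exact: excl.
  by split=> //; case: (alt w Dw) => // h; case: nPw.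
by right=> z Dz; case: (alt z Dz) => // h; case: nB; exists z.
Qed.

Lemma mero_zero_alt D f : meromorphic D f -> forall z, D z ->
  (\forall w \near z, f w = Some 0) \/ (\forall w \near z^', ~ f w = Some 0).
Proof.
move=> mf z Dz; have [r [h [r0 hh [fE|[hz hn fE]]]]] := mero_cases mf Dz.
  case: (zero_factor r0 hh) => [h0|[m [k [hk k0 hE]]]].
    left; apply/nbhsCP; exists (r / 3); first exact: divr_gt0.
    by move=> w wr; rewrite fE ?h0 ?oquot1 //; lra.
  right; have [d d0 [dr dP]] := nonzero_near r0 hk k0.
  apply/dnbhsCP; exists d => // w wz wd; rewrite fE ?(lt_le_trans wd) // oquot1 hE.
  case=> /eqP; rewrite mulf_eq0 (negbTE (dP w wd)) orbF expf_eq0 subr_eq0.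
  by rewrite (negbTE wz) andbF.
right; apply/dnbhsCP; exists r => // w wz wr; rewrite fE // /oquot.
rewrite (negbTE (hn w wz wr)) => -[/eqP]; rewrite mul1r invr_eq0.
by rewrite (negbTE (hn w wz wr)).
Qed.

(** The zero or pole at [z0] is separated from the zero-free factors [a] and [b]. As one of [A] and
    [B] is constant, the exponents [m] and [n] are genuine multiplicities when positive. *)
Lemma mero_quot_rep D f z0 : open D -> connected D -> meromorphic D f ->
  ~ (forall z, D z -> f z = Some 0) -> D z0 ->
  exists r A B a b m n, [/\ 0 < r, holD A z0 r /\ holD B z0 r,
   forall w, cmod (w - z0) < r -> f w = oquot (A w) (B w),
   [/\ holD a z0 r, holD b z0 r,
      forall w, cmod (w - z0) < r -> a w != 0 /\ b w != 0 &
      forall w, A w = (w - z0) ^+ m * a w /\ B w = (w - z0) ^+ n * b w] &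
   (A = (fun=> 1) /\ m = 0%N) \/ (B = (fun=> 1) /\ n = 0%N)].
Proof.
move=> oD cD mf nf Dz0.
(* Vanishing near [z0] would spread over all of [D]. *)
have nz : ~ \forall w \near z0, f w = Some 0.
  move=> fz; case: (dichotomy oD cD (mero_zero_alt mf)) => [al|/(_ _ Dz0)].
    by apply: nf => z /al/nbhs_singleton.
  move: fz => /nbhsCP[d d0 dP] /dnbhsCP[e e0 eP].
  pose x := Num.min d e / 2.
  have x0 : 0 < x by rewrite divr_gt0 // lt_min d0.
  have xE : cmod (z0 + x%:C - z0) = x by rewrite addrC addKr cmodR gtr0_norm.
  have : x < Num.min d e by rewrite ltr_pdivrMr // mulrDr mulr1 ltrDr lt_min d0.
  rewrite lt_min -xE => /andP[/dP h1 h2]; apply: eP h2 h1.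
  by rewrite -subr_eq0 -cmod_gt0 xE.
have h1 (s : R) : holD (fun=> 1 : C) z0 s by move=> w _; exact: cder_cst.
have one0 : (1 : C) != 0 by exact: oner_neq0.
have [r [h [r0 hh [fE|[hz hn fE]]]]] := mero_cases mf Dz0.
  case: (zero_factor r0 hh) => [h0|[m [k [hk k0 hE]]]].
    exfalso; apply: nz; apply/nbhsCP; exists (r / 3); first exact: divr_gt0.
    by move=> w wr; rewrite fE ?h0 ?oquot1 //; lra.
  have [d d0 [dr dP]] := nonzero_near r0 hk k0.
  exists d, h, (fun=> 1), k, (fun=> 1), m, 0%N; split=> //.
  - by split=> //; exact: holD_le hh.
  - by move=> w wd; apply: fE; exact: lt_le_trans dr.
  - split=> //; first exact: holD_le hk.
      by move=> w /dP.
    by move=> w; rewrite hE expr0 mul1r.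
  - by right.
case: (zero_factor r0 hh) => [h0|[m [k [hk k0 hE]]]].
  exfalso; pose x := r / 6.
  have x0 : 0 < x by rewrite divr_gt0.
  have xE : cmod (z0 + x%:C - z0) = x by rewrite addrC addKr cmodR gtr0_norm.
  have xz : z0 + x%:C != z0 by rewrite -subr_eq0 -cmod_gt0 xE.
  have xr : cmod (z0 + x%:C - z0) < r by rewrite xE /x; lra.
  have := hn _ xz xr; rewrite h0 ?eqxx // xE /x; lra.
have [d d0 [dr dP]] := nonzero_near r0 hk k0.
exists d, (fun=> 1), h, (fun=> 1), k, 0%N, m; split=> //.
- by split=> //; exact: holD_le hh.
- by move=> w wd; apply: fE; exact: lt_le_trans dr.
- split=> //; first exact: holD_le hk.
    by move=> w /dP.
  by move=> w; rewrite hE expr0 mul1r.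
- by left.
Qed.

End Meromorphic.

(** * The auxiliary function [f / (f - psi)] *)

Section LocalBound.
Variable R : realType.
Notation C := R[i].
Implicit Types (z w : C) (h P Q : C -> C) (f : C -> option C) (D : set C).

Lemma lt_third (x s : R) : 0 < s -> x < s / 3 -> x < s.
Proof. by lra. Qed.
Lemma sixth_lt (s : R) : 0 < s -> s / 6 < s.
Proof. by lra. Qed.
Lemma sixth_lt_third (s : R) : 0 < s -> s / 6 < s / 3.
Proof. by lra. Qed.

(** The quotient [f / (f - psi)] with [psi = a / b], cleared of the denominator [b]; at a pole of
    [f] it takes its limit 1. *)
Definition Gval (o : option C) (a b : C) : C :=
  if o is Some x then x * b / (x * b - a) else 1.

Lemma Gval_oquot p q a b : b != 0 -> (p != 0) || (q != 0) -> p * b - a * q != 0 ->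
  Gval (oquot p q) a b = p * b / (p * b - a * q).
Proof.
move=> b0; rewrite /oquot; have [->|q0] := eqVneq q 0; rewrite ?orbF ?orbT => p0.
  by rewrite mulr0 subr0 /= => ?; rewrite divff.
rewrite /= => h0.
have -> : p / q * b - a = (p * b - a * q) / q by field.
by rewrite invfM invrK; field; rewrite h0 q0.
Qed.

Section Admissible.
Variables (D : set C) (f : C -> option C) (z0 : C) (r : R).
Variables (A B a b : C -> C) (m n : nat).
Hypothesis mf : meromorphic D f.
Hypothesis r0 : 0 < r.
Hypothesis discD : forall w, cmod (w - z0) < r -> D w.
Hypotheses (hA : holD A z0 r) (hB : holD B z0 r).
Hypothesis AB0 : forall w, w != z0 -> cmod (w - z0) < r -> A w != 0 /\ B w != 0.
Hypothesis f_neq : forall w, w != z0 -> cmod (w - z0) < r ->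
  f w <> oquot (A w) (B w).
Hypothesis f_zeros : forall z k, D z -> zero_mult f z k -> (2 <= k)%N.
Hypothesis f_poles : forall z k, D z -> pole_mult f z k -> (3 <= k)%N.

Let G w := Gval (f w) (A w) (B w).

Lemma punctured_disc z : z != z0 -> cmod (z - z0) < r -> exists2 d, 0 < d &
  forall w, cmod (w - z) < d -> w != z0 /\ cmod (w - z0) < r.
Proof.
move=> zz zr; apply/nbhsCP; move: (near_neqC zz) (near_disc zr).
by apply: filterS2.
Qed.

Lemma den_neq0 w p q : w != z0 -> cmod (w - z0) < r -> (p != 0) || (q != 0) ->
  f w = oquot p q -> p * B w - A w * q != 0.
Proof.
move=> wz wr pq fE; rewrite subr_eq0; apply/eqP => E; apply: (f_neq wz wr).
rewrite fE; apply/oquot_eq => //.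
by have [-> _] := AB0 wz wr.
Qed.

Lemma G_oquot w p q : w != z0 -> cmod (w - z0) < r -> (p != 0) || (q != 0) ->
  f w = oquot p q -> G w = p * B w / (p * B w - A w * q).
Proof.
move=> wz wr pq fE; rewrite /G fE Gval_oquot //; first by case: (AB0 wz wr).
exact: den_neq0 fE.
Qed.

(** With homogeneous coordinates [p : q] of [f], [G] is [p * B / (p * B - A * q)] and [G - 1] is
    [A * q / (p * B - A * q)]. Off [z0] the denominator and [A], [B] do not vanish, so zeros and
    1-points of [G] inherit the orders of the zeros and poles of [f]. *)
Lemma admissible_G : admissible z0 r G.
Proof.
split.
- move=> w wz wr; have [s [h [s0 hh alt]]] := mero_cases mf (discD wr).
  have [d d0 dP] := punctured_disc wz wr.
  have e0 : 0 < Num.min s d by rewrite lt_min s0.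
  have ww : cmod (w - w) < Num.min s d by rewrite subrr cmod0.
  have ws : cmod (w - w) < s by rewrite subrr cmod0.
  case: alt => [fE|[hz hn fE]].
    have nz (x : C) : (x != 0) || (1 != 0 :> C) by rewrite oner_neq0 orbT.
    apply: (@eq_near_cder _ (fun w => h w * B w / (h w * B w - A w * 1))).
      apply/nbhsCP; exists (Num.min s d) => // v; rewrite lt_min => /andP[vs /dP[vz vr]].
      by rewrite (@G_oquot v (h v) 1) // fE.
    apply: cder_div.
    - by apply: (@den_neq0 w (h w) 1) => //; exact: fE.
    - by apply: cderM; [exact: hh|exact: hB].
    by apply: cderB; apply: cderM; [exact: hh|exact: hB|exact: hA|exact: cder_cst].
  have nz (x : C) : (1 != 0 :> C) || (x != 0) by rewrite oner_neq0.
  apply: (@eq_near_cder _ (fun w => 1 * B w / (1 * B w - A w * h w))).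
    apply/nbhsCP; exists (Num.min s d) => // v; rewrite lt_min => /andP[vs /dP[vz vr]].
    by rewrite (@G_oquot v 1 (h v)) // fE.
  apply: cder_div.
  - by apply: (@den_neq0 w 1 (h w)) => //; exact: fE.
  - by apply: cderM; [exact: cder_cst|exact: hB].
  by apply: cderB; apply: cderM; [exact: cder_cst|exact: hB|exact: hA|exact: hh].
- move=> z zz zr Gz; have [s [h [s0 hh alt]]] := mero_cases mf (discD zr).
  have [d d0 dP] := punctured_disc zz zr.
  have zs : cmod (z - z) < s by rewrite subrr cmod0.
  have [Az Bz] := AB0 zz zr.
  case: alt => [fE|[hz hn fE]]; last first.
    have nz1 : (1 != 0 :> C) || (h z != 0) by rewrite oner_neq0.
    have := @G_oquot z 1 (h z) zz zr nz1 (fE z zs); rewrite Gz mul1r => /esym/eqP.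
    rewrite mulf_eq0 invr_eq0 (negbTE Bz) /= => /eqP E.
    by have := @den_neq0 z 1 (h z) zz zr nz1 (fE z zs); rewrite mul1r E eqxx.
  have nz (x : C) : (x != 0) || (1 != 0 :> C) by rewrite oner_neq0 orbT.
  have hz : h z = 0.
    have := @G_oquot z (h z) 1 zz zr (nz _) (fE z zs); rewrite Gz => /esym/eqP.
    have := @den_neq0 z (h z) 1 zz zr (nz _) (fE z zs).
    rewrite !mulf_eq0 invr_eq0 => /negbTE->; rewrite orbF (negbTE Bz) orbF.
    by move/eqP.
  case: (zero_factor s0 hh) => [h0|[k [g [hg g0 hE]]]].
    left; apply/nbhsCP; exists (Num.min (s / 3) d); first by rewrite lt_min d0 divr_gt0.
    move=> w; rewrite lt_min => /andP[ws /dP[wz wr]].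
    have ws' : cmod (w - z) < s by exact: lt_third.
    by rewrite (@G_oquot w (h w) 1) ?fE // h0 // !mul0r.
  right; have k0 : (0 < k)%N.
    by case: k hE => // hE; move: hz; rewrite hE mul1r => gz; rewrite gz eqxx in g0.
  have k2 : (2 <= k)%N.
    apply: (@f_zeros z k); first exact: discD.
    apply: (@zero_multI _ _ _ _ g s) => // w ws.
    by rewrite fE // oquot1 hE.
  have e0 : 0 < Num.min s d by rewrite lt_min s0.
  exists k, (fun w => g w * B w / (h w * B w - A w * 1)), (Num.min s d); split=> //.
  + move=> w; rewrite lt_min => /andP[ws /dP[wz wr]].
    apply: cder_div.
    * by apply: (@den_neq0 w (h w) 1) => //; exact: fE.
    * by apply: cderM; [exact: hg|exact: hB].
    by apply: cderB; apply: cderM; [exact: hh|exact: hB|exact: hA|exact: cder_cst].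
  + rewrite !mulf_neq0 // invr_eq0.
    by apply: (@den_neq0 z (h z) 1) => //; exact: fE.
  move=> w; rewrite lt_min => /andP[ws /dP[wz wr]].
  by rewrite (@G_oquot w (h w) 1) ?fE // {1}hE !mulrA.
- move=> z zz zr Gz; have [s [h [s0 hh alt]]] := mero_cases mf (discD zr).
  have [d d0 dP] := punctured_disc zz zr.
  have zs : cmod (z - z) < s by rewrite subrr cmod0.
  have [Az Bz] := AB0 zz zr.
  have G1 w p q : w != z0 -> cmod (w - z0) < r -> (p != 0) || (q != 0) ->
      f w = oquot p q -> G w - 1 = A w * q / (p * B w - A w * q).
    move=> wz wr pq fE; rewrite (G_oquot wz wr pq fE).
    by field; exact: den_neq0 fE.
  case: alt => [fE|[hz hn fE]].
    have nz : (h z != 0) || (1 != 0 :> C) by rewrite oner_neq0 orbT.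
    have := @G1 z (h z) 1 zz zr nz (fE z zs); rewrite Gz subrr => /esym/eqP.
    have := @den_neq0 z (h z) 1 zz zr nz (fE z zs).
    by rewrite !mulf_eq0 invr_eq0 => /negbTE->; rewrite (negbTE Az) oner_eq0.
  have nz (x : C) : (1 != 0 :> C) || (x != 0) by rewrite oner_neq0.
  right; case: (zero_factor s0 hh) => [h0|[k [g [hg g0 hE]]]].
    exfalso; pose x := s / 6.
    have x0 : 0 < x by rewrite divr_gt0.
    have xE : cmod (z + x%:C - z) = x by rewrite addrC addKr cmodR gtr0_norm.
    have xz : z + x%:C != z by rewrite -subr_eq0 -cmod_gt0 xE.
    have xr : cmod (z + x%:C - z) < s by rewrite xE sixth_lt.
    by have := hn _ xz xr; rewrite h0 ?eqxx // xE sixth_lt_third.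
  have k0 : (0 < k)%N.
    by case: k hE => // hE; move: hz; rewrite hE mul1r => gz; rewrite gz eqxx in g0.
  have k3 : (3 <= k)%N.
    apply: (@f_poles z k); first exact: discD.
    apply: (@pole_multI _ _ _ _ g s) => // w ws.
    by rewrite fE // hE.
  have e0 : 0 < Num.min s d by rewrite lt_min s0.
  exists k, (fun w => A w * g w / (1 * B w - A w * h w)), (Num.min s d); split=> //.
  + move=> w; rewrite lt_min => /andP[ws /dP[wz wr]].
    apply: cder_div.
    * by apply: (@den_neq0 w 1 (h w)) => //; exact: fE.
    * by apply: cderM; [exact: hA|exact: hg].
    by apply: cderB; apply: cderM; [exact: cder_cst|exact: hB|exact: hA|exact: hh].
  + rewrite !mulf_neq0 // invr_eq0.
    by apply: (@den_neq0 z 1 (h z)) => //; exact: fE.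
  move=> w; rewrite lt_min => /andP[ws /dP[wz wr]].
  rewrite (@G1 w 1 (h w)) ?fE // [X in A w * X / _]hE.
  by rewrite [A w * (_ * _)]mulrCA -!mulrA.
have z0r : cmod (z0 - z0) < r by rewrite subrr cmod0.
have [s [h [s0 hh alt]]] := mero_cases mf (discD z0r).
(* Homogeneous coordinates of [f] near [z0]: [h : 1] or [1 : h], according to the alternative. *)
pose P w := if pselect (forall w, cmod (w - z0) < s -> f w = oquot (h w) 1) then h w else 1.
pose Q w := if pselect (forall w, cmod (w - z0) < s -> f w = oquot (h w) 1) then 1 else h w.
have [fE hP hQ PQ] : [/\ forall w, cmod (w - z0) < s -> f w = oquot (P w) (Q w),
    holD P z0 s, holD Q z0 s & forall w, (P w != 0) || (Q w != 0)].
  rewrite /P /Q; case: pselect => [fE|nfE].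
    by split=> //; [move=> w _; exact: cder_cst|move=> w; rewrite oner_neq0 orbT].
  case: alt => [//|[hz hn fE]].
  by split=> //; [move=> w _; exact: cder_cst|move=> w; rewrite oner_neq0].
pose t := Num.min s r; have t0 : 0 < t by rewrite lt_min s0.
have ts : t <= s by rewrite ge_min lexx.
have tr : t <= r by rewrite ge_min lexx orbT.
pose N w := P w * B w; pose M w := P w * B w - A w * Q w.
have hN : holD N z0 t.
  move=> w wt; apply: cderM; [exact: hP (lt_le_trans wt ts)|].
  exact: hB (lt_le_trans wt tr).
have hM : holD M z0 t.
  move=> w wt; apply: cderB; first exact: hN.
  by apply: cderM; [exact: hA (lt_le_trans wt tr)|exact: hQ (lt_le_trans wt ts)].
have GE w : w != z0 -> cmod (w - z0) < t -> G w = N w / M w.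
  move=> wz wt; apply: G_oquot => //; first exact: lt_le_trans tr.
  by apply: fE; exact: lt_le_trans ts.
have M0 w : w != z0 -> cmod (w - z0) < t -> M w != 0.
  move=> wz wt; apply: den_neq0 => //; first exact: lt_le_trans tr.
  by apply: fE; exact: lt_le_trans ts.
case: (zero_factor t0 hM) => [Mz|[kM [gM [hgM gM0 ME]]]].
  exfalso; pose x := t / 6.
  have x0 : 0 < x by rewrite divr_gt0.
  have xE : cmod (z0 + x%:C - z0) = x by rewrite addrC addKr cmodR gtr0_norm.
  have xz : z0 + x%:C != z0 by rewrite -subr_eq0 -cmod_gt0 xE.
  have xr : cmod (z0 + x%:C - z0) < t by rewrite xE sixth_lt.
  by have := M0 _ xz xr; rewrite Mz ?eqxx // xE sixth_lt_third.
case: (zero_factor t0 hN) => [Nz|[kN [gN [hgN gN0 NE]]]].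
  left; exists (fun=> 0), (t / 3); split; first exact: divr_gt0.
    by move=> w _; exact: cder_cst.
  move=> w wz wt; rewrite GE ?Nz ?mul0r //; exact: lt_third.
have [d d0 [dt dP]] := nonzero_near t0 hgM gM0.
have hq : holD (fun w => gN w / gM w) z0 d.
  move=> w wd; apply: cder_div; first exact: dP.
    by apply: hgN; exact: lt_le_trans dt.
  by apply: hgM; exact: lt_le_trans dt.
have z0d : cmod (z0 - z0) < d by rewrite subrr cmod0.
(* Numerator and denominator may both vanish at [z0]; their orders decide between a holomorphic
   extension and a pole. *)
have [kk|kk] := leqP kM kN.
  left; exists (fun w => (w - z0) ^+ (kN - kM) * (gN w / gM w)), d; split=> //.
    move=> w wd; apply: cderM; last exact: hq.
    by apply: cderX; apply: cderB; [exact: cder_id|exact: cder_cst].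
  move=> w wz wd; rewrite GE ?(lt_le_trans wd) // NE ME.
  have wz0 : (w - z0) ^+ kM != 0 by rewrite expf_neq0 // subr_eq0.
  have gw := dP w wd.
  rewrite -{1}(subnK kk) exprD; move: ((w - z0) ^+ (kN - kM)) => y.
  by field; rewrite wz0 gw.
right; exists (kM - kN).-1, (fun w => gN w / gM w), d; split=> //.
  by rewrite mulf_neq0 ?invr_eq0.
have kp : (0 < kM - kN)%N by rewrite subn_gt0.
move=> w wz wd; rewrite GE ?(lt_le_trans wd) // NE ME prednK //.
have wz0 k : (w - z0) ^+ k != 0 by rewrite expf_neq0 // subr_eq0.
have gw := dP w wd.
rewrite -{1}(subnK (ltnW kk)) exprD.
move: (wz0 (kM - kN)%N) (wz0 kN); move: ((w - z0) ^+ _) ((w - z0) ^+ _) => y y' y0 y0'.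
by field; rewrite y0 y0' gw.
Qed.

End Admissible.
End LocalBound.

(** * Local boundedness of the family *)

Section LocallyBounded.
Variable R : realType.
Notation C := R[i].
Implicit Types (z w : C) (h A B b : C -> C) (f : C -> option C) (D : set C).

(** Disc and bound are common to the family, while each member chooses whether itself or its
    reciprocal is bounded. *)
Definition locally_bounded (F : set (C -> option C)) z0 :=
  exists r M : R, 0 < r /\ forall f, F f ->
    (exists2 h, holD h z0 r & forall w, cmod (w - z0) < r ->
       f w = oquot (h w) 1 /\ cmod (h w) <= M) \/
    (exists2 h, holD h z0 r & forall w, cmod (w - z0) < r ->
       f w = oquot 1 (h w) /\ cmod (h w) <= M).

(** The radius [d] depends on [r] alone, which makes the later bounds uniform in [f]. *)
Lemma osc_small (r : R) : 0 < r -> exists2 d, 0 < d & forall y, 0 <= y -> y < d ->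
  rt y <= rt r / 2 /\ 48 * Num.sqrt (Kgrad r) * Num.sqrt (rt y) <= 1 / 4.
Proof.
move=> r0; set K := 48 * Num.sqrt (Kgrad r).
have K0 : 0 <= K by rewrite mulr_ge0 ?sqrtr_ge0.
have K1 : 0 < 4 * (K + 1) by lra.
pose e := (4 * (K + 1))^-1; have e0 : 0 < e by rewrite invr_gt0.
pose t := Num.min (rt r / 2) (e ^+ 2).
have t0 : 0 < t by rewrite lt_min divr_gt0 ?rt_gt0 //= exprn_gt0.
exists (t ^+ 24); first exact: exprn_gt0.
move=> y y0 /ltW yt; have := rt_le_pow (ltW t0) y0 yt.
rewrite le_min => /andP[h1 h2]; split=> //.
have h3 : Num.sqrt (rt y) <= e.
  by rewrite -[e]gtr0_norm // -sqrtr_sqr; apply: ler_wsqrtr.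
apply: (@le_trans _ _ (K * e)); first exact: ler_wpM2l.
by rewrite /e ler_pdivrMr // mul1r; lra.
Qed.

(** At [z0] the factor [B] may vanish and the inequality is then void, but at distance at least
    [d / 3] it bounds [h], and Cauchy's formula carries the bound inside. The factor 4 is
    [2 * (d / 3)] divided by [d / 6]. *)
Lemma annulus_bound (z0 : C) (d MA c : R) (n : nat) h A B b :
  0 < d -> 0 < c -> holD h z0 d ->
  (forall w, w != z0 -> cmod (w - z0) < d -> cmod (h w) * cmod (B w) <= 2 * cmod (A w)) ->
  (forall w, cmod (w - z0) < d -> cmod (A w) <= MA /\ c <= cmod (b w)) ->
  (forall w, B w = (w - z0) ^+ n * b w) ->
  forall w, cmod (w - z0) < d / 6 -> cmod (h w) <= 4 * (2 * MA / ((d / 3) ^+ n * c)).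
Proof.
move=> d0 c0 hh hAB bd BE w wd.
have d30 : 0 < d / 3 by rewrite divr_gt0.
have q0 : 0 < (d / 3) ^+ n * c by rewrite mulr_gt0 ?exprn_gt0.
set M1 := 2 * MA / _.
have ann u : d / 3 <= cmod (u - z0) -> cmod (u - z0) < d -> cmod (h u) <= M1.
  move=> u3 ud; have u0 := lt_le_trans d30 u3.
  have uz : u != z0 by rewrite -subr_eq0 -cmod_gt0.
  have [AM bc] := bd u ud; rewrite /M1 ler_pdivlMr //.
  apply: (@le_trans _ _ (cmod (h u) * cmod (B u))).
    rewrite ler_wpM2l ?cmod_ge0 // BE cmodM cmodX; apply: ler_pM => //.
    - by rewrite exprn_ge0 // ltW.
    - exact: ltW.
    by apply: lerXn2r; rewrite ?nnegrE ?cmod_ge0 // ltW.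
  by apply: (le_trans (hAB u uz ud)); rewrite ler_pM2l.
have wd3 : cmod (w - z0) < d / 3 by exact: lt_trans (sixth_lt_third d0).
apply: (le_trans (cauchy_bound d0 hh ann wd3)).
have M10 : 0 <= M1.
  have E : cmod (z0 + (d / 2)%:C - z0) = d / 2.
    by rewrite addrC addKr cmodR gtr0_norm // divr_gt0.
  by apply: (le_trans (cmod_ge0 (h (z0 + (d / 2)%:C)))); apply: ann; rewrite E; lra.
rewrite mulrA ler_pdivrMr ?subr_gt0 //.
have : d / 6 <= d / 3 - cmod (w - z0) by lra.
move: (d / 3 - cmod (w - z0)) => y dy.
have h4 : 0 <= 4 * M1 by rewrite mulr_ge0.
apply: le_trans (ler_wpM2l h4 dy).
by clearbody M1; rewrite le_eqVlt; apply/orP; left; apply/eqP; field.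
Qed.

(** Divided by [(w - z0) ^+ n], the inequality would give [b z0 = 0] in the limit. Here the
    multiplicity of [f] being strictly larger than that of [psi] takes effect. *)
Lemma center_contra (z0 : C) (d : R) (n k : nat) A B b h g :
  0 < d -> (n < k)%N -> ccont b z0 -> b z0 != 0 -> ccont A z0 -> ccont g z0 ->
  (forall w, B w = (w - z0) ^+ n * b w) -> (forall w, h w = (w - z0) ^+ k * g w) ->
  (forall w, w != z0 -> cmod (w - z0) < d -> cmod (B w) <= 2 * (cmod (A w) * cmod (h w))) ->
  False.
Proof.
move=> d0 nk cb b0 cA cg BE hE le.
pose q w := 2 * (A w * ((w - z0) ^+ (k - n) * g w)).
have cq : ccont q z0.
  apply: ccontM; first exact: ccont_cst.
  apply: ccontM => //; apply: ccontM => //; apply: ccontX.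
  by apply: ccontB; [exact: ccont_id|exact: ccont_cst].
have q0 : q z0 = 0.
  rewrite /q subrr; case: (k - n)%N (subn_gt0 n k) => [|j _].
    by rewrite nk.
  by rewrite expr0n /= !(mul0r, mulr0).
have e0 : 0 < cmod (b z0) / 2 by rewrite divr_gt0 // cmod_gt0.
have /ccontCP/(_ _ e0)[d1 d10 d1P] := cb; have /ccontCP/(_ _ e0)[d2 d20 d2P] := cq.
pose x := Num.min d (Num.min d1 d2) / 2.
have x0 : 0 < x by rewrite divr_gt0 // !lt_min d0 d10.
have xE : cmod (z0 + x%:C - z0) = x by rewrite addrC addKr cmodR gtr0_norm.
have : x < Num.min d (Num.min d1 d2).
  by rewrite ltr_pdivrMr // mulrDr mulr1 ltrDr !lt_min d0 d10.
have xz : z0 + x%:C != z0 by rewrite -subr_eq0 -cmod_gt0 xE.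
rewrite !lt_min -xE => /andP[/(le _ xz) h1 /andP[/d1P h2 /d2P h3]].
move: h3; rewrite q0 subr0 => h3.
set w := z0 + x%:C in xE xz h1 h2 h3.
have wn : 0 < cmod (w - z0) ^+ n by rewrite exprn_gt0 // xE.
have : cmod (b w) <= cmod (q w).
  rewrite -(ler_pM2l wn) -cmodX -cmodM -BE; apply: (le_trans h1).
  rewrite /q hE -{1}(subnK (ltnW nk)) exprD !cmodM.
  have -> : cmod (2 : C) = 2 by rewrite -(rmorph_nat (real_complex R)) cmodR ger0_norm.
  by rewrite le_eqVlt; apply/orP; left; apply/eqP; ring.
have := cmod_sub_le (b z0) (b w); rewrite cmodB.
by move: h2 h3; lra.
Qed.

Lemma Theta_ratio (p q a b : C) : p * b - a * q != 0 ->
  Theta (p * b / (p * b - a * q)) =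
  (cmod p * cmod b) ^+ 2 / ((cmod p * cmod b) ^+ 2 + (cmod a * cmod q) ^+ 2).
Proof.
move=> m0; rewrite /Theta.
have -> : p * b / (p * b - a * q) - 1 = a * q / (p * b - a * q) by field.
have c0 : cmod (p * b - a * q) != 0 by rewrite cmod_eq0.
have den := Theta_den (p * b / (p * b - a * q)).
rewrite !cmodM !cmodV !exprMn !exprVn.
have : (cmod p) ^+ 2 * (cmod b) ^+ 2 + (cmod a) ^+ 2 * (cmod q) ^+ 2 != 0.
  rewrite gt_eqF //; rewrite -!exprMn -!cmodM lt_def addr_ge0 ?sqr_ge0 // andbT.
  rewrite paddr_eq0 ?sqr_ge0 // !sqrf_eq0 !cmod_eq0; apply/negP => /andP[/eqP E1 /eqP E2].
  by rewrite E1 E2 subrr eqxx in m0.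
move: (cmod (p * b - a * q)) c0 => y y0.
move: ((cmod p) ^+ 2 * (cmod b) ^+ 2) ((cmod a) ^+ 2 * (cmod q) ^+ 2) => x x' xx.
by field; rewrite y0 xx.
Qed.

Lemma ratio_le (x y : R) : 0 <= x -> 0 <= y -> 0 < x ^+ 2 + y ^+ 2 ->
  x ^+ 2 / (x ^+ 2 + y ^+ 2) <= 3 / 4 -> x <= 2 * y.
Proof.
move=> x0 y0 d0; rewrite ler_pdivrMr // => h.
rewrite -(@ler_pXn2r _ 2) ?nnegrE ?mulr_ge0 // exprMn; move: (x ^+ 2) (y ^+ 2) h (sqr_ge0 y).
by move=> X Y h Y0; lra.
Qed.

Lemma ratio_ge (x y : R) : 0 <= x -> 0 <= y -> 0 < x ^+ 2 + y ^+ 2 ->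
  1 / 4 <= x ^+ 2 / (x ^+ 2 + y ^+ 2) -> y <= 2 * x.
Proof.
move=> x0 y0 d0; rewrite ler_pdivlMr // => h.
rewrite -(@ler_pXn2r _ 2) ?nnegrE ?mulr_ge0 // exprMn; move: (x ^+ 2) (y ^+ 2) h (sqr_ge0 x).
by move=> X Y h X0; lra.
Qed.

Lemma near_cmod_ge_half h z : ccont h z -> h z != 0 ->
  \forall w \near z, cmod (h z) / 2 <= cmod (h w).
Proof.
move=> /ccontP ch h0; have e0 : 0 < cmod (h z) / 2 by rewrite divr_gt0 // cmod_gt0.
apply: filterS (ch _ e0) => w; have := cmod_sub_le (h z) (h w); rewrite cmodB; lra.
Qed.

Variables (D : set C) (F : set (C -> option C)) (psi : C -> option C).
Hypothesis domD : domain D.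
Hypothesis merF : forall f, F f -> meromorphic D f.
Hypothesis merpsi : meromorphic D psi.
Hypothesis psi_neq0 : ~ (forall z, D z -> psi z = Some 0).
Hypothesis zeros_ge2 : forall f, F f -> forall z m, D z ->
  zero_mult f z m -> (2 <= m)%N.
Hypothesis poles_ge3 : forall f, F f -> forall z m, D z ->
  pole_mult f z m -> (3 <= m)%N.
Hypothesis common_zeros : forall f, F f -> forall z m n, D z ->
  zero_mult f z m -> zero_mult psi z n -> (n < m)%N.
Hypothesis common_poles : forall f, F f -> forall z m n, D z ->
  pole_mult f z m -> pole_mult psi z n -> (n < m)%N.
Hypothesis sharepsi : forall f g, F f -> F g -> share D f g psi.

Lemma share_eq f g z : F f -> F g -> D z -> f z = psi z -> g z = psi z.
Proof.
move=> Ff Fg Dz fz; have := sharepsi Ff Fg; rewrite /share => E.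
have : [set z | D z /\ f z = psi z] z by [].
by rewrite E => -[].
Qed.

Section AtPoint.
Variables (z0 : C) (r : R) (A B a b : C -> C) (m n : nat).
Hypothesis r0 : 0 < r.
Hypothesis discD : forall w, cmod (w - z0) < r -> D w.
Hypotheses (hA : holD A z0 r) (hB : holD B z0 r).
Hypothesis psiE : forall w, cmod (w - z0) < r -> psi w = oquot (A w) (B w).
Hypotheses (ha : holD a z0 r) (hb : holD b z0 r).
Hypothesis ab0 : forall w, cmod (w - z0) < r -> a w != 0 /\ b w != 0.
Hypothesis AE : forall w, A w = (w - z0) ^+ m * a w.
Hypothesis BE : forall w, B w = (w - z0) ^+ n * b w.
Hypothesis alt : (A = (fun=> 1) /\ m = 0%N) \/ (B = (fun=> 1) /\ n = 0%N).

Let z0r : cmod (z0 - z0) < r. Proof. by rewrite subrr cmod0. Qed.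

Lemma AB_neq0 w : w != z0 -> cmod (w - z0) < r -> A w != 0 /\ B w != 0.
Proof.
move=> wz wr; have [a0 b0] := ab0 wr; rewrite AE BE.
by rewrite !mulf_neq0 // expf_neq0 // subr_eq0.
Qed.

Lemma nz_any w : (A w != 0) || (B w != 0).
Proof. by case: alt => [[-> _]|[-> _]]; rewrite oner_neq0 ?orbT. Qed.

(** Since [psi] is shared, every member equals [psi] as soon as one does, and the local
    representation of [psi] bounds them all. *)
Lemma bounded_if_equal f0 (d : R) : F f0 -> 0 < d -> d <= r ->
  (forall w, cmod (w - z0) < d -> f0 w = psi w) -> locally_bounded F z0.
Proof.
move=> Ff0 d0 dr f0E.
have allE f : F f -> forall w, cmod (w - z0) < d -> f w = oquot (A w) (B w).
  move=> Ff w wd; have wr := lt_le_trans wd dr.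
  by rewrite -psiE //; apply: (share_eq Ff0 Ff (discD wr)); exact: f0E.
have cA := near_bound_cont (ccont_cmod (cder_ccont (hA z0r))).
have cB := near_bound_cont (ccont_cmod (cder_ccont (hB z0r))).
have [e e0 eP] : exists2 e, 0 < e & forall w, cmod (w - z0) < e ->
   cmod (A w) <= cmod (A z0) + 1 /\ cmod (B w) <= cmod (B z0) + 1.
  by apply/nbhsCP; move: cA cB; apply: filterS2.
have t0 : 0 < Num.min d e by rewrite lt_min d0.
have td : Num.min d e <= d by rewrite ge_min lexx.
have tr := le_trans td dr.
case: alt => [[A1 _]|[B1 _]].
  exists (Num.min d e), (cmod (B z0) + 1); split=> // f /allE fE; right.
  exists B; first exact: holD_le hB.
  by move=> w; rewrite lt_min => /andP[wd /eP[_ ?]]; rewrite fE // A1.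
exists (Num.min d e), (cmod (A z0) + 1); split=> // f /allE fE; left.
exists A; first exact: holD_le hA.
by move=> w; rewrite lt_min => /andP[wd /eP[? _]]; rewrite fE // B1.
Qed.

Hypothesis neq : forall f, F f -> forall w, w != z0 -> cmod (w - z0) < r ->
  f w <> psi w.

Lemma f_cases f z : F f -> D z -> exists s h, [/\ 0 < s, holD h z s &
    (forall w, cmod (w - z) < s -> f w = oquot (h w) 1) \/
    [/\ h z = 0, forall w, w != z -> cmod (w - z) < s -> h w != 0 &
        forall w, cmod (w - z) < s -> f w = oquot 1 (h w)]].
Proof. by move=> Ff Dz; exact: mero_cases (merF Ff) Dz. Qed.

(** Off [z0] a pole of [f] would make [B] vanish, by the inequality with [p = 1] and [q = 0]. At
    [z0] a pole of [f] would have larger order than that of [psi], which the inequality excludes in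
    the limit. *)
Lemma finite_case f (d : R) : F f -> 0 < d -> d <= r ->
  (forall w p q, w != z0 -> cmod (w - z0) < d -> (p != 0) || (q != 0) ->
    f w = oquot p q -> cmod p * cmod (B w) <= 2 * (cmod (A w) * cmod q)) ->
  exists2 h, holD h z0 d &
    (forall w, cmod (w - z0) < d -> f w = oquot (h w) 1) /\
    forall w, w != z0 -> cmod (w - z0) < d ->
      cmod (h w) * cmod (B w) <= 2 * cmod (A w).
Proof.
move=> Ff d0 dr le.
have one0 : (1 : C) != 0 by exact: oner_neq0.
have z0d : cmod (z0 - z0) < d by rewrite subrr cmod0.
have fin w : cmod (w - z0) < d -> f w <> None.
  move=> wd; have wr := lt_le_trans wd dr; have [wE|wz] := eqVneq w z0; last first.
    move=> fw; have := le w 1 0 wz wd; rewrite one0 /oquot eqxx => /(_ isT fw).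
    rewrite cmod1 cmod0 mulr0 mulr0 mul1r leNgt cmod_gt0.
    by have [_ ->] := AB_neq0 wz wr.
  move: wd wr; rewrite {}wE => {w} wd wr fz.
  have [s [h [s0 hh [fE|[hz hn fE]]]]] := f_cases Ff (discD wr).
    by move: fz; rewrite fE ?subrr ?cmod0 // oquot1.
  case: (zero_factor s0 hh) => [h0|[k [g [hg g0 hE]]]].
    pose x := s / 6.
    have x0 : 0 < x by rewrite divr_gt0.
    have xE : cmod (z0 + x%:C - z0) = x by rewrite addrC addKr cmodR gtr0_norm.
    have xz : z0 + x%:C != z0 by rewrite -subr_eq0 -cmod_gt0 xE.
    have xr : cmod (z0 + x%:C - z0) < s by rewrite xE sixth_lt.
    by have := hn _ xz xr; rewrite h0 ?eqxx // xE sixth_lt_third.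
  have k0 : (0 < k)%N.
    by case: k hE => // hE; move: hz; rewrite hE mul1r => gz; rewrite gz eqxx in g0.
  (* For [n = 0] this is [k0]; otherwise [A] is the constant 1 and [psi] has a pole of order [n]. *)
  have nk : (n < k)%N.
    have [->//|n0] := posnP n.
    case: alt => [[A1 _]|[_ n1]]; last by rewrite n1 in n0.
    apply: (common_poles Ff (discD z0r)).
      by apply: (@pole_multI _ _ _ _ g s) => // w ws; rewrite fE // hE.
    apply: (@pole_multI _ _ _ _ b r) => //; first by have [_] := ab0 z0r.
    by move=> w ws; rewrite psiE // A1 BE.
  have m0 : 0 < Num.min s d by rewrite lt_min s0.
  have zs : cmod (z0 - z0) < s by rewrite subrr cmod0.
  apply: (@center_contra z0 (Num.min s d) n k A B b h g) => //.
  - exact: cder_ccont (hb z0r).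
  - by have [_] := ab0 z0r.
  - exact: cder_ccont (hA z0r).
  - exact: cder_ccont (hg _ zs).
  move=> w wz; rewrite lt_min => /andP[ws wd'].
  have := le w 1 (h w) wz wd'; rewrite one0 cmod1 mul1r; apply=> //.
  exact: fE.
exists (fun w => odflt 0 (f w)).
  move=> w wd; have wr := lt_le_trans wd dr.
  have [s [h [s0 hh [fE|[hz hn fE]]]]] := f_cases Ff (discD wr).
    apply: (@eq_near_cder _ h); last by apply: hh; rewrite subrr cmod0.
    by apply/nbhsCP; exists s => // v /fE ->; rewrite oquot1.
  by have := fin w wd; rewrite fE ?subrr ?cmod0 // hz /oquot eqxx.
have fE w : cmod (w - z0) < d -> f w = oquot (odflt 0 (f w)) 1.
  by move=> /fin; case: (f w) => // x _; rewrite oquot1.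
split=> // w wz wd.
have := le w (odflt 0 (f w)) 1 wz wd; rewrite one0 orbT cmod1 mulr1; apply=> //.
exact: fE.
Qed.

(** The previous argument for the reciprocals of [f] and [psi]: [A] and [B] are exchanged, and so
    are zeros and poles. Moreover [f] could vanish identically near [z0], which the inequality rules
    out at a nearby point. *)
Lemma infinite_case f (d : R) : F f -> 0 < d -> d <= r ->
  (forall w p q, w != z0 -> cmod (w - z0) < d -> (p != 0) || (q != 0) ->
    f w = oquot p q -> cmod (A w) * cmod q <= 2 * (cmod p * cmod (B w))) ->
  exists2 h, holD h z0 d &
    (forall w, cmod (w - z0) < d -> f w = oquot 1 (h w)) /\
    forall w, w != z0 -> cmod (w - z0) < d ->
      cmod (h w) * cmod (A w) <= 2 * cmod (B w).
Proof.
move=> Ff d0 dr le.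
have one0 : (1 : C) != 0 by exact: oner_neq0.
have z0d : cmod (z0 - z0) < d by rewrite subrr cmod0.
have fin w : cmod (w - z0) < d -> f w <> Some 0.
  move=> wd; have wr := lt_le_trans wd dr; have [wE|wz] := eqVneq w z0; last first.
    move=> fw; have := le w 0 1 wz wd; rewrite one0 orbT oquot1 => /(_ isT fw).
    rewrite cmod1 cmod0 mul0r mulr0 mulr1 leNgt cmod_gt0.
    by have [-> _] := AB_neq0 wz wr.
  move: wd wr; rewrite {}wE => {w} wd wr fz.
  have [s [h [s0 hh [fE|[hz hn fE]]]]] := f_cases Ff (discD wr); last first.
    by move: fz; rewrite fE ?subrr ?cmod0 // hz /oquot eqxx.
  have zs : cmod (z0 - z0) < s by rewrite subrr cmod0.
  have hz : h z0 = 0 by move: fz; rewrite fE // oquot1 => -[].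
  have sd0 : 0 < Num.min s d by rewrite lt_min s0.
  case: (zero_factor s0 hh) => [h0|[k [g [hg g0 hE]]]].
    pose x := Num.min s d / 6.
    have x0 : 0 < x by rewrite divr_gt0.
    have xE : cmod (z0 + x%:C - z0) = x by rewrite addrC addKr cmodR gtr0_norm.
    have xz : z0 + x%:C != z0 by rewrite -subr_eq0 -cmod_gt0 xE.
    have : x < Num.min s d by rewrite sixth_lt.
    rewrite lt_min => /andP[xs xd].
    have x3 : cmod (z0 + x%:C - z0) < s / 3.
      rewrite xE; apply: (lt_le_trans (sixth_lt_third sd0)).
      by rewrite ler_pM2r // ge_min lexx.
    have xd' : cmod (z0 + x%:C - z0) < d by rewrite xE.
    have := le _ (h (z0 + x%:C)) 1 xz xd'; rewrite one0 orbT fE ?xE // => /(_ isT erefl).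
    rewrite h0 // cmod1 cmod0 mul0r mulr0 mulr1 leNgt cmod_gt0.
    by have [-> _] := AB_neq0 xz (lt_le_trans xd' dr).
  have k0 : (0 < k)%N.
    by case: k hE => // hE; move: hz; rewrite hE mul1r => gz; rewrite gz eqxx in g0.
  have mk : (m < k)%N.
    have [->//|m0] := posnP m.
    case: alt => [[_ m1]|[B1 _]]; first by rewrite m1 in m0.
    apply: (common_zeros Ff (discD z0r)).
      by apply: (@zero_multI _ _ _ _ g s) => // w ws; rewrite fE // oquot1 hE.
    apply: (@zero_multI _ _ _ _ a r) => //; first by have [] := ab0 z0r.
    by move=> w ws; rewrite psiE // B1 oquot1 AE.
  apply: (@center_contra z0 (Num.min s d) m k B A a h g) => //.
  - exact: cder_ccont (ha z0r).
  - by have [] := ab0 z0r.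
  - exact: cder_ccont (hB z0r).
  - exact: cder_ccont (hg _ zs).
  move=> w wz; rewrite lt_min => /andP[ws wd'].
  have := le w (h w) 1 wz wd'; rewrite one0 orbT cmod1 mulr1 [cmod (B w) * _]mulrC.
  by apply=> //; exact: fE.
pose inv w := if f w is Some x then x^-1 else 0.
exists inv.
  move=> w wd; have wr := lt_le_trans wd dr.
  have [s [h [s0 hh [fE|[hz hn fE]]]]] := f_cases Ff (discD wr).
    have ws : cmod (w - w) < s by rewrite subrr cmod0.
    have hw0 : h w != 0.
      by apply/eqP => hw; apply: (fin w wd); rewrite fE // hw oquot1.
    apply: (@eq_near_cder _ (fun w => (h w)^-1)).
      by apply/nbhsCP; exists s => // v vs; rewrite /inv fE // oquot1.
    by apply: cderV => //; exact: hh.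
  apply: (@eq_near_cder _ h); last by apply: hh; rewrite subrr cmod0.
  apply/nbhsCP; exists s => // v vs; rewrite /inv fE // /oquot.
  by have [->//|hv] := eqVneq (h v) 0; rewrite mul1r invrK.
have fE w : cmod (w - z0) < d -> f w = oquot 1 (inv w).
  move=> /fin; rewrite /inv /oquot; case: (f w) => [x|]; last by rewrite eqxx.
  have [->//|x0 _] := eqVneq x 0.
  by rewrite invr_eq0 (negbTE x0) mul1r invrK.
split=> // w wz wd.
have := le w 1 (inv w) wz wd; rewrite one0 cmod1 mul1r [_ * cmod (A w)]mulrC; apply=> //.
exact: fE.
Qed.

Lemma bounded_if_neq : locally_bounded F z0.
Proof.
(* The comparison disc has radius [r / 2], and [r] provides the margin around it. *)
have r2 : 0 < r / 2 by rewrite divr_gt0.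
have r2r : r / 2 < r by rewrite ltr_pdivrMr // mulrDr mulr1 ltrDr.
have [d1 d10 d1P] := osc_small r2.
have [a0 b0] := ab0 z0r.
have cA := near_bound_cont (ccont_cmod (cder_ccont (hA z0r))).
have cB := near_bound_cont (ccont_cmod (cder_ccont (hB z0r))).
have ca := near_cmod_ge_half (cder_ccont (ha z0r)) a0.
have cb := near_cmod_ge_half (cder_ccont (hb z0r)) b0.
have [e e0 eP] : exists2 e, 0 < e & forall w, cmod (w - z0) < e ->
   (cmod (A w) <= cmod (A z0) + 1 /\ cmod (b z0) / 2 <= cmod (b w)) /\
   (cmod (B w) <= cmod (B z0) + 1 /\ cmod (a z0) / 2 <= cmod (a w)).
  apply/nbhsCP; near=> w; split; split; near: w.
  - exact: cA.
  - exact: cb.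
  - exact: cB.
  - exact: ca.
pose d := Num.min (Num.min d1 e) r.
have d0 : 0 < d by rewrite !lt_min d10 e0.
have dr : d <= r by rewrite ge_min lexx orbT.
have dd1 w : cmod (w - z0) < d -> cmod (w - z0) < d1.
  by rewrite !lt_min => /andP[/andP[]].
have de w : cmod (w - z0) < d -> cmod (w - z0) < e.
  by rewrite !lt_min => /andP[/andP[]].
have ca0 : 0 < cmod (a z0) / 2 by rewrite divr_gt0 // cmod_gt0.
have cb0 : 0 < cmod (b z0) / 2 by rewrite divr_gt0 // cmod_gt0.
pose M1 := 4 * (2 * (cmod (A z0) + 1) / ((d / 3) ^+ n * (cmod (b z0) / 2))).
pose M2 := 4 * (2 * (cmod (B z0) + 1) / ((d / 3) ^+ m * (cmod (a z0) / 2))).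
exists (d / 6), (Num.max M1 M2); split; first by rewrite divr_gt0.
move=> f Ff.
have d6 : d / 6 <= d by rewrite ltW // sixth_lt.
have fneq w : w != z0 -> cmod (w - z0) < r -> f w <> oquot (A w) (B w).
  by move=> wz wr; rewrite -psiE //; exact: neq.
have aG := admissible_G (merF Ff) r0 discD hA hB AB_neq0 fneq (zeros_ge2 Ff) (poles_ge3 Ff).
have [T0 limT] := Theta_limit aG.
have osc w p q : w != z0 -> cmod (w - z0) < d -> (p != 0) || (q != 0) ->
    f w = oquot p q -> let x := cmod p * cmod (B w) in let y := cmod (A w) * cmod q in
    [/\ 0 <= x, 0 <= y, 0 < x ^+ 2 + y ^+ 2 &
      `|x ^+ 2 / (x ^+ 2 + y ^+ 2) - T0| <= 1 / 4].
  move=> wz wd pq fE x y; have wr := lt_le_trans wd dr.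
  have [small_rt small_osc] := d1P _ (cmod_ge0 _) (dd1 _ wd).
  have oscw := Theta_osc r2 r2r aG limT wz small_rt.
  have dnz := den_neq0 AB_neq0 fneq wz wr pq fE.
  have GE := G_oquot AB_neq0 fneq wz wr pq fE.
  rewrite GE Theta_ratio // -/x -/y in oscw.
  split.
  - by rewrite mulr_ge0 ?cmod_ge0.
  - by rewrite mulr_ge0 ?cmod_ge0.
  - rewrite lt_def addr_ge0 ?sqr_ge0 // andbT paddr_eq0 ?sqr_ge0 // !sqrf_eq0.
    rewrite /x /y -!cmodM !cmod_eq0; apply/negP => /andP[/eqP E1 /eqP E2].
    by rewrite E1 E2 subrr eqxx in dnz.
  exact: le_trans oscw small_osc.
(* [T0] depends on [f], but its side of [1 / 2] is enough: [Theta] is then at most [3 / 4], or at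
   least [1 / 4], on a punctured disc chosen before [f]. *)
have [T12|T12] := leP T0 (1 / 2).
  left; have [|h hh [fE hle]] := @finite_case f d Ff d0 dr.
    move=> w p q wz wd pq fE; have [x0 y0 xy] := osc w p q wz wd pq fE.
    rewrite ler_norml => /andP[_ h2]; apply: ratio_le => //.
    by move: h2 T12; lra.
  exists h; first exact: holD_le hh.
  move=> w w6; split; first by apply: fE; exact: lt_le_trans d6.
  rewrite le_max; apply/orP; left.
  apply: (@annulus_bound z0 d _ _ n h A B b) => //.
  by move=> u /de/eP[].
right; have [|h hh [fE hle]] := @infinite_case f d Ff d0 dr.
  move=> w p q wz wd pq fE; have [x0 y0 xy] := osc w p q wz wd pq fE.
  rewrite ler_norml => /andP[h1 _]; apply: ratio_ge => //.
  by move: h1 T12; lra.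
exists h; first exact: holD_le hh.
move=> w w6; split; first by apply: fE; exact: lt_le_trans d6.
rewrite le_max; apply/orP; right.
apply: (@annulus_bound z0 d _ _ m h B A a) => //.
by move=> u /de/eP[].
Unshelve. all: by end_near. Qed.

End AtPoint.

(** Coincidence of one member [f0] with [psi] is the vanishing of the holomorphic cross product
    [P * B - A * Q], which is identical near [z0] or absent from a punctured disc. As [psi] is
    shared, the same alternative holds for every member on the same disc. *)
Lemma family_locally_bounded z0 : D z0 -> locally_bounded F z0.
Proof.
move=> Dz0; have [_ cD oD] := domD.
have [[f0 Ff0]|nF] := pselect (exists f, F f); last first.
  by exists 1, 0; split=> // f Ff; case: nF; exists f.
have [r [A [B [a [b [m [n [r0 [hA hB] psiE [ha hb ab0 ABE] alt]]]]]]]] :=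
  mero_quot_rep oD cD merpsi psi_neq0 Dz0.
have [rD rD0 rDP] := openCP oD Dz0.
have [s [h [s0 hh alt0]]] := mero_cases (merF Ff0) Dz0.
pose P w := if pselect (forall w, cmod (w - z0) < s -> f0 w = oquot (h w) 1) then h w else 1.
pose Q w := if pselect (forall w, cmod (w - z0) < s -> f0 w = oquot (h w) 1) then 1 else h w.
have [fE hP hQ PQ] : [/\ forall w, cmod (w - z0) < s -> f0 w = oquot (P w) (Q w),
    holD P z0 s, holD Q z0 s & forall w, (P w != 0) || (Q w != 0)].
  rewrite /P /Q; case: pselect => [fE|nfE].
    by split=> //; [move=> w _; exact: cder_cst|move=> w; rewrite oner_neq0 orbT].
  case: alt0 => [//|[hz hn fE]].
  by split=> //; [move=> w _; exact: cder_cst|move=> w; rewrite oner_neq0].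
have AE w : A w = (w - z0) ^+ m * a w by case: (ABE w).
have BE w : B w = (w - z0) ^+ n * b w by case: (ABE w).
pose t := Num.min (Num.min s r) rD.
have t0 : 0 < t by rewrite !lt_min s0 r0.
have ts : t <= s by rewrite !ge_min lexx.
have tr : t <= r by rewrite !ge_min lexx orbT.
have tD : t <= rD by rewrite !ge_min lexx orbT.
have hM : holD (fun w => P w * B w - A w * Q w) z0 t.
  move=> w wt; have ws := lt_le_trans wt ts; have wr := lt_le_trans wt tr.
  by apply: cderB; apply: cderM; [exact: hP|exact: hB|exact: hA|exact: hQ].
have eqE w : cmod (w - z0) < t -> (f0 w = psi w) <-> (P w * B w - A w * Q w = 0).
  move=> wt; have ws := lt_le_trans wt ts; have wr := lt_le_trans wt tr.
  rewrite fE // psiE // oquot_eq //; last exact: (nz_any alt).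
  by split=> [->|/eqP]; rewrite ?subrr // subr_eq0 => /eqP.
have discD x : x <= t -> forall w, cmod (w - z0) < x -> D w.
  by move=> xt w wx; apply: rDP; exact: lt_le_trans (lt_le_trans wx xt) tD.
have sub x : x <= t -> x <= r by move=> /le_trans; apply.
case: (zero_factor t0 hM) => [M0|[k [g [hg g0 ME]]]].
  have t3 : t / 3 <= t by move: t0; lra.
  have t30 : 0 < t / 3 by rewrite divr_gt0.
  apply: (@bounded_if_equal z0 (t / 3) A B m n t30 (discD _ t3)
    (holD_le (sub _ t3) hA) (holD_le (sub _ t3) hB) _ alt f0 (t / 3)) => //.
    by move=> w wt; apply: psiE; exact: lt_le_trans (sub _ t3).
  by move=> w wt; apply/eqE; [exact: lt_le_trans t3|exact: M0].
have [d d0 [dt dP]] := nonzero_near t0 hg g0.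
apply: (@bounded_if_neq z0 d A B a b m n d0 (discD _ dt)
  (holD_le (sub _ dt) hA) (holD_le (sub _ dt) hB) _
  (holD_le (sub _ dt) ha) (holD_le (sub _ dt) hb) _ AE BE alt).
- by move=> w wd; apply: psiE; exact: lt_le_trans (sub _ dt).
- by move=> w wd; apply: ab0; exact: lt_le_trans (sub _ dt).
move=> f Ff w wz wd fw; have wt := lt_le_trans wd dt.
have : f0 w = psi w by apply: (share_eq Ff Ff0 (discD _ (lexx t) _ wt)).
move=> /(eqE _ wt) /eqP; rewrite ME mulf_eq0 (negbTE (dP w wd)) orbF.
by rewrite expf_eq0 subr_eq0 (negbTE wz) andbF.
Qed.

End LocallyBounded.

(** * Normality *)

Section Normality.
Variable R : realType.
Notation C := R[i].
Implicit Types (z w p q : C) (h : C -> C) (D K : set C).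

Lemma chordal_fin p q : chordal (oquot p 1) (oquot q 1) <= cmod (p - q).
Proof.
rewrite !oquot1 /chordal ler_pdivrMr; last first.
  by rewrite mulr_gt0 // sqrtr_gt0 ltr_pwDl // sqr_ge0.
rewrite -[leLHS]mulr1 ler_wpM2l ?cmod_ge0 // -[leLHS]mulr1.
by apply: ler_pM => //; rewrite -[leLHS]sqrtr1; apply: ler_wsqrtr; rewrite lerDl sqr_ge0.
Qed.

(** Inversion is an isometry of the chordal metric; only the value infinity, at [p = 0] or [q = 0],
    is computed apart. *)
Lemma chordal_inf p q : chordal (oquot 1 p) (oquot 1 q) <= cmod (p - q).
Proof.
pose s (x : C) : R := Num.sqrt (1 + cmod x ^+ 2).
have sp x : 0 < s x by rewrite sqrtr_gt0 ltr_pwDl // sqr_ge0.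
have s1 x : 1 <= s x.
  by rewrite -[leLHS]sqrtr1; apply: ler_wsqrtr; rewrite lerDl sqr_ge0.
have inv x : x != 0 -> s x^-1 = s x / cmod x.
  move=> x0; have cx : 0 < cmod x by rewrite cmod_gt0.
  rewrite /s; have -> : 1 + cmod x^-1 ^+ 2 = (1 + cmod x ^+ 2) / cmod x ^+ 2.
    by rewrite cmodV; field; rewrite gt_eqF.
  by rewrite sqrtrM ?addr_ge0 ?sqr_ge0 // -exprVn sqrtr_sqr ger0_norm // invr_ge0 ltW.
have half x : x != 0 -> (s x^-1)^-1 <= cmod x.
  move=> x0; rewrite inv // invf_div ler_pdivrMr //.
  by rewrite ler_peMr ?cmod_ge0.
rewrite /oquot; have [->|p0] := eqVneq p 0; have [->|q0] := eqVneq q 0 => /=.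
- exact: cmod_ge0.
- by rewrite sub0r cmodN mul1r; exact: half.
- by rewrite subr0 mul1r; exact: half.
rewrite !mul1r -/(s p^-1) -/(s q^-1) !inv //.
have cp : 0 < cmod p by rewrite cmod_gt0.
have cq : 0 < cmod q by rewrite cmod_gt0.
have -> : p^-1 - q^-1 = (q - p) / (p * q) by field; rewrite p0 q0.
rewrite cmodM cmodV cmodM [cmod (q - p)]cmodB.
have -> : cmod (p - q) / (cmod p * cmod q) / (s p / cmod p * (s q / cmod q)) =
  cmod (p - q) / (s p * s q).
  have := sp p; have := sp q; move: (s p) (s q) => x y y0 x0.
  by field; rewrite !gt_eqF.
rewrite ler_pdivrMr ?mulr_gt0 // -[leLHS]mulr1 ler_wpM2l ?cmod_ge0 // -[leLHS]mulr1.
by apply: ler_pM.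
Qed.

Lemma chordal_ge0 (a b : option C) : 0 <= chordal a b.
Proof.
by case: a => [x|]; case: b => [y|] //=;
  rewrite ?mulr_ge0 ?invr_ge0 ?mulr_ge0 ?sqrtr_ge0 ?cmod_ge0.
Qed.

Lemma spherical_small (e : R) : 0 < e -> exists2 d, 0 < d &
  forall a b : option C, chordal a b < d -> spherical a b < e.
Proof.
move=> e0; have e2 : 0 < e / 2 by rewrite divr_gt0.
have h01 : ((-1 : R) < 0) && ((0 : R) < 1) by rewrite ltrN10 ltr01.
have := @continuous_asin R 0 h01 => /cvgrPdist_lt/(_ _ e2) [d /= d0 dP].
exists d => // a b ab; rewrite /spherical mulrC -ltr_pdivlMr //.
have a0 : asin (0 : R) = 0.
  rewrite -{1}[0](@sin0 R) sinK // in_itv /= oppr_le0 andbb.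
  by rewrite divr_ge0 // pi_ge0.
have := dP (chordal a b); rewrite /= sub0r normrN ger0_norm ?chordal_ge0 // a0 sub0r normrN.
by move=> /(_ ab); apply: le_lt_trans; exact: ler_norm.
Qed.

(** * Limits along an ultrafilter *)

Section UltraLimit.
Context (U : set_system nat) (UU : UltraFilter U).

Let PU : ProperFilter U. Proof. exact: ultra_proper. Qed.
Let FU : Filter U. Proof. exact: PU. Qed.

(** Compactness provides a cluster point. An ultrafilter contains each set or its complement, so a
    cluster point is a limit. *)
Lemma ultra_bounded_limit (x : nat -> C) (M : R) :
  U [set n | cmod (x n) <= M] ->
  exists p, forall e, 0 < e -> U [set n | cmod (x n - p) < e].
Proof.
move=> xM; pose K := [set w : C | cmod (w - 0) <= M].
have cK : compact K by exact: compact_disc.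
have FK : (x @ U) K.
  by apply: (filterS _ xM) => n xn; rewrite /K /= subr0; exact: xn.
have [p [_ clp]] := cK (x @ U) _ FK.
exists p => e e0; have [//|nU] := in_ultra_setVsetC [set n | cmod (x n - p) < e] UU.
have n1 : nbhs p [set w | cmod (w - p) < e] by apply/nbhsCP; exists e.
have n2 : (x @ U) [set w | ~ cmod (w - p) < e] by exact: nU.
by have [w [/= w1 w2]] := clp _ _ n2 n1.
Qed.

(** Arzela-Ascoli without subsequences: the pointwise limit inherits the Lipschitz constant, and
    compactness of the disc turns pointwise into uniform convergence along [U]. *)
Lemma uniform_on_disc (fs : nat -> C -> C) (f : C -> C) z0 (r L : R) : 0 <= L ->
  (\forall n \near U, forall w w', cmod (w - z0) <= r -> cmod (w' - z0) <= r ->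
     cmod (fs n w - fs n w') <= L * cmod (w - w')) ->
  (forall w, cmod (w - z0) <= r -> forall e, 0 < e -> U [set n | cmod (fs n w - f w) < e]) ->
  forall e, 0 < e -> \forall n \near U,
    forall w, cmod (w - z0) <= r -> cmod (fs n w - f w) < e.
Proof.
move=> L0 lip cvf e e0.
have L1 : 0 < L + 1 by rewrite ltr_wpDl.
have e4 : 0 < e / 4 by rewrite divr_gt0.
have lipf w w' : cmod (w - z0) <= r -> cmod (w' - z0) <= r ->
    cmod (f w - f w') <= L * cmod (w - w').
  move=> wr wr'; apply/ler_addgt0Pr => d d0; have d2 : 0 < d / 2 by rewrite divr_gt0.
  have [n [l1 [l2 l3]]] := filter_ex (filterI lip (filterI (cvf w wr _ d2) (cvf w' wr' _ d2))).
  have := l1 w w' wr wr'; move: l2 l3 => /=.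
  have := cmod_tri (f w) (fs n w) (f w'); have := cmod_tri (fs n w) (fs n w') (f w').
  by rewrite [cmod (f w - fs n w)]cmodB; lra.
have /compact_near_coveringP cov := @compact_disc R z0 r.
have H := cov nat U (fun n w => cmod (w - z0) <= r -> cmod (fs n w - f w) < e) FU.
apply: filterS (H _) => [n Hn w wr|w wr]; first exact: Hn.
exists ([set w' | cmod (w' - w) < e / (4 * (L + 1))],
  [set n | (forall w w', cmod (w - z0) <= r -> cmod (w' - z0) <= r ->
     cmod (fs n w - fs n w') <= L * cmod (w - w')) /\ cmod (fs n w - f w) < e / 4]).
  split=> /=; last exact: filterI lip (cvf w wr _ e4).
  by apply/nbhsCP; exists (e / (4 * (L + 1))) => //; rewrite divr_gt0 // mulr_gt0.
move=> [w' n] [/= w'w [ln cn]] wr'.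
have h1 := ln w' w wr' wr; have h2 := lipf w w' wr wr'.
have h3 : L * cmod (w' - w) <= e / 4.
  move: w'w; rewrite invfM mulrA ltr_pdivlMr // mulrC => h.
  apply: le_trans (ltW h); rewrite ler_wpM2r ?cmod_ge0 //; lra.
have := cmod_tri (fs n w') (fs n w) (f w'); have := cmod_tri (fs n w) (f w) (f w').
by move: h2; rewrite [cmod (w - w')]cmodB; lra.
Qed.

Variable u : nat -> C -> option C.

Definition orep (fin : bool) (p : C) := if fin then oquot p 1 else oquot 1 p.

(** Convergence along [U] on the sphere, written without choosing between [f] and [1 / f], so that
    the limits found on overlapping discs agree. In the clause for infinity a pole of [u n] counts
    as a large value. *)
Definition ulim w (o : option C) :=
  if o is Some p then forall e, 0 < e ->
    U [set n | exists2 x, u n w = Some x & cmod (x - p) < e]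
  else forall e : R, U [set n | forall x, u n w = Some x -> e < cmod x].

Lemma ulim_uniq w o o' : ulim w o -> ulim w o' -> o = o'.
Proof.
have mix p : ulim w (Some p) -> ulim w None -> False.
  move=> /(_ 1 ltr01) h1 /(_ (cmod p + 1)) h2.
  have [n [[x xE x1] /(_ _ xE) x2]] := filter_ex (filterI h1 h2).
  by have := cmod_sub_le x p; lra.
case: o => [p|]; case: o' => [q|] // h1 h2.
- congr Some; apply/eqP; rewrite -subr_eq0 -cmod_eq0 eq_le cmod_ge0 andbT.
  apply/ler_addgt0Pr => e e0; rewrite add0r; have e2 : 0 < e / 2 by rewrite divr_gt0.
  have [n [[x xE x1] [y yE y1]]] := filter_ex (filterI (h1 _ e2) (h2 _ e2)).
  move: yE y1; rewrite xE => -[<-] y1.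
  by have := cmod_tri p x q; rewrite [cmod (p - x)]cmodB; lra.
- by case: (mix _ h1 h2).
- by case: (mix _ h2 h1).
Qed.

Lemma ulim_orep w fin (fs : nat -> C) p :
  (forall e, 0 < e -> U [set n | u n w = orep fin (fs n) /\ cmod (fs n - p) < e]) ->
  ulim w (orep fin p).
Proof.
move=> cvf; case: fin cvf => cvf.
  rewrite /orep oquot1 => e e0; apply: filterS (cvf e e0) => n [E h].
  by exists (fs n) => //; rewrite E /orep oquot1.
rewrite /orep /oquot; have [p0|p0] := eqVneq p 0.
  move=> e; have e1 : 0 < (`|e| + 1)^-1 by rewrite invr_gt0 ltr_wpDl.
  apply: filterS (cvf _ e1) => n [E]; rewrite p0 subr0 => h x; rewrite E /orep /oquot.
  have [//|f0] := eqVneq (fs n) 0; move=> -[<-]; rewrite mul1r cmodV.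
  apply: (@le_lt_trans _ _ `|e|); first exact: ler_norm.
  apply: (@lt_trans _ _ (`|e| + 1)); first by rewrite ltrDl.
  by rewrite -[ltLHS]invrK ltf_pV2 ?posrE ?cmod_gt0.
move=> e e0; have cp : 0 < cmod p by rewrite cmod_gt0.
have d0 : 0 < Num.min (cmod p / 2) (e * (cmod p * (cmod p / 2))).
  by rewrite lt_min divr_gt0 //= mulr_gt0 // mulr_gt0 // divr_gt0.
apply: filterS (cvf _ d0) => n [E]; rewrite lt_min => /andP[h1 h2].
have fl : cmod p / 2 < cmod (fs n).
  by have := cmod_sub_le p (fs n); rewrite cmodB; lra.
have f0 : fs n != 0 by rewrite -cmod_gt0; lra.
exists (fs n)^-1; first by rewrite E /orep /oquot (negbTE f0) mul1r.
rewrite mul1r; have -> : (fs n)^-1 - p^-1 = (p - fs n) / (p * fs n).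
  by field; rewrite p0 f0.
rewrite cmodM cmodV cmodM cmodB ltr_pdivrMr; last by rewrite mulr_gt0 // cmod_gt0.
apply: (lt_trans h2); rewrite ltr_pM2l // ltr_pM2l //.
Qed.

(** [U] decides, for all indices of one of its sets, which of [f] and [1 / f] is bounded; what
    remains concerns bounded holomorphic functions. *)
Lemma local_limit (F : set (C -> option C)) z0 :
  (forall n, F (u n)) -> locally_bounded F z0 ->
  exists s fin (hl : C -> C) (fs : nat -> C -> C), [/\ 0 < s, holD hl z0 s &
    forall e, 0 < e -> U [set n | forall w, cmod (w - z0) < s ->
      u n w = orep fin (fs n w) /\ cmod (fs n w - hl w) < e]].
Proof.
move=> Fu [r [M [r0 lb]]].
have E n : exists bh : bool * (C -> C), holD bh.2 z0 r /\
    forall w, cmod (w - z0) < r -> u n w = orep bh.1 (bh.2 w) /\ cmod (bh.2 w) <= M.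
  case: (lb _ (Fu n)) => [[h hh hP]|[h hh hP]]; first by exists (true, h).
  by exists (false, h).
have [bh bhP] := choice E.
have [fin finU] : exists fin, U [set n | (bh n).1 = fin].
  have [h|h] := in_ultra_setVsetC [set n | (bh n).1 = true] UU; first by exists true.
  by exists false; apply: filterS h => n /=; case: (bh n).1.
pose fs n := (bh n).2.
have fsM n w : cmod (w - z0) < r -> cmod (fs n w) <= M by move=> /((bhP n).2 w)[].
have M0 : 0 <= M.
  by apply: le_trans (cmod_ge0 (fs 0%N z0)) _; apply: fsM; rewrite subrr cmod0.
have Ul w : exists p, cmod (w - z0) < r -> forall e, 0 < e -> U [set n | cmod (fs n w - p) < e].
  have [wr|] := boolP (cmod (w - z0) < r); last by exists 0.
  have [|p pP] := @ultra_bounded_limit (fun n => fs n w) M.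
    by apply: filterS filterT => n _; exact: fsM.
  by exists p.
have [hl hlP] := choice Ul.
have r6 : 0 < r / 6 by rewrite divr_gt0.
have r6r : r / 6 < r by exact: sixth_lt.
have L0 : 0 <= 24 * M / r by rewrite divr_ge0 ?mulr_ge0 // ltW.
have lip n w w' : cmod (w - z0) <= r / 6 -> cmod (w' - z0) <= r / 6 ->
    cmod (fs n w - fs n w') <= 24 * M / r * cmod (w - w').
  move=> wr wr'; apply: (cauchy_lip r0 (bhP n).1) => //.
  by move=> v _ vr; exact: fsM.
have unif := @uniform_on_disc fs hl z0 (r / 6) (24 * M / r) L0 _ _.
have {}unif : forall e, 0 < e -> \forall n \near U,
    forall w, cmod (w - z0) <= r / 6 -> cmod (fs n w - hl w) < e.
  apply: unif; first by apply: filterS filterT => n _; exact: lip.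
  by move=> w wr; apply: hlP; exact: le_lt_trans r6r.
have hhl : holD hl z0 (r / 6 / 3).
  apply: (@hol_uniform_limit _ _ U _ fs hl z0 (r / 6) r6).
    apply: filterS filterT => n _; apply: holD_le (bhP n).1; exact: ltW.
  move=> e e0; apply: filterS (unif e e0) => n nP w /ltW; exact: nP.
have s0 : 0 < r / 6 / 3 by rewrite divr_gt0.
exists (r / 6 / 3), fin, hl, fs; split=> // e e0.
apply: filterS (filterI finU (unif e e0)) => n [nf nP] w ws.
have w6 := lt_third r6 ws.
split; last by apply: nP; exact: ltW.
by rewrite -nf; case: ((bhP n).2 w (lt_trans w6 r6r)).
Qed.

End UltraLimit.

(** * Exhaustion of the domain and extraction of a subsequence *)

Section ExhaustionAndLimit.
Variable D : set C.
Hypothesis domD : domain D.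

Let oD : open D. Proof. by case: domD. Qed.

(** The distance to the complement is bounded below pointwise, so that the case of the whole plane
    needs no convention. *)
Definition exhaust (j : nat) : set C :=
  [set z | cmod (z - 0) <= j%:R /\ forall w, ~ D w -> j.+1%:R^-1 <= cmod (z - w)].

Lemma exhaust_sub j : exhaust j `<=` D.
Proof.
move=> z [_ zP]; apply: contrapT => nDz; have := zP z nDz.
by rewrite subrr cmod0 leNgt invr_gt0 ltr0n.
Qed.

Lemma compact_exhaust j : compact (exhaust j).
Proof.
apply: subclosed_compact (@compact_disc R 0 j%:R) _; last by move=> z [].
have -> : exhaust j = [set z : C | cmod (z - 0) <= j%:R] `&`
    [set z | forall w, ~ D w -> j.+1%:R^-1 <= cmod (z - w)] by apply/seteqP; split.
apply: closedI; first exact: closed_disc_closed.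
rewrite -openC openE => z /existsNP[w /not_implyP[nDw /negP]].
rewrite -ltNge => zw; apply/nbhsCP; exists (j.+1%:R^-1 - cmod (z - w)).
  by rewrite subr_gt0.
move=> v vz /= /(_ w nDw); apply/negP; rewrite -ltNge.
have := cmod_tri v z w; move: vz; move: (cmod (v - z)) (cmod (z - w)) (cmod (v - w)).
by move: (j.+1%:R^-1) => x a b c; lra.
Qed.

Lemma exhaustP K : compact K -> K `<=` D -> \forall j \near \oo, K `<=` exhaust j.
Proof.
move=> /compact_near_coveringP cov KD.
have H := cov nat \oo (fun j z => exhaust j z) _.
apply: H => z Kz; have [r r0 rP] := openCP oD (KD _ Kz).
have r2 : 0 < r / 2 by rewrite divr_gt0.
pose N := Num.bound (cmod z + r + 2 / r).
exists ([set w | cmod (w - z) < r / 2], [set j | (N <= j)%N]).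
  split; first by apply/nbhsCP; exists (r / 2).
  by exists N.
move=> [w j] [/= wz Nj].
have b0 : 0 <= cmod z + r + 2 / r by rewrite !addr_ge0 ?cmod_ge0 ?divr_ge0 // ltW.
have jb : cmod z + r + 2 / r < j%:R.
  by apply: lt_le_trans (archi_boundP b0) _; rewrite ler_nat.
have r2p : 0 < 2 / r by rewrite divr_gt0.
have z0 := cmod_ge0 z.
split.
  by rewrite subr0; have := cmod_sub_le w z; move: wz jb r2p; lra.
move=> v nDv; have h1 : r <= cmod (v - z).
  by rewrite leNgt; apply/negP => /rP.
have h2 : r / 2 <= cmod (w - v).
  by have := cmod_tri v w z; rewrite [cmod (v - w)]cmodB; move: wz; lra.
apply: le_trans h2; rewrite -[leRHS]invrK lef_pV2 ?posrE ?invr_gt0 ?ltr0n //.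
rewrite invf_div; apply: (@le_trans _ _ j%:R); last by rewrite ler_nat.
by move: jb; lra.
Qed.

(** The limit [g] is defined at all points along a single ultrafilter on the indices, so its local
    descriptions need no gluing. A subsequence is extracted at the end, from the nonemptiness of the
    sets of [U]. *)
Lemma normal_of_locally_bounded (F : set (C -> option C)) :
  (forall z, D z -> locally_bounded F z) -> normal_family D F.
Proof.
move=> lb u Fu; have [_ cD _] := domD.
(* [U] refines the filter at infinity, so its sets contain arbitrarily large indices. *)
have [U [UU sU]] := @ultraFilterLemma nat \oo _.
have PU : ProperFilter U by exact: ultra_proper.
pose g w := xget None [set o | ulim U u w o].
have gE w o : ulim U u w o -> g w = o.
  move=> ho; rewrite /g; case: xgetP => [x -> hx|/(_ o)/(_ ho) []].
  exact: ulim_uniq hx ho.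
have loc z0 : D z0 -> exists s fin (hl : C -> C) (fs : nat -> C -> C), [/\ 0 < s,
    holD hl z0 s, forall e, 0 < e -> U [set n | forall w, cmod (w - z0) < s ->
      u n w = orep fin (fs n w) /\ cmod (fs n w - hl w) < e] &
    forall w, cmod (w - z0) < s -> g w = orep fin (hl w)].
  move=> /lb lbz; have [s [fin [hl [fs [s0 hh cvf]]]]] := local_limit UU Fu lbz.
  exists s, fin, hl, fs; split=> // w ws; apply: gE.
  apply: (@ulim_orep U UU u w fin (fun n => fs n w)) => e e0.
  by apply: filterS (cvf e e0) => n /(_ w ws).
(* This feeds the dichotomy that separates the two admissible limits: the constant infinity, or a
   function with isolated poles. *)
have alt z : D z -> (\forall w \near z, g w = None) \/ (\forall w \near z^', ~ g w = None).
  move=> Dz; have [s [fin [hl [fs [s0 hh _ gP]]]]] := loc z Dz.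
  case: fin gP => gP.
    by right; apply/dnbhsCP; exists s => // w _ /gP ->; rewrite /orep oquot1.
  case: (zero_factor s0 hh) => [h0|[m [k [hk k0 hE]]]].
    left; apply/nbhsCP; exists (s / 3); first by rewrite divr_gt0.
    by move=> w ws; rewrite gP ?(lt_third s0) // h0 // /orep /oquot eqxx.
  right; have [d d0 [dr dP]] := nonzero_near s0 hk k0.
  apply/dnbhsCP; exists d => // w wz wd; rewrite gP ?(lt_le_trans wd) // /orep /oquot.
  rewrite hE mulf_eq0 (negbTE (dP w wd)) orbF expf_eq0 subr_eq0.
  by rewrite (negbTE wz) andbF.
have merg : meromorphic D g \/ (forall z, D z -> g z = None).
  case: (dichotomy oD cD alt) => [gN|gN]; first by right=> z /gN/nbhs_singleton.
  left=> z Dz; have [s [fin [hl [fs [s0 hh _ gP]]]]] := loc z Dz.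
  have zs : cmod (z - z) < s by rewrite subrr cmod0.
  case: fin gP => gP.
    left; exists hl; first by apply/holomorphic_at_holD; exists s.
    by apply/nbhsCP; exists s => // w /gP ->; rewrite /orep oquot1.
  have [hz|hz] := eqVneq (hl z) 0; last first.
    left; have [d d0 [dr dP]] := nonzero_near s0 hh hz.
    exists (fun w => (hl w)^-1).
      apply/holomorphic_at_holD; exists d => // w wd; apply: cderV; first exact: dP.
      by apply: hh; exact: lt_le_trans dr.
    apply/nbhsCP; exists d => // w wd; rewrite gP ?(lt_le_trans wd) // /orep /oquot.
    by rewrite (negbTE (dP w wd)) mul1r.
  right; split; first by rewrite gP // hz /orep /oquot eqxx.
  have /dnbhsCP[d d0 dP] := gN z Dz.
  have hn w : w != z -> cmod (w - z) < Num.min s d -> hl w != 0.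
    move=> wz; rewrite lt_min => /andP[ws wd]; apply/eqP => hw.
    by apply: (dP w wz wd); rewrite gP // hw /orep /oquot eqxx.
  exists (fun w => (hl w)^-1).
    apply/dnbhsCP; exists (Num.min s d); first by rewrite lt_min s0.
    move=> w wz wsd; have h0 := hn w wz wsd; move: wsd; rewrite lt_min => /andP[ws wd].
    split; first by rewrite gP // /orep /oquot (negbTE h0) mul1r.
    by apply/derivableCP; apply: cderV => //; exact: hh.
  apply/cvgryPge => K; apply/dnbhsCP.
  have K1 : 0 < (`|K| + 1)^-1 by rewrite invr_gt0 ltr_wpDl.
  have /ccontCP/(_ _ K1)[d2 d20 d2P] := cder_ccont (hh _ zs).
  exists (Num.min (Num.min s d) d2); first by rewrite !lt_min s0 d0.
  move=> w wz; rewrite lt_min => /andP[wsd /d2P]; rewrite hz subr0 cmodV => h.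
  apply: (le_trans (ler_norm K)); apply: (@le_trans _ _ (`|K| + 1)); first by rewrite lerDl.
  by rewrite ltW // -[ltLHS]invrK ltf_pV2 ?posrE // cmod_gt0 hn.
have unifK j : U [set n | forall z, exhaust j z -> spherical (u n z) (g z) < j.+1%:R^-1].
  have e0 : 0 < j.+1%:R^-1 :> R by rewrite invr_gt0 ltr0n.
  have [d d0 dP] := spherical_small e0.
  have /compact_near_coveringP cov := @compact_exhaust j.
  have H := cov nat U (fun n z => spherical (u n z) (g z) < j.+1%:R^-1) _.
  apply: H => z /exhaust_sub Dz.
  have [s [fin [hl [fs [s0 hh cvf gP]]]]] := loc z Dz.
  exists ([set w | cmod (w - z) < s], [set n | forall w, cmod (w - z) < s ->
      u n w = orep fin (fs n w) /\ cmod (fs n w - hl w) < d]).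
    by split; [apply/nbhsCP; exists s|exact: cvf].
  move=> [w n] [/= ws nP]; apply: dP; have [-> h] := nP w ws; rewrite gP //.
  by apply: le_lt_trans h; case: (fin); [exact: chordal_fin|exact: chordal_inf].
(* Diagonal choice: an index beyond the previous one [jN.2], with error below [1 / (j + 1)] on the
   compact set of rank [j = jN.1]. *)
have pick (jN : nat * nat) : exists n, (jN.2 < n)%N /\
    forall z, exhaust jN.1 z -> spherical (u n z) (g z) < jN.1.+1%:R^-1.
  have tl : U [set n | (jN.2 < n)%N] by apply: sU; exists jN.2.+1.
  by have [n [h1 h2]] := filter_ex (filterI tl (unifK jN.1)); exists n.
have [pk pkP] := choice pick.
pose phi := fix phi j := if j is i.+1 then pk (i.+1, phi i) else pk (0, 0)%N.
have phiP j : forall z, exhaust j z -> spherical (u (phi j) z) (g z) < j.+1%:R^-1.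
  by case: j => [|j]; [exact: (pkP (0, 0)%N).2|exact: (pkP (j.+1, phi j)).2].
exists phi; split.
  by apply: homo_ltn => [|j]; [exact: ltn_trans|exact: (pkP (j.+1, phi j)).1].
exists g; split=> // K cK KD e e0.
have [N1 _ N1P] := exhaustP cK KD.
pose N2 := Num.bound e^-1.
have ei : 0 <= e^-1 by rewrite invr_ge0 ltW.
exists (maxn N1 N2) => // j; rewrite /= geq_max => /andP[j1 j2] z Kz.
apply: (lt_trans (phiP j z (N1P j j1 z Kz))).
rewrite -[ltRHS]invrK ltf_pV2 ?posrE ?invr_gt0 ?ltr0n //.
by apply: lt_le_trans (archi_boundP ei) _; rewrite ler_nat ltnW.
Qed.

End ExhaustionAndLimit.
End Normality.

Theorem theorem1p6 (R : realType) (D : set R[i])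
  (F : set (R[i] -> option R[i])) (psi : R[i] -> option R[i])
  (domD : domain D)
  (merF : forall f, F f -> meromorphic D f)
  (merpsi : meromorphic D psi)
  (psi_neq0 : ~ (forall z, D z -> psi z = Some 0))
  (psi_neqoo : ~ (forall z, D z -> psi z = None))
  (zeros_ge2 : forall f, F f -> forall z m, D z ->
     zero_mult f z m -> (2 <= m)%N)
  (poles_ge3 : forall f, F f -> forall z m, D z ->
     pole_mult f z m -> (3 <= m)%N)
  (common_zeros : forall f, F f -> forall z m n, D z ->
     zero_mult f z m -> zero_mult psi z n -> (n < m)%N)
  (common_poles : forall f, F f -> forall z m n, D z ->
     pole_mult f z m -> pole_mult psi z n -> (n < m)%N)
  (sharepsi : forall f g, F f -> F g -> share D f g psi) :
  normal_family D F.
Proof.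
apply: (normal_of_locally_bounded domD) => z Dz.
exact: (family_locally_bounded domD merF merpsi psi_neq0 zeros_ge2 poles_ge3
  common_zeros common_poles sharepsi Dz).
Qed.
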